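(* Let $p>1$ and let $\mathcal{M}$ be a closed maximal ideal in $F^p$. Then there exists $\lambda\in\mathbb{D}$ such that $\mathcal{M}=\mathcal{M}_\lambda:=\{f\in F^p: f(\lambda)=0\}$.
   Context: $\mathbb{D}$ denotes the open unit disk in $\mathbb{C}$. For $p>1$, $F^p$ is the space of all holomorphic functions $f$ on $\mathbb{D}$ such that $\lim_{r\to 1^-}(1-r)^{1/p}\log^+M_\infty(r,f)=0$, where $M_\infty(r,f)=\max_{|z|\le r}|f(z)|$ for $0<r<1$ and $\log^+x=\max\{\log x,0\}$. For $f(z)=\sum_{n\ge0}a_nz^n\in F^p$ and $c>0$ one has $\|f\|_{p,c}:=\sum_{n=0}^\infty |a_n|\exp(-c\,n^{1/(p+1)})<\infty$, and $F^p$ carries the locally convex topology given by the family of seminorms $\{\|\cdot\|_{p,c}\}_{c>0}$; with this topology and pointwise multiplication, $F^p$ is a commutative Fréchet algebra. ''Closed'' refers to this topology and ''maximal ideal'' means a proper ideal of the ring $F^p$ not properly contained in any other proper ideal. *)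

(* Defs.v *)
From Stdlib Require Import Reals List ClassicalEpsilon.
From Coquelicot Require Import Coquelicot.
Open Scope R_scope.

Definition disk (z : C) : Prop := Cmod z < 1.

(* A function on the disk is represented by its extension by 0 to C, so that
   Leibniz equality (up to functional extensionality) is equality on the disk. *)
Definition on_disk (f : C -> C) : Prop := forall z, ~ disk z -> f z = RtoC 0.

Definition holomorphic_on_disk (f : C -> C) : Prop :=
  forall z, disk z -> @ex_derive C_AbsRing C_NormedModule f z.

Definition fadd (f g : C -> C) : C -> C := fun z => Cplus (f z) (g z).
Definition fsub (f g : C -> C) : C -> C := fun z => Cminus (f z) (g z).
Definition fmul (f g : C -> C) : C -> C := fun z => Cmult (f z) (g z).
Definition fzero : C -> C := fun _ => RtoC 0.

(* ln is 0 on nonpositive reals, so log_plus 0 = 0. *)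
Definition log_plus (x : R) : R := Rmax (ln x) 0.

(* For f continuous on the disk and 0 < r < 1 this supremum is a maximum. *)
Definition Minf (r : R) (f : C -> C) : R :=
  real (Lub_Rbar (fun y => exists z : C, Cmod z <= r /\ y = Cmod (f z))).

Definition Fp (p : R) (f : C -> C) : Prop :=
  on_disk f /\
  holomorphic_on_disk f /\
  filterlim (fun r => Rpower (1 - r) (1 / p) * log_plus (Minf r f))
            (at_left 1) (locally 0).

Definition power_series_on_disk (a : nat -> C) (f : C -> C) : Prop :=
  forall z, disk z ->
    @is_series C_AbsRing C_NormedModule (fun n => Cmult (a n) (Cpow z n)) (f z).

(* The sequence a with f(z) = sum a_n z^n on the disk; it exists and is unique
   for every f holomorphic on the disk. *)
Definition coeffs (f : C -> C) : nat -> C :=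
  epsilon (inhabits (fun _ => RtoC 0)) (fun a => power_series_on_disk a f).

(* n^q for q > 0; Rpower 0 q is 1, hence the separate case. *)
Definition nat_rpow (n : nat) (q : R) : R :=
  match n with O => 0 | S _ => Rpower (INR n) q end.

(* The sum, in [0, +oo], of a series of nonnegative terms. *)
Definition seminorm (p c : R) (f : C -> C) : Rbar :=
  Lim_seq (sum_n (fun n =>
    Cmod (coeffs f n) * exp (- c * nat_rpow n (1 / (p + 1))))).

(* Open sets of the locally convex topology of F^p defined by the seminorms:
   basic neighbourhoods are given by finitely many c > 0 and a radius. *)
Definition Fp_open (p : R) (U : (C -> C) -> Prop) : Prop :=
  (forall f, U f -> Fp p f) /\
  forall f, U f ->
    exists (cs : list R) (eps : R),
      (forall c, In c cs -> 0 < c) /\ 0 < eps /\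
      forall g, Fp p g ->
        (forall c, In c cs -> Rbar_lt (seminorm p c (fsub g f)) (Finite eps)) ->
        U g.

Definition Fp_closed (p : R) (S : (C -> C) -> Prop) : Prop :=
  (forall f, S f -> Fp p f) /\ Fp_open p (fun f => Fp p f /\ ~ S f).

Definition Fp_ideal (p : R) (I : (C -> C) -> Prop) : Prop :=
  (forall f, I f -> Fp p f) /\
  I fzero /\
  (forall f g, I f -> I g -> I (fadd f g)) /\
  (forall f g, Fp p f -> I g -> I (fmul f g)).

Definition Fp_proper_ideal (p : R) (I : (C -> C) -> Prop) : Prop :=
  Fp_ideal p I /\ exists f, Fp p f /\ ~ I f.

Definition Fp_maximal_ideal (p : R) (I : (C -> C) -> Prop) : Prop :=
  Fp_proper_ideal p I /\
  forall J : (C -> C) -> Prop, Fp_proper_ideal p J ->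
    (forall f, I f -> J f) -> forall f, J f -> I f.

Definition M_at (p : R) (lambda : C) (f : C -> C) : Prop :=
  Fp p f /\ f lambda = RtoC 0.

(* Main.v *)
(** Suppose a closed maximal ideal M of F^p contains no z - a with |a| < 1. Then every z - a is
    invertible modulo M; let g_a be an inverse. Since M is closed there is a continuous linear
    functional phi vanishing on M with phi(1) <> 0 (orthogonal projection in a weighted l^2 norm of
    Taylor coefficients). For w in F^p the resolvent identity
    phi(w g_a) - phi(w g_b) = (a - b) phi(w g_b g_a) makes a |-> phi(w g_a) entire as soon as all these
    functions are locally bounded. F^p is not a Banach algebra, and the delicate points are |a| >= 1:
    if phi(w g_b_n) were unbounded for some b_n -> a, then for b_n converging fast enough
    u = prod (z - b_n)/(z - a) lies in F^p, is close to 1, hence has an inverse w' modulo M, and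
    phi(w g_b_n) = phi(w w' u/(z - b_n)) is bounded after all. So a phi(g_a) is entire, vanishes at 0
    and tends to - phi(1) at infinity, which contradicts the constancy of its circular means.

    Hence some z - a with |a| < 1 lies in M, and dividing f - f(a) by z - a gives M = M_a. *)

Require Import Defs.
From Stdlib Require Import Reals ZArith Lra Lia List Classical ClassicalEpsilon FunctionalExtensionality.
From Coquelicot Require Import Coquelicot.
Open Scope R_scope.

(** Two descriptions of F^p meet here. Products and quotients are estimated through growth, |f(z)|
    <= K exp(eps (1-|z|)^(-1/p)) for every eps > 0, while the topology is given by weighted sums of
    Taylor coefficients. Cauchy's estimate at distance of order n^(-p/(p+1)) from the unit circle
    turns the first into the second; this is where the exponent 1/(p+1) comes from. The functional
    phi is built on the coefficient side, but later enters only through a growth bound with one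
    fixed eps, which each estimate then shares out among the factors of a product. Differentiating a
    |-> phi(w g_a) takes two applications of the resolvent identity, and the remainder contains w
    g_a g_a. Local boundedness is therefore needed for every w, not only for w = 1. When |a| = 1 the
    factors (z - b_n)/(z - a) are singular on the boundary. Their product is held to order
    (1-|z|)^(-1/(2p)) in the exponent, half the critical order, so every eps absorbs it. Only
    circles around 0 serve as contours. In the coordinates exp(s + i t) an annulus becomes a
    rectangle and the integrand is periodic in t, so Goursat's lemma for rectangles is enough. *)

Lemma Cmod_minus_sym (x y : C) : Cmod (x - y) = Cmod (y - x).
Proof. rewrite <- Cmod_opp. f_equal. ring. Qed.

Lemma Cmod_minus_triangle (x y z : C) : Cmod (x - z) <= Cmod (x - y) + Cmod (y - z).
Proof. replace (x - z)%C with ((x - y) + (y - z))%C by ring. apply Cmod_triangle. Qed.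

Lemma Cmod_minus_le (x y : C) : Cmod (x - y) <= Cmod x + Cmod y.
Proof. rewrite <- (Cmod_opp y). apply Cmod_triangle. Qed.

Lemma Cmod_minus_ge (x y : C) : Cmod x - Cmod y <= Cmod (x - y).
Proof.
  assert (H := Cmod_triangle (x - y) y). replace (x - y + y)%C with x in H by ring. lra.
Qed.

Lemma Cmod_le_nonneg (x : C) (t : R) : Cmod x <= t -> 0 <= t.
Proof. apply Rle_trans, Cmod_ge_0. Qed.

Lemma Cmod_pair_le (a b : R) : Cmod (a, b) <= Rabs a + Rabs b.
Proof.
  assert (H := Cmod_triangle (a, 0) (0, b)).
  assert (E : Cplus (a, 0) (0, b) = (a, b)) by (unfold Cplus; simpl; f_equal; ring).
  rewrite E in H. assert (E1 : Cmod (a, 0) = Rabs a) by apply Cmod_R.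
  assert (E2 : Cmod (0, b) = Rabs b).
  { replace ((0, b) : C) with (Cmult Ci (RtoC b)).
    - rewrite Cmod_mult, Cmod_Ci, Cmod_R. ring.
    - unfold Cmult, Ci, RtoC; simpl; f_equal; ring. }
  lra.
Qed.

Lemma im_le_Cmod (c : C) : Rabs (Im c) <= Cmod c.
Proof. eapply Rle_trans; [apply Rmax_r | apply (Rmax_Cmod c)]. Qed.

Lemma Cmod_le_re_im (c : C) : Cmod c <= Rabs (Re c) + Rabs (Im c).
Proof. destruct c. apply Cmod_pair_le. Qed.

(** * Complex differentiability *)

(** The remainder is compared with |y - z| without dividing, so [y = z] needs no exclusion, and the
    definition does not depend on a choice of normed module structure on the target. *)
Definition cderiv (f : C -> C) (z l : C) : Prop :=
  forall eps, 0 < eps -> exists d, 0 < d /\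
    forall y, Cmod (y - z) < d -> Cmod (f y - f z - (y - z) * l) <= eps * Cmod (y - z).

Definition ccont (f : C -> C) (z : C) : Prop :=
  forall eps, 0 < eps -> exists d, 0 < d /\
    forall y, Cmod (y - z) < d -> Cmod (f y - f z) < eps.

Lemma is_derive_cderiv (f : C -> C) (z l : C) :
  @is_derive C_AbsRing C_NormedModule f z l <-> cderiv f z l.
Proof.
  split.
  - intros [_ H] eps He. destruct (H z (fun P h => h) (mkposreal eps He)) as [d Hd].
    exists d. split; [apply cond_pos | exact Hd].
  - intros H. split; [apply is_linear_scal_l|]. intros x Hx.
    assert (Ex : z = x) by (apply (@is_filter_lim_locally_unique C_AbsRing (AbsRing_NormedModule C_AbsRing)); exact Hx).
    subst x. intros eps. destruct (H eps (cond_pos eps)) as (d & Hd & H1).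
    exists (mkposreal d Hd). exact H1.
Qed.

Lemma ex_derive_cderiv (f : C -> C) (z : C) :
  @ex_derive C_AbsRing C_NormedModule f z <-> exists l, cderiv f z l.
Proof.
  split; intros [l H]; exists l; apply is_derive_cderiv; exact H.
Qed.

Lemma cderiv_ccont f z l : cderiv f z l -> ccont f z.
Proof.
  intros H eps He. destruct (H 1 Rlt_0_1) as (d & Hd & H1).
  assert (Hl := Cmod_ge_0 l).
  assert (Hq : 0 < eps / (1 + Cmod l)) by (apply Rdiv_lt_0_compat; lra).
  exists (Rmin d (eps / (1 + Cmod l))). split.
  - apply Rmin_pos; auto.
  - intros y Hy.
    destruct (Rmin_Rgt_l _ _ _ Hy) as [Hy1 Hy2].
    specialize (H1 y Hy1).
    replace (f y - f z)%C with ((f y - f z - (y - z) * l) + (y - z) * l)%C by ring.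
    eapply Rle_lt_trans; [apply Cmod_triangle|]. rewrite Cmod_mult.
    apply Rle_lt_trans with (Cmod (y - z) * (1 + Cmod l)); [lra|].
    apply Rlt_le_trans with (eps / (1 + Cmod l) * (1 + Cmod l)).
    + apply Rmult_lt_compat_r; lra.
    + right. field. lra.
Qed.

Lemma cderiv_local f g z l r : 0 < r ->
  (forall y, Cmod (y - z) < r -> f y = g y) -> cderiv f z l -> cderiv g z l.
Proof.
  intros Hr E H eps He. destruct (H eps He) as (d & Hd & H1).
  exists (Rmin d r). split; [apply Rmin_pos; auto|].
  intros y Hy. rewrite <- !E.
  - apply H1. eapply Rlt_le_trans; [exact Hy | apply Rmin_l].
  - replace (z - z)%C with (RtoC 0) by ring. rewrite Cmod_0. exact Hr.
  - eapply Rlt_le_trans; [exact Hy | apply Rmin_r].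
Qed.

Lemma cderiv_const c z : cderiv (fun _ => c) z 0.
Proof.
  intros eps He. exists 1. split; [lra|]. intros y _.
  replace (c - c - (y - z) * 0)%C with (RtoC 0) by ring. rewrite Cmod_0.
  apply Rmult_le_pos; [lra | apply Cmod_ge_0].
Qed.

Lemma cderiv_id z : cderiv (fun y => y) z 1.
Proof.
  intros eps He. exists 1. split; [lra|]. intros y _.
  replace (y - z - (y - z) * 1)%C with (RtoC 0) by ring. rewrite Cmod_0.
  apply Rmult_le_pos; [lra | apply Cmod_ge_0].
Qed.

Lemma cderiv_plus f g z k l : cderiv f z k -> cderiv g z l ->
  cderiv (fun y => f y + g y)%C z (k + l).
Proof.
  intros Hf Hg. apply is_derive_cderiv.
  apply (@is_derive_plus C_AbsRing C_NormedModule); apply is_derive_cderiv; assumption.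
Qed.

(* [is_derive] depends on the target structure; the chain and product rules are stated for this one. *)
Lemma is_derive_AbsRing_cderiv (f : C -> C) (z l : C) :
  @is_derive C_AbsRing (AbsRing_NormedModule C_AbsRing) f z l <-> cderiv f z l.
Proof.
  split.
  - intros [_ H] eps He. destruct (H z (fun P h => h) (mkposreal eps He)) as [d Hd].
    exists d. split; [apply cond_pos | exact Hd].
  - intros H. split; [apply is_linear_scal_l|]. intros x Hx.
    assert (Ex : z = x) by (apply (@is_filter_lim_locally_unique C_AbsRing (AbsRing_NormedModule C_AbsRing)); exact Hx).
    subst x. intros eps. destruct (H eps (cond_pos eps)) as (d & Hd & H1).
    exists (mkposreal d Hd). exact H1.
Qed.

Lemma cderiv_mult f g z k l : cderiv f z k -> cderiv g z l ->
  cderiv (fun y => f y * g y)%C z (k * g z + f z * l).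
Proof.
  intros Hf Hg. apply is_derive_AbsRing_cderiv.
  apply (@is_derive_mult C_AbsRing f g); [apply is_derive_AbsRing_cderiv; assumption .. | apply Cmult_comm].
Qed.

Lemma cderiv_comp f g z k l : cderiv f (g z) k -> cderiv g z l ->
  cderiv (fun y => f (g y)) z (l * k).
Proof.
  intros Hf Hg. apply is_derive_AbsRing_cderiv.
  apply (@is_derive_comp C_AbsRing (AbsRing_NormedModule C_AbsRing) f g); apply is_derive_AbsRing_cderiv; assumption.
Qed.

Lemma cderiv_inv z : z <> RtoC 0 -> cderiv Cinv z (- (/ z * / z)).
Proof.
  intros Hz eps He. assert (Hm : 0 < Cmod z) by (apply Cmod_gt_0; exact Hz).
  set (m := Cmod z) in *.
  (* The error is (y - z)^2 / (y z^2). The first bound gives |y| > m/2, so its modulus is at most 2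
     |y - z|^2 / m^3, and the second bound makes this at most eps |y - z|. *)
  exists (Rmin (m / 2) (eps * (m * m * m) / 2)). 
  assert (Hm3 : 0 < m * m * m) by (repeat apply Rmult_lt_0_compat; auto).
  split.
  - apply Rmin_pos; [lra|]. apply Rdiv_lt_0_compat; [apply Rmult_lt_0_compat; lra | lra].
  - intros y Hy.
    destruct (Rmin_Rgt_l _ _ _ Hy) as [Hy1 Hy2].
    assert (Hym : m / 2 < Cmod y).
    { assert (H := Cmod_minus_ge z y). rewrite Cmod_minus_sym in H. fold m in H. lra. }
    assert (Hy0 : y <> RtoC 0) by (apply Cmod_gt_0; lra).
    replace (/ y - / z - (y - z) * - (/ z * / z))%C
      with ((y - z) * (y - z) * (/ y * (/ z * / z)))%C by (field; auto).
    rewrite !Cmod_mult, !Cmod_inv by auto. fold m.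
    rewrite Rmult_assoc, (Rmult_comm eps). apply Rmult_le_compat_l; [apply Cmod_ge_0|].
    apply Rle_trans with (eps * (m * m * m) / 2 * (/ (m / 2) * (/ m * / m))).
    + apply Rmult_le_compat; [apply Cmod_ge_0 | | lra |].
      * repeat apply Rmult_le_pos; left; apply Rinv_0_lt_compat; lra.
      * apply Rmult_le_compat_r; [apply Rmult_le_pos; left; apply Rinv_0_lt_compat; lra|].
        apply Rinv_le_contravar; lra.
    + right. field. lra.
Qed.

Lemma ccont_id z : ccont (fun y => y) z.
Proof. apply cderiv_ccont with (RtoC 1), cderiv_id. Qed.

(** * Integrals of complex-valued functions of a real variable *)

Definition pcont (G : R -> C) (t : R) : Prop :=
  forall eps, 0 < eps -> exists d, 0 < d /\
    forall s, Rabs (s - t) < d -> Cmod (G s - G t) < eps.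

Lemma pcont_const c t : pcont (fun _ => c) t.
Proof.
  intros eps He. exists 1. split; [lra|]. intros s _.
  replace (c - c)%C with (RtoC 0) by ring. rewrite Cmod_0. exact He.
Qed.

Lemma pcont_comp f G t : ccont f (G t) -> pcont G t -> pcont (fun s => f (G s)) t.
Proof.
  intros Hf HG eps He. destruct (Hf eps He) as (d & Hd & H1).
  destruct (HG d Hd) as (d' & Hd' & H2). exists d'. split; auto.
Qed.

Lemma pcont_plus F G t : pcont F t -> pcont G t -> pcont (fun s => F s + G s)%C t.
Proof.
  intros HF HG eps He. destruct (HF (eps / 2)) as (d1 & Hd1 & H1); [lra|].
  destruct (HG (eps / 2)) as (d2 & Hd2 & H2); [lra|].
  exists (Rmin d1 d2). split; [apply Rmin_pos; auto|]. intros s Hs.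
  replace (F s + G s - (F t + G t))%C with ((F s - F t) + (G s - G t))%C by ring.
  eapply Rle_lt_trans; [apply Cmod_triangle|].
  assert (A1 := H1 s (Rlt_le_trans _ _ _ Hs (Rmin_l _ _))).
  assert (A2 := H2 s (Rlt_le_trans _ _ _ Hs (Rmin_r _ _))). lra.
Qed.

Lemma Cmult_continuous (a b : C) eps : 0 < eps -> exists d, 0 < d /\
  forall x y, Cmod (x - a) < d -> Cmod (y - b) < d -> Cmod (x * y - a * b) < eps.
Proof.
  intros He. assert (Ha := Cmod_ge_0 a). assert (Hb := Cmod_ge_0 b).
  set (m := 1 + Cmod a + Cmod b).
  exists (Rmin 1 (eps / m)). split; [apply Rmin_pos; [lra | apply Rdiv_lt_0_compat; unfold m; lra]|].
  intros x y Hx Hy. destruct (Rmin_Rgt_l _ _ _ Hx) as [Hx1 Hx2]. destruct (Rmin_Rgt_l _ _ _ Hy) as [Hy1 Hy2].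
  replace (x * y - a * b)%C with ((x - a) * (y - b) + (x - a) * b + a * (y - b))%C by ring.
  eapply Rle_lt_trans; [apply Cmod_triangle|].
  assert (T := Cmod_triangle ((x - a) * (y - b)) ((x - a) * b)). rewrite !Cmod_mult in *.
  assert (Px := Cmod_ge_0 (x - a)). assert (Py := Cmod_ge_0 (y - b)).
  set (e := eps / m) in *. replace eps with (e * 1 + e * Cmod b + Cmod a * e) by (unfold e, m; field; unfold m in *; lra).
  assert (Cmod (x - a) * Cmod (y - b) < e * 1).
  { apply Rle_lt_trans with (Cmod (x - a) * 1); [apply Rmult_le_compat_l|]; lra. }
  assert (Cmod (x - a) * Cmod b <= e * Cmod b) by (apply Rmult_le_compat_r; lra).
  assert (Cmod a * Cmod (y - b) <= Cmod a * e) by (apply Rmult_le_compat_l; lra). lra.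
Qed.

Lemma pcont_mult F G t : pcont F t -> pcont G t -> pcont (fun s => F s * G s)%C t.
Proof.
  intros HF HG eps He. destruct (Cmult_continuous (F t) (G t) eps He) as (d & Hd & H).
  destruct (HF d Hd) as (d1 & Hd1 & H1). destruct (HG d Hd) as (d2 & Hd2 & H2).
  exists (Rmin d1 d2). split; [apply Rmin_pos; auto|]. intros s Hs.
  destruct (Rmin_Rgt_l _ _ _ Hs) as [Hs1 Hs2]. apply H; auto.
Qed.

Lemma pcont_minus F G t : pcont F t -> pcont G t -> pcont (fun s => F s - G s)%C t.
Proof.
  intros HF HG. replace (fun s => F s - G s)%C with (fun s => F s + - RtoC 1 * G s)%C
    by (apply functional_extensionality; intros s; ring).
  apply pcont_plus; auto. apply pcont_mult; auto. apply pcont_const.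
Qed.

Lemma pcont_continuous_re G t : pcont G t -> continuous (fun s => Re (G s)) t.
Proof.
  intros H. apply filterlim_locally. intros eps.
  destruct (H eps (cond_pos eps)) as (d & Hd & H1).
  exists (mkposreal d Hd). intros s Hs. apply Rle_lt_trans with (2 := H1 s Hs).
  apply (re_le_Cmod (G s - G t)%C).
Qed.

Lemma pcont_continuous_im G t : pcont G t -> continuous (fun s => Im (G s)) t.
Proof.
  intros H. apply filterlim_locally. intros eps.
  destruct (H eps (cond_pos eps)) as (d & Hd & H1).
  exists (mkposreal d Hd). intros s Hs. apply Rle_lt_trans with (2 := H1 s Hs).
  apply (im_le_Cmod (G s - G t)%C).
Qed.

Definition Cint (G : R -> C) (a b : R) : C :=
  (RInt (fun t => Re (G t)) a b, RInt (fun t => Im (G t)) a b).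

Definition pcont_on (G : R -> C) (a b : R) : Prop := forall t, a <= t <= b -> pcont G t.

Lemma ex_RInt_re G a b : a <= b -> pcont_on G a b -> ex_RInt (fun t => Re (G t)) a b.
Proof.
  intros Hab H. apply (@ex_RInt_continuous R_CompleteNormedModule).
  intros t. rewrite Rmin_left, Rmax_right by auto. intros Ht.
  apply pcont_continuous_re, H, Ht.
Qed.

Lemma ex_RInt_im G a b : a <= b -> pcont_on G a b -> ex_RInt (fun t => Im (G t)) a b.
Proof.
  intros Hab H. apply (@ex_RInt_continuous R_CompleteNormedModule).
  intros t. rewrite Rmin_left, Rmax_right by auto. intros Ht.
  apply pcont_continuous_im, H, Ht.
Qed.

Lemma Cint_plus F G a b : a <= b -> pcont_on F a b -> pcont_on G a b ->
  Cint (fun t => F t + G t)%C a b = (Cint F a b + Cint G a b)%C.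
Proof.
  intros Hab HF HG. apply injective_projections; simpl.
  - apply (@RInt_plus R_CompleteNormedModule); apply ex_RInt_re; auto.
  - apply (@RInt_plus R_CompleteNormedModule); apply ex_RInt_im; auto.
Qed.

Lemma Cint_scal c G a b : a <= b -> pcont_on G a b ->
  Cint (fun t => c * G t)%C a b = (c * Cint G a b)%C.
Proof.
  intros Hab HG.
  assert (Hr := ex_RInt_re G a b Hab HG). assert (Hi := ex_RInt_im G a b Hab HG).
  apply injective_projections; simpl.
  - assert (E := @RInt_minus R_CompleteNormedModule _ _ a b
      (@ex_RInt_scal R_NormedModule _ a b (fst c) Hr) (@ex_RInt_scal R_NormedModule _ a b (snd c) Hi)).
    rewrite !(@RInt_scal R_CompleteNormedModule) in E by assumption. exact E.
  - assert (E := @RInt_plus R_CompleteNormedModule _ _ a b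
      (@ex_RInt_scal R_NormedModule _ a b (fst c) Hi) (@ex_RInt_scal R_NormedModule _ a b (snd c) Hr)).
    rewrite !(@RInt_scal R_CompleteNormedModule) in E by assumption. exact E.
Qed.

Lemma Cint_minus F G a b : a <= b -> pcont_on F a b -> pcont_on G a b ->
  Cint (fun t => F t - G t)%C a b = (Cint F a b - Cint G a b)%C.
Proof.
  intros Hab HF HG.
  assert (HN : pcont_on (fun t => - RtoC 1 * G t)%C a b).
  { intros t Ht. apply pcont_mult; [apply pcont_const | auto]. }
  assert (E := Cint_plus F _ a b Hab HF HN). rewrite Cint_scal in E by auto.
  replace (Cint F a b - Cint G a b)%C with (Cint F a b + - RtoC 1 * Cint G a b)%C.
  - rewrite <- E. f_equal. apply functional_extensionality. intros t.
    ring.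
  - ring.
Qed.

Lemma Cint_ext F G a b : a <= b -> (forall t, a <= t <= b -> F t = G t) -> Cint F a b = Cint G a b.
Proof.
  intros Hab E. unfold Cint. f_equal; apply RInt_ext; intros t;
    rewrite Rmin_left, Rmax_right by auto; intros Ht; rewrite E by lra; reflexivity.
Qed.

Lemma Cint_chasles G a b c : a <= b -> b <= c -> pcont_on G a c ->
  (Cint G a b + Cint G b c)%C = Cint G a c.
Proof.
  intros Hab Hbc HG.
  assert (H1 : pcont_on G a b) by (intros t Ht; apply HG; lra).
  assert (H2 : pcont_on G b c) by (intros t Ht; apply HG; lra).
  apply injective_projections; simpl.
  - apply (@RInt_Chasles R_CompleteNormedModule); apply ex_RInt_re; auto.
  - apply (@RInt_Chasles R_CompleteNormedModule); apply ex_RInt_im; auto.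
Qed.

(* The factor 2 comes from bounding real and imaginary parts separately. *)
Lemma Cint_bound G a b m : a <= b -> pcont_on G a b ->
  (forall t, a <= t <= b -> Cmod (G t) <= m) -> Cmod (Cint G a b) <= 2 * m * (b - a).
Proof.
  intros Hab HG Hm.
  eapply Rle_trans; [apply Cmod_le_re_im|]. simpl.
  assert (Hr := ex_RInt_re G a b Hab HG). assert (Hi := ex_RInt_im G a b Hab HG).
  assert (A1 : Rabs (RInt (fun t => Re (G t)) a b) <= (b - a) * m).
  { apply (@norm_RInt_le_const R_NormedModule (fun t => Re (G t))); auto.
    - intros t Ht. eapply Rle_trans; [apply re_le_Cmod | apply Hm; lra].
    - apply (@RInt_correct R_CompleteNormedModule). exact Hr. }
  assert (A2 : Rabs (RInt (fun t => Im (G t)) a b) <= (b - a) * m).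
  { apply (@norm_RInt_le_const R_NormedModule (fun t => Im (G t))); auto.
    - intros t Ht. eapply Rle_trans; [apply im_le_Cmod | apply Hm; lra].
    - apply (@RInt_correct R_CompleteNormedModule). exact Hi. }
  lra.
Qed.

Lemma Cint_const c a b : Cint (fun _ => c) a b = (RtoC (b - a) * c)%C.
Proof.
  unfold Cint. rewrite !RInt_const. unfold Cmult, RtoC, scal; simpl. unfold mult; simpl.
  f_equal; unfold Re, Im; ring.
Qed.

Lemma RInt_linear a b : RInt (fun t => t) a b = (b * b - a * a) / 2.
Proof.
  apply is_RInt_unique.
  assert (H := is_RInt_derive (fun t => t * t / 2) (fun t => t) a b).
  replace ((b * b - a * a) / 2) with (minus (b * b / 2) (a * a / 2)).
  - apply H; intros t _.
    + auto_derive; auto. field.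
    + apply continuous_id.
  - unfold minus, plus, opp; simpl. field.
Qed.

Lemma pcont_RtoC t : pcont RtoC t.
Proof.
  intros eps He. exists eps. split; auto. intros s Hs.
  rewrite <- RtoC_minus, Cmod_R. exact Hs.
Qed.

Lemma Cint_affine p q a b : a <= b ->
  Cint (fun t => p * RtoC t + q)%C a b = (p * RtoC ((b * b - a * a) / 2) + RtoC (b - a) * q)%C.
Proof.
  intros Hab. rewrite Cint_plus; auto.
  - rewrite Cint_scal, Cint_const; auto.
    + f_equal. f_equal. unfold Cint, RtoC. simpl. rewrite RInt_linear, RInt_const.
      unfold scal; simpl. unfold mult; simpl. f_equal. ring.
    + intros t _. apply pcont_RtoC.
  - intros t _. apply pcont_mult; [apply pcont_const | apply pcont_RtoC].
  - intros t _. apply pcont_const.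
Qed.

Definition Cpair (x y : R) : C := (x, y).

(** * Goursat's lemma for rectangles *)

Definition hcont (H : R -> R -> C) (x y : R) : Prop :=
  forall eps, 0 < eps -> exists d, 0 < d /\
    forall x' y', Rabs (x' - x) < d -> Rabs (y' - y) < d -> Cmod (H x' y' - H x y) < eps.

(** Complex differentiability in x + i y, with the two real coordinates kept apart because the sides
    of a rectangle are integrated one coordinate at a time. *)
Definition hderiv (H : R -> R -> C) (x y : R) (l : C) : Prop :=
  forall eps, 0 < eps -> exists d, 0 < d /\
    forall x' y', Rabs (x' - x) < d -> Rabs (y' - y) < d ->
      Cmod (H x' y' - H x y - l * (Cpair (x' - x) (y' - y))) <= eps * (Rabs (x' - x) + Rabs (y' - y)).

Lemma hderiv_hcont H x y l : hderiv H x y l -> hcont H x y.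
Proof.
  intros HD eps He. destruct (HD 1 Rlt_0_1) as (d & Hd & H1).
  assert (Hl := Cmod_ge_0 l).
  set (e := eps / 2 / (1 + Cmod l)).
  assert (Hq : 0 < e) by (unfold e; repeat apply Rdiv_lt_0_compat; lra).
  exists (Rmin d e). split; [apply Rmin_pos; auto|].
  intros x' y' Hx Hy.
  specialize (H1 x' y' (Rlt_le_trans _ _ _ Hx (Rmin_l _ _)) (Rlt_le_trans _ _ _ Hy (Rmin_l _ _))).
  assert (Hx2 := Rlt_le_trans _ _ _ Hx (Rmin_r _ _)).
  assert (Hy2 := Rlt_le_trans _ _ _ Hy (Rmin_r _ _)).
  replace (H x' y' - H x y)%C
    with ((H x' y' - H x y - l * (Cpair (x' - x) (y' - y))) + l * (Cpair (x' - x) (y' - y)))%C by ring.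
  eapply Rle_lt_trans; [apply Cmod_triangle|]. rewrite Cmod_mult.
  assert (T := Cmod_pair_le (x' - x) (y' - y)).
  set (s := Rabs (x' - x) + Rabs (y' - y)) in *.
  apply Rle_lt_trans with ((1 + Cmod l) * s).
  - assert (Cmod l * Cmod (Cpair (x' - x) (y' - y)) <= Cmod l * s) by (apply Rmult_le_compat_l; auto). lra.
  - apply Rlt_le_trans with ((1 + Cmod l) * (2 * e)).
    + apply Rmult_lt_compat_l; unfold s; lra.
    + right. unfold e. field. lra.
Qed.

Lemma hcont_pcont_x H x y : hcont H x y -> pcont (fun t => H t y) x.
Proof.
  intros HC eps He. destruct (HC eps He) as (d & Hd & H1). exists d. split; auto.
  intros s Hs. apply H1; auto. rewrite Rminus_diag, Rabs_R0. exact Hd.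
Qed.

Lemma hcont_pcont_y H x y : hcont H x y -> pcont (H x) y.
Proof.
  intros HC eps He. destruct (HC eps He) as (d & Hd & H1). exists d. split; auto.
  intros s Hs. apply H1; auto. rewrite Rminus_diag, Rabs_R0. exact Hd.
Qed.

(** The contour integral of H dz counterclockwise along the boundary; the factor [Ci] comes from dz
    = i dy on the vertical sides. *)
Definition rect (H : R -> R -> C) (a b c d : R) : C :=
  (Cint (fun x => H x c) a b - Cint (fun x => H x d) a b
   + Ci * (Cint (H b) c d - Cint (H a) c d))%C.

Definition hcont_on (H : R -> R -> C) (a b c d : R) : Prop :=
  forall x y, a <= x <= b -> c <= y <= d -> hcont H x y.

Lemma rect_bound H a b c d m : a <= b -> c <= d -> hcont_on H a b c d ->
  (forall x y, a <= x <= b -> c <= y <= d -> Cmod (H x y) <= m) ->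
  Cmod (rect H a b c d) <= 4 * m * ((b - a) + (d - c)).
Proof.
  intros Hab Hcd HC Hm. unfold rect.
  assert (A : forall y, c <= y <= d -> Cmod (Cint (fun x => H x y) a b) <= 2 * m * (b - a)).
  { intros y Hy. apply Cint_bound; auto. intros t Ht. apply hcont_pcont_x, HC; auto. }
  assert (B : forall x, a <= x <= b -> Cmod (Cint (H x) c d) <= 2 * m * (d - c)).
  { intros x Hx. apply Cint_bound; auto. intros t Ht. apply hcont_pcont_y, HC; auto. }
  assert (A1 := A c ltac:(lra)). assert (A2 := A d ltac:(lra)).
  assert (A3 := B b ltac:(lra)). assert (A4 := B a ltac:(lra)).
  eapply Rle_trans; [apply Cmod_triangle|]. rewrite Cmod_mult, Cmod_Ci.
  assert (T1 := Cmod_minus_le (Cint (fun x => H x c) a b) (Cint (fun x => H x d) a b)).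
  assert (T2 := Cmod_minus_le (Cint (H b) c d) (Cint (H a) c d)). lra.
Qed.

(** An affine function of x + i y has a primitive. The four sides are integrated explicitly instead,
    which leaves a polynomial identity. *)
Lemma rect_affine alpha l x0 y0 a b c d : a <= b -> c <= d ->
  rect (fun x y => alpha + l * (Cpair (x - x0) (y - y0)))%C a b c d = RtoC 0.
Proof.
  intros Hab Hcd. unfold rect.
  assert (E1 : forall y, Cint (fun x => alpha + l * (Cpair (x - x0) (y - y0)))%C a b
     = (l * RtoC ((b * b - a * a) / 2) + RtoC (b - a) * (alpha + l * Cpair (- x0) (y - y0)))%C).
  { intros y. rewrite <- Cint_affine by auto. apply Cint_ext; auto. intros t _.
    replace (Cpair (t - x0) (y - y0)) with (RtoC t + (Cpair (- x0) (y - y0)))%C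
      by (unfold Cpair, Cplus, RtoC; simpl; f_equal; ring). ring. }
  assert (E2 : forall x, Cint (fun y => alpha + l * (Cpair (x - x0) (y - y0)))%C c d
     = (l * Ci * RtoC ((d * d - c * c) / 2) + RtoC (d - c) * (alpha + l * Cpair (x - x0) (- y0)))%C).
  { intros x. rewrite <- Cint_affine by auto. apply Cint_ext; auto. intros t _.
    replace (Cpair (x - x0) (t - y0)) with (Ci * RtoC t + (Cpair (x - x0) (- y0)))%C
      by (unfold Cpair, Cplus, Cmult, Ci, RtoC; simpl; f_equal; ring). ring. }
  rewrite !E1, !E2.
  destruct l as [l1 l2], alpha as [u v]. unfold Cpair, Cminus, Copp, Cmult, Cplus, Ci, RtoC; simpl.
  f_equal; field.
Qed.

Lemma hcont_minus H G x y : hcont H x y -> hcont G x y -> hcont (fun x y => H x y - G x y)%C x y.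
Proof.
  intros H1 H2 eps He. destruct (H1 (eps / 2)) as (d1 & Hd1 & A1); [lra|].
  destruct (H2 (eps / 2)) as (d2 & Hd2 & A2); [lra|].
  exists (Rmin d1 d2). split; [apply Rmin_pos; auto|]. intros x' y' Hx Hy.
  replace (H x' y' - G x' y' - (H x y - G x y))%C
    with ((H x' y' - H x y) - (G x' y' - G x y))%C by ring.
  eapply Rle_lt_trans; [apply Cmod_minus_le|].
  destruct (Rmin_Rgt_l _ _ _ Hx) as [Hx1 Hx2]. destruct (Rmin_Rgt_l _ _ _ Hy) as [Hy1 Hy2].
  specialize (A1 x' y' Hx1 Hy1). specialize (A2 x' y' Hx2 Hy2). lra.
Qed.

Lemma rect_minus H G a b c d : a <= b -> c <= d -> hcont_on H a b c d -> hcont_on G a b c d ->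
  rect (fun x y => H x y - G x y)%C a b c d = (rect H a b c d - rect G a b c d)%C.
Proof.
  intros Hab Hcd HH HG. unfold rect.
  rewrite (Cint_minus (fun x => H x c) (fun x => G x c)), (Cint_minus (fun x => H x d) (fun x => G x d)),
    (Cint_minus (H b) (G b)), (Cint_minus (H a) (G a)); auto;
    try (intros t Ht; (apply hcont_pcont_x || apply hcont_pcont_y); (apply HH || apply HG); lra).
  ring.
Qed.

Lemma rect_split_x H a m b c d : a <= m -> m <= b -> c <= d -> hcont_on H a b c d ->
  rect H a b c d = (rect H a m c d + rect H m b c d)%C.
Proof.
  intros Ha Hb Hcd HC. unfold rect.
  rewrite <- (Cint_chasles (fun x => H x c) a m b), <- (Cint_chasles (fun x => H x d) a m b); auto;
    try (intros t Ht; apply hcont_pcont_x; apply HC; lra).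
  ring.
Qed.

Lemma rect_split_y H a b c m d : a <= b -> c <= m -> m <= d -> hcont_on H a b c d ->
  rect H a b c d = (rect H a b c m + rect H a b m d)%C.
Proof.
  intros Hab Hc Hd HC. unfold rect.
  rewrite <- (Cint_chasles (H b) c m d), <- (Cint_chasles (H a) c m d); auto;
    try (intros t Ht; apply hcont_pcont_y; apply HC; lra).
  ring.
Qed.

Lemma nested_intervals_point (a w : nat -> R) :
  (forall n, a n <= a (S n)) -> (forall n, a (S n) + w (S n) <= a n + w n) -> (forall n, 0 <= w n) ->
  exists x, forall n, a n <= x <= a n + w n.
Proof.
  intros H1 H2 Hw.
  assert (M1 : forall n k, a n <= a (n + k)%nat).
  { intros n k. induction k; [rewrite Nat.add_0_r; lra|]. rewrite Nat.add_succ_r.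
    specialize (H1 (n + k)%nat). lra. }
  assert (M2 : forall n k, a (n + k)%nat + w (n + k)%nat <= a n + w n).
  { intros n k. induction k; [rewrite Nat.add_0_r; lra|]. rewrite Nat.add_succ_r.
    specialize (H2 (n + k)%nat). lra. }
  assert (UB : forall n m, a m <= a n + w n).
  { intros n m. specialize (M1 m n). specialize (M2 n m). rewrite Nat.add_comm in M2.
    specialize (Hw (m + n)%nat). lra. }
  destruct (completeness (fun y => exists n, y = a n)) as [x [Hx1 Hx2]].
  - exists (a 0%nat + w 0%nat). intros y [n ->]. apply UB.
  - exists (a 0%nat), 0%nat. reflexivity.
  - exists x. intros n. split.
    + apply Hx1. exists n. reflexivity.
    + apply Hx2. intros y [m ->]. apply UB.
Qed.

(** A two-dimensional compactness principle. If P failed, some quarter would fail again and again;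
    the failing rectangles shrink to a point, around which P holds for all small rectangles. All
    rectangles are copies of one shape scaled by h, so a single number measures their size. *)
Lemma bisection_2d (A B a0 c0 : R) (P : R -> R -> R -> Prop) : 0 <= A -> 0 <= B ->
  (forall a c h, 0 < h -> a0 <= a -> a + h * A <= a0 + A -> c0 <= c -> c + h * B <= c0 + B ->
     P a c (h / 2) -> P (a + h / 2 * A) c (h / 2) ->
     P a (c + h / 2 * B) (h / 2) -> P (a + h / 2 * A) (c + h / 2 * B) (h / 2) -> P a c h) ->
  (forall x y, a0 <= x <= a0 + A -> c0 <= y <= c0 + B -> exists d, 0 < d /\
     forall a c h, 0 < h < d -> a0 <= a -> a + h * A <= a0 + A -> c0 <= c -> c + h * B <= c0 + B ->
       a <= x <= a + h * A -> c <= y <= c + h * B -> P a c h) ->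
  P a0 c0 1.
Proof.
  intros HA HB Hsplit Hloc. apply NNPP. intros HN.
  set (inside := fun (ac : R * R) h => a0 <= fst ac /\ fst ac + h * A <= a0 + A /\
                     c0 <= snd ac /\ snd ac + h * B <= c0 + B).
  set (h := fun n => (/ 2) ^ n).
  assert (Hh : forall n, 0 < h n) by (intros n; apply pow_lt; lra).
  assert (HhS : forall n, h (S n) = h n / 2) by (intros n; unfold h; simpl; field).
  assert (step : forall n (ac : R * R), inside ac (h n) /\ ~ P (fst ac) (snd ac) (h n) ->
     exists ac', (inside ac' (h (S n)) /\ ~ P (fst ac') (snd ac') (h (S n))) /\
        (fst ac <= fst ac' /\ fst ac' + h (S n) * A <= fst ac + h n * A) /\
        (snd ac <= snd ac' /\ snd ac' + h (S n) * B <= snd ac + h n * B)).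
  { intros n [a c] [(I1 & I2 & I3 & I4) NP]; simpl in *. specialize (Hh n). rewrite HhS.
    assert (PA : 0 <= h n / 2 * A) by (apply Rmult_le_pos; lra).
    assert (PB : 0 <= h n / 2 * B) by (apply Rmult_le_pos; lra).
    apply NNPP. intros Hall. apply NP. apply Hsplit; auto; apply NNPP; intros NQ; apply Hall.
    - exists (a, c). unfold inside; simpl. repeat split; auto; lra.
    - exists (a + h n / 2 * A, c). unfold inside; simpl. repeat split; auto; lra.
    - exists (a, c + h n / 2 * B). unfold inside; simpl. repeat split; auto; lra.
    - exists (a + h n / 2 * A, c + h n / 2 * B). unfold inside; simpl. repeat split; auto; lra. }
  (* Dependent choice: each corner carries the proof that its rectangle is inside and fails P, which
     is what the choice of the next quarter consumes. *)
  set (next := fun n (s : {ac : R * R | inside ac (h n) /\ ~ P (fst ac) (snd ac) (h n)}) =>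
      constructive_indefinite_description _ (step n (proj1_sig s) (proj2_sig s))).
  assert (init : inside (a0, c0) (h 0%nat) /\ ~ P a0 c0 (h 0%nat)).
  { unfold inside, h; simpl. split; auto. repeat split; lra. }
  set (s := nat_rect (fun n => {ac : R * R | inside ac (h n) /\ ~ P (fst ac) (snd ac) (h n)})
       (exist _ (a0, c0) init)
       (fun n s => exist _ (proj1_sig (next n s)) (proj1 (proj2_sig (next n s))))).
  assert (Hs : forall n,
        (fst (proj1_sig (s n)) <= fst (proj1_sig (s (S n))) /\
         fst (proj1_sig (s (S n))) + h (S n) * A <= fst (proj1_sig (s n)) + h n * A) /\
        (snd (proj1_sig (s n)) <= snd (proj1_sig (s (S n))) /\
         snd (proj1_sig (s (S n))) + h (S n) * B <= snd (proj1_sig (s n)) + h n * B)).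
  { intros n. exact (proj2 (proj2_sig (next n (s n)))). }
  destruct (nested_intervals_point (fun n => fst (proj1_sig (s n))) (fun n => h n * A)) as [x Hx].
  { intros n; apply Hs. } { intros n; apply Hs. }
  { intros n; apply Rmult_le_pos; auto. left; auto. }
  destruct (nested_intervals_point (fun n => snd (proj1_sig (s n))) (fun n => h n * B)) as [y Hy].
  { intros n; apply Hs. } { intros n; apply Hs. }
  { intros n; apply Rmult_le_pos; auto. left; auto. }
  assert (I := fun n => proj2_sig (s n)).
  destruct (Hloc x y) as (d & Hd & Hd1).
  { specialize (Hx 0%nat). specialize (I 0%nat). destruct I as [(I1 & I2 & I3 & I4) _]. lra. }
  { specialize (Hy 0%nat). specialize (I 0%nat). destruct I as [(I1 & I2 & I3 & I4) _]. lra. }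
  destruct (pow_lt_1_zero (/ 2)) with (y := d) as [N HN1].
  { rewrite Rabs_pos_eq; lra. } { exact Hd. }
  destruct (I N) as [(I1 & I2 & I3 & I4) NP]. apply NP.
  specialize (HN1 N (Nat.le_refl N)).
  assert (HhN := Hh N). fold (h N) in HN1. rewrite Rabs_pos_eq in HN1 by lra.
  apply Hd1; auto.
Qed.

(** The bound |integral| <= eps h^2 for the copy of scale h passes from the quarters to the whole
    because 4 (h/2)^2 = h^2. Near a given point the affine part integrates to 0, and the remainder
    is o(h) on a perimeter of order h. At scale 1 the integral is at most eps. *)
Lemma goursat H a b c d : a <= b -> c <= d ->
  (forall x y, a <= x <= b -> c <= y <= d -> exists l, hderiv H x y l) ->
  rect H a b c d = RtoC 0.
Proof.
  intros Hab Hcd HD.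
  assert (HC : hcont_on H a b c d).
  { intros x y Hx Hy. destruct (HD x y Hx Hy) as [l Hl]. exact (hderiv_hcont _ _ _ _ Hl). }
  apply Cmod_eq_0. apply Rle_antisym; [|apply Cmod_ge_0].
  apply le_epsilon. intros eps He. rewrite Rplus_0_l.
  set (A := b - a). set (B := d - c).
  assert (HA : 0 <= A) by (unfold A; lra). assert (HB : 0 <= B) by (unfold B; lra).
  assert (G := bisection_2d A B a c
    (fun a' c' h => Cmod (rect H a' (a' + h * A) c' (c' + h * B)) <= eps * (h * h)) HA HB).
  simpl in G. rewrite !Rmult_1_l, Rmult_1_r in G. unfold A, B in G.
  replace (a + (b - a)) with b in G by ring. replace (c + (d - c)) with d in G by ring.
  fold A B in G. apply G; clear G.
  - intros a' c' h Hh I1 I2 I3 I4 P1 P2 P3 P4.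
    assert (PA : 0 <= h * A) by (apply Rmult_le_pos; lra).
    assert (PB : 0 <= h * B) by (apply Rmult_le_pos; lra).
    assert (EA : a' + h / 2 * A + h / 2 * A = a' + h * A) by field.
    assert (EB : c' + h / 2 * B + h / 2 * B = c' + h * B) by field.
    rewrite EA in P2, P4. rewrite EB in P3, P4.
    assert (HC' : hcont_on H a' (a' + h * A) c' (c' + h * B)) by (intros x y Hx Hy; apply HC; lra).
    assert (PA2 : h / 2 * A = h * A / 2) by field. assert (PB2 : h / 2 * B = h * B / 2) by field.
    rewrite PA2, PB2 in *.
    rewrite (rect_split_x H a' (a' + h * A / 2)) by (auto; lra).
    rewrite (rect_split_y H a' (a' + h * A / 2) c' (c' + h * B / 2))
      by (try lra; intros x y Hx Hy; apply HC'; lra).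
    rewrite (rect_split_y H (a' + h * A / 2) (a' + h * A) c' (c' + h * B / 2))
      by (try lra; intros x y Hx Hy; apply HC'; lra).
    eapply Rle_trans; [apply Cmod_triangle|].
    assert (T1 := Cmod_triangle (rect H a' (a' + h * A / 2) c' (c' + h * B / 2))
                     (rect H a' (a' + h * A / 2) (c' + h * B / 2) (c' + h * B))).
    assert (T2 := Cmod_triangle (rect H (a' + h * A / 2) (a' + h * A) c' (c' + h * B / 2))
                     (rect H (a' + h * A / 2) (a' + h * A) (c' + h * B / 2) (c' + h * B))).
    assert (E : eps * (h * h) = 4 * (eps * (h / 2 * (h / 2)))) by field. lra.
  - intros x y Hx Hy. destruct (HD x y Hx Hy) as [l Hl].
    (* [rect_bound] will give 4 e (A + B)^2 h^2. The added 1 keeps the denominator positive for a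
       degenerate rectangle. *)
    set (e := eps / (4 * (1 + A + B) * (1 + A + B))).
    assert (HK : 0 < 4 * (1 + A + B) * (1 + A + B)) by (repeat apply Rmult_lt_0_compat; lra).
    assert (He' : 0 < e) by (unfold e; apply Rdiv_lt_0_compat; lra).
    destruct (Hl e He') as (del & Hdel & H1).
    exists (del / (1 + A + B)). split; [apply Rdiv_lt_0_compat; lra|].
    intros a' c' h [Hh Hh'] I1 I2 I3 I4 Jx Jy.
    assert (PA : 0 <= h * A) by (apply Rmult_le_pos; lra).
    assert (PB : 0 <= h * B) by (apply Rmult_le_pos; lra).
    assert (Hsmall : h * A + h * B < del).
    { apply Rle_lt_trans with (h * (1 + A + B)); [lra|].
      apply Rlt_le_trans with (del / (1 + A + B) * (1 + A + B)).
      - apply Rmult_lt_compat_r; lra.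
      - right. field. lra. }
    assert (HC' : hcont_on H a' (a' + h * A) c' (c' + h * B)) by (intros x' y' Hx' Hy'; apply HC; lra).
    assert (HL : hcont_on (fun x' y' => H x y + l * (Cpair (x' - x) (y' - y)))%C
         a' (a' + h * A) c' (c' + h * B)).
    { intros x' y' _ _. apply hderiv_hcont with l. intros e1 He1. exists 1. split; [lra|].
      intros x'' y'' _ _.
      replace (H x y + l * (Cpair (x'' - x) (y'' - y)) - (H x y + l * (Cpair (x' - x) (y' - y))) - l * (Cpair (x'' - x') (y'' - y')))%C with (RtoC 0).
      - rewrite Cmod_0. apply Rmult_le_pos; [lra|]. apply Rplus_le_le_0_compat; apply Rabs_pos.
      - replace (Cpair (x'' - x') (y'' - y')) with ((Cpair (x'' - x) (y'' - y)) - (Cpair (x' - x) (y' - y)))%C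
          by (unfold Cpair, Cminus, Cplus, Copp; simpl; f_equal; ring). ring. }
    replace (rect H a' (a' + h * A) c' (c' + h * B))
      with (rect (fun x' y' => H x' y' - (H x y + l * (Cpair (x' - x) (y' - y))))%C a' (a' + h * A) c' (c' + h * B)).
    + eapply Rle_trans.
      * apply rect_bound with (m := e * (h * A + h * B)); try lra.
        -- intros x' y' Hx' Hy'. apply (hcont_minus H); [apply HC' | apply HL]; auto.
        -- intros x' y' Hx' Hy'.
           assert (D1 : Rabs (x' - x) <= h * A) by (apply Rabs_le; lra).
           assert (D2 : Rabs (y' - y) <= h * B) by (apply Rabs_le; lra).
           replace (H x' y' - (H x y + l * (Cpair (x' - x) (y' - y))))%C
             with (H x' y' - H x y - l * (Cpair (x' - x) (y' - y)))%C by ring.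
           eapply Rle_trans; [apply H1; lra|]. apply Rmult_le_compat_l; lra.
      * replace (4 * (e * (h * A + h * B)) * (a' + h * A - a' + (c' + h * B - c')))
          with (4 * e * (A + B) * (A + B) * (h * h)) by ring.
        replace eps with (4 * e * (1 + A + B) * (1 + A + B)) at 1 by (unfold e; field; lra).
        apply Rmult_le_compat_r; [apply Rle_0_sqr|].
        apply Rmult_le_compat; try lra. apply Rmult_le_pos; lra.
    + rewrite rect_minus, rect_affine by (auto; lra). ring.
Qed.

Definition mean2pi (H : R -> R -> C) (x : R) : C := Cint (H x) 0 (2 * PI).

(* Periodicity makes the two horizontal sides cancel. *)
Lemma mean2pi_const H a b : a <= b ->
  (forall x y, H x (y + 2 * PI) = H x y) ->
  (forall x y, a <= x <= b -> exists l, hderiv H x y l) ->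
  mean2pi H a = mean2pi H b.
Proof.
  intros Hab Hper HD. assert (HPI := PI_RGT_0).
  assert (E := goursat H a b 0 (2 * PI) Hab ltac:(lra) (fun x y Hx _ => HD x y Hx)).
  unfold rect in E.
  assert (E2 : Cint (fun x => H x (2 * PI)) a b = Cint (fun x => H x 0) a b).
  { apply Cint_ext; auto. intros t _. rewrite <- (Hper t 0). f_equal. ring. }
  rewrite E2 in E. unfold mean2pi. symmetry. apply Ceq_minus.
  replace (Cint (H b) 0 (2 * PI) - Cint (H a) 0 (2 * PI))%C
    with (- Ci * (Cint (fun x => H x 0) a b - Cint (fun x => H x 0) a b
          + Ci * (Cint (H b) 0 (2 * PI) - Cint (H a) 0 (2 * PI))))%C.
  - rewrite E. ring.
  - assert (EC : (Ci * Ci)%C = (- RtoC 1)%C)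
      by (unfold Cmult, Ci, Copp, RtoC; simpl; f_equal; ring).
    set (u := Cint (H b) 0 (2 * PI)). set (v := Cint (H a) 0 (2 * PI)).
    set (w := Cint (fun x => H x 0) a b).
    replace (- Ci * (w - w + Ci * (u - v)))%C with (- (Ci * Ci) * (u - v))%C by ring.
    rewrite EC. ring.
Qed.

Lemma mean2pi_continuous H x : (forall y, hcont H x y) ->
  forall eps, 0 < eps -> exists d, 0 < d /\ forall x', Rabs (x' - x) < d ->
    (forall y, hcont H x' y) -> Cmod (mean2pi H x' - mean2pi H x) <= eps.
Proof.
  intros HC eps He. assert (HPI := PI_RGT_0).
  (* The integrands are compared through an intermediate point, at cost 2 e; the factor 2 of
     [Cint_bound] and the length 2 pi then give exactly eps. *)
  set (e := eps / (4 * PI) / 2).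
  assert (He' : 0 < e) by (unfold e; repeat apply Rdiv_lt_0_compat; lra).
  assert (Hdel : forall y, exists d : posreal, forall x' y', Rabs (x' - x) < d -> Rabs (y' - y) < d ->
     Cmod (H x' y' - H x y) < e).
  { intros y. destruct (HC y e He') as (d & Hd & H1). exists (mkposreal d Hd). exact H1. }
  set (del := fun y => proj1_sig (constructive_indefinite_description _ (Hdel y))).
  assert (Hdel2 : forall y x' y', Rabs (x' - x) < del y -> Rabs (y' - y) < del y ->
     Cmod (H x' y' - H x y) < e).
  { intros y. exact (proj2_sig (constructive_indefinite_description _ (Hdel y))). }
  destruct (compactness_value_1d 0 (2 * PI) del) as [d Hd].
  exists d. split; [apply cond_pos|]. intros x' Hx' HC'. unfold mean2pi.
  rewrite <- Cint_minus.
  - replace eps with (2 * (2 * e) * (2 * PI - 0)) by (unfold e; field; lra).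
    apply Cint_bound.
    + lra.
    + intros t _. apply pcont_minus; apply hcont_pcont_y; auto.
    (* [compactness_value_1d] asserts the existence of a centre s only under a double negation, so
       the bound is proved by contradiction. *)
    + intros t Ht. apply Rnot_lt_le. intros Hlt. apply (Hd t Ht).
      intros (s & _ & Hs & Hds).
      assert (B1 := Hdel2 s x' t ltac:(lra) Hs).
      assert (B2 := Hdel2 s x t ltac:(rewrite Rminus_diag, Rabs_R0; apply cond_pos) Hs).
      assert (T := Cmod_minus_triangle (H x' t) (H x s) (H x t)).
      rewrite (Cmod_minus_sym (H x s)) in T. lra.
  - lra.
  - intros t _. apply hcont_pcont_y, HC'.
  - intros t _. apply hcont_pcont_y, HC.
Qed.

(** A removable singularity in weak form: the means on both sides of x0 are constant, and continuity
    at x0 glues them. It serves difference quotients, which at their base point are only known to be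
    continuous. *)
Lemma mean2pi_const_except H a b x0 : a < x0 < b ->
  (forall x y, H x (y + 2 * PI) = H x y) ->
  (forall x y, a <= x <= b -> hcont H x y) ->
  (forall x y, a <= x <= b -> x <> x0 -> exists l, hderiv H x y l) ->
  mean2pi H a = mean2pi H b.
Proof.
  intros Hx0 Hper HC HD. apply Ceq_minus, Cmod_eq_0, Rle_antisym; [|apply Cmod_ge_0].
  apply le_epsilon. intros eps He.
  destruct (mean2pi_continuous H x0 (fun y => HC x0 y ltac:(lra)) (eps / 2) ltac:(lra)) as (d & Hd & H1).
  set (e := Rmin (d / 2) (Rmin (x0 - a) (b - x0))).
  assert (He0 : 0 < e) by (unfold e; repeat apply Rmin_pos; lra).
  assert (He1 : e <= d / 2) by apply Rmin_l.
  assert (He2 : e <= x0 - a) by (eapply Rle_trans; [apply Rmin_r | apply Rmin_l]).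
  assert (He3 : e <= b - x0) by (eapply Rle_trans; [apply Rmin_r | apply Rmin_r]).
  rewrite (mean2pi_const H a (x0 - e)); try lra; auto;
    [| intros x y Hx; apply HD; lra].
  rewrite <- (mean2pi_const H (x0 + e) b); try lra; auto;
    [| intros x y Hx; apply HD; lra].
  assert (A1 := H1 (x0 - e) ltac:(replace (x0 - e - x0) with (- e) by ring; rewrite Rabs_Ropp, Rabs_pos_eq; lra)
                   (fun y => HC (x0 - e) y ltac:(lra))).
  assert (A2 := H1 (x0 + e) ltac:(replace (x0 + e - x0) with e by ring; rewrite Rabs_pos_eq; lra)
                   (fun y => HC (x0 + e) y ltac:(lra))).
  assert (T := Cmod_minus_triangle (mean2pi H (x0 - e)) (mean2pi H x0) (mean2pi H (x0 + e))).
  rewrite (Cmod_minus_sym (mean2pi H x0)) in T. lra.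
Qed.

(** * Polar coordinates and Cauchy's integral formula *)

(** This is exp(s + i t), so [s] is the logarithm of the radius and a rectangle of height 2 pi
    covers an annulus. *)
Definition polar (s t : R) : C := (exp s * cos t, exp s * sin t).

Lemma polar_add s s' t t' : polar (s + s') (t + t') = (polar s t * polar s' t')%C.
Proof.
  unfold polar, Cmult; simpl. rewrite exp_plus, cos_plus, sin_plus. f_equal; ring.
Qed.

Lemma Cmod_polar s t : Cmod (polar s t) = exp s.
Proof.
  unfold Cmod, polar; simpl.
  replace (exp s * cos t * (exp s * cos t * 1) + exp s * sin t * (exp s * sin t * 1))
    with (exp s * exp s * (Rsqr (sin t) + Rsqr (cos t))) by (unfold Rsqr; ring).
  rewrite sin2_cos2, Rmult_1_r. apply sqrt_square. left; apply exp_pos.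
Qed.

Lemma polar_neq_0 s t : polar s t <> RtoC 0.
Proof. apply Cmod_gt_0. rewrite Cmod_polar. apply exp_pos. Qed.

Lemma polar_periodic s t : polar s (t + 2 * PI) = polar s t.
Proof.
  assert (E := cos_period t 1). assert (E2 := sin_period t 1). simpl in E, E2.
  rewrite Rmult_1_r in E, E2. unfold polar. rewrite E, E2. reflexivity.
Qed.

Lemma derivable_pt_lim_0_le f l : derivable_pt_lim f 0 l ->
  forall eps, 0 < eps -> exists d, 0 < d /\ forall h, Rabs h < d -> Rabs (f h - f 0 - l * h) <= eps * Rabs h.
Proof.
  intros H eps He. destruct (H eps He) as [d Hd]. exists d. split; [apply cond_pos|].
  intros h Hh. destruct (Req_dec h 0) as [-> | Hn].
  - rewrite Rabs_R0. replace (f 0 - f 0 - l * 0) with 0 by ring. rewrite Rabs_R0. lra.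
  - specialize (Hd h Hn Hh). rewrite Rplus_0_l in Hd.
    replace (f h - f 0 - l * h) with (((f h - f 0) / h - l) * h) by (field; auto).
    rewrite Rabs_mult. apply Rmult_le_compat_r; [apply Rabs_pos | lra].
Qed.

Lemma hderiv_polar_0 : hderiv polar 0 0 1.
Proof.
  intros eps He.
  (* The bound 1 gives |exp s - 1| <= 2 |s|, hence exp s <= 3 when |s| < 1. The shares of eps then
     sum to at most eps/8 for |s| and 3/8 + 3/8 + 1/4 = 1 times eps for |t|. *)
  destruct (derivable_pt_lim_0_le exp 1) with (eps := Rmin 1 (eps / 8)) as (d1 & Hd1 & H1).
  { rewrite <- exp_0. apply derivable_pt_lim_exp. } { apply Rmin_pos; lra. }
  destruct (derivable_pt_lim_0_le cos 0) with (eps := eps / 8) as (d2 & Hd2 & H2).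
  { assert (T := derivable_pt_lim_cos 0). rewrite sin_0, Ropp_0 in T. exact T. } { lra. }
  destruct (derivable_pt_lim_0_le sin 1) with (eps := eps / 8) as (d3 & Hd3 & H3).
  { rewrite <- cos_0. apply derivable_pt_lim_sin. } { lra. }
  exists (Rmin (Rmin d1 (Rmin 1 (eps / 8))) (Rmin d2 d3)).
  split; [repeat apply Rmin_pos; lra|].
  intros s t. rewrite !Rminus_0_r. intros Hs Ht.
  destruct (Rmin_Rgt_l _ _ _ Hs) as [Hs' _]. destruct (Rmin_Rgt_l _ _ _ Hs') as [Hs1 Hs2].
  destruct (Rmin_Rgt_l _ _ _ Ht) as [_ Ht']. destruct (Rmin_Rgt_l _ _ _ Ht') as [Ht2 Ht3].
  destruct (Rmin_Rgt_l _ _ _ Hs2) as [Hs3 Hs4].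
  specialize (H1 s Hs1). specialize (H2 t Ht2). specialize (H3 t Ht3).
  rewrite exp_0, Rmult_1_l in H1. rewrite cos_0, Rmult_0_l, Rminus_0_r in H2.
  rewrite sin_0, Rmult_1_l, Rminus_0_r in H3.
  assert (Ps := Rabs_pos s). assert (Pt := Rabs_pos t).
  assert (M1 := Rmin_l 1 (eps / 8)). assert (M2 := Rmin_r 1 (eps / 8)).
  set (m := Rmin 1 (eps / 8)) in *.
  assert (H1' : m * Rabs s <= 1 * Rabs s) by (apply Rmult_le_compat_r; lra).
  assert (H1'' : m * Rabs s <= eps / 8 * Rabs s) by (apply Rmult_le_compat_r; lra).
  assert (Ee1 : Rabs (exp s - 1) <= 2 * Rabs s).
  { replace (exp s - 1) with ((exp s - 1 - s) + s) by ring. eapply Rle_trans; [apply Rabs_triang|]. lra. }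
  assert (Ee : Rabs (exp s) <= 3).
  { replace (exp s) with ((exp s - 1) + 1) by ring. eapply Rle_trans; [apply Rabs_triang|].
    rewrite Rabs_R1. lra. }
  replace (polar s t - polar 0 0 - 1 * Cpair s t)%C
    with (Cpair ((exp s - 1 - s) + exp s * (cos t - 1)) (exp s * (sin t - t) + (exp s - 1) * t)).
  2:{ unfold polar, Cpair, Cminus, Cplus, Copp, Cmult, RtoC; simpl. rewrite exp_0, cos_0, sin_0. f_equal; ring. }
  eapply Rle_trans; [apply Cmod_pair_le|].
  assert (B1 := Rabs_triang (exp s - 1 - s) (exp s * (cos t - 1))).
  assert (B2 := Rabs_triang (exp s * (sin t - t)) ((exp s - 1) * t)).
  rewrite Rabs_mult in B1. rewrite !Rabs_mult in B2.
  assert (C1 : Rabs (exp s) * Rabs (cos t - 1) <= 3 * (eps / 8 * Rabs t))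
    by (apply Rmult_le_compat; auto using Rabs_pos).
  assert (C2 : Rabs (exp s) * Rabs (sin t - t) <= 3 * (eps / 8 * Rabs t))
    by (apply Rmult_le_compat; auto using Rabs_pos).
  assert (C3 : Rabs (exp s - 1) * Rabs t <= (eps / 4) * Rabs t)
    by (apply Rmult_le_compat_r; lra).
  assert (0 <= eps * Rabs s) by (apply Rmult_le_pos; lra).
  lra.
Qed.

(** The addition law moves the point to the origin; the factor of modulus exp s that appears is
    compensated by dividing eps by it. *)
Lemma hderiv_polar s t : hderiv polar s t (polar s t).
Proof.
  intros eps He. assert (Hes := exp_pos s).
  destruct (hderiv_polar_0 (eps / exp s)) as (d & Hd & H); [apply Rdiv_lt_0_compat; auto|].
  exists d. split; auto. intros s' t' Hs Ht.
  specialize (H (s' - s) (t' - t)). rewrite !Rminus_0_r in H. specialize (H Hs Ht).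
  assert (E0 : polar 0 0 = RtoC 1).
  { unfold polar, RtoC. rewrite exp_0, cos_0, sin_0. f_equal; ring. }
  replace (polar s' t') with (polar s t * polar (s' - s) (t' - t))%C
    by (rewrite <- polar_add; f_equal; ring).
  replace (polar s t * polar (s' - s) (t' - t) - polar s t - polar s t * Cpair (s' - s) (t' - t))%C
    with (polar s t * (polar (s' - s) (t' - t) - polar 0 0 - 1 * Cpair (s' - s) (t' - t)))%C
    by (rewrite E0; ring).
  rewrite Cmod_mult, Cmod_polar.
  replace (eps * (Rabs (s' - s) + Rabs (t' - t)))
    with (exp s * (eps / exp s * (Rabs (s' - s) + Rabs (t' - t)))) by (field; lra).
  apply Rmult_le_compat_l; lra.
Qed.

Lemma hcont_polar s t : hcont polar s t.
Proof. apply hderiv_hcont with (polar s t), hderiv_polar. Qed.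

Lemma pcont_polar s t : pcont (polar s) t.
Proof. apply hcont_pcont_y, hcont_polar. Qed.

Lemma hcont_comp f P x y : ccont f (P x y) -> hcont P x y -> hcont (fun x y => f (P x y)) x y.
Proof.
  intros Hf HP eps He. destruct (Hf eps He) as (d & Hd & H1).
  destruct (HP d Hd) as (d' & Hd' & H2). exists d'. split; auto.
Qed.

Lemma hderiv_comp f P x y k l : cderiv f (P x y) k -> hderiv P x y l ->
  hderiv (fun x y => f (P x y)) x y (l * k).
Proof.
  intros Hf Hg eps He.
  destruct (Hg 1 Rlt_0_1) as (d1 & Hd1 & H1).
  assert (Hl := Cmod_ge_0 l). assert (Hk := Cmod_ge_0 k).
  set (e1 := eps / 2 / (1 + Cmod l)). set (e2 := eps / 2 / (1 + Cmod k)).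
  assert (He1 : 0 < e1) by (unfold e1; repeat apply Rdiv_lt_0_compat; lra).
  assert (He2 : 0 < e2) by (unfold e2; repeat apply Rdiv_lt_0_compat; lra).
  destruct (Hf e1 He1) as (d2 & Hd2 & H2).
  destruct (Hg e2 He2) as (d3 & Hd3 & H3).
  destruct (hderiv_hcont _ _ _ _ Hg d2 Hd2) as (d4 & Hd4 & H4).
  exists (Rmin (Rmin d1 d3) d4). split; [repeat apply Rmin_pos; auto|].
  intros x' y' Hx Hy.
  destruct (Rmin_Rgt_l _ _ _ Hx) as [Hx' Hx4]. destruct (Rmin_Rgt_l _ _ _ Hx') as [Hx1 Hx3].
  destruct (Rmin_Rgt_l _ _ _ Hy) as [Hy' Hy4]. destruct (Rmin_Rgt_l _ _ _ Hy') as [Hy1 Hy3].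
  specialize (H1 x' y' Hx1 Hy1). specialize (H3 x' y' Hx3 Hy3). specialize (H2 _ (H4 x' y' Hx4 Hy4)).
  assert (T := Cmod_pair_le (x' - x) (y' - y)). fold (Cpair (x' - x) (y' - y)) in T.
  set (v := Cpair (x' - x) (y' - y)) in *.
  set (n := Rabs (x' - x) + Rabs (y' - y)) in *.
  assert (Hn : 0 <= n) by (unfold n; apply Rplus_le_le_0_compat; apply Rabs_pos).
  replace (f (P x' y') - f (P x y) - l * k * v)%C
    with ((f (P x' y') - f (P x y) - (P x' y' - P x y) * k) + (P x' y' - P x y - l * v) * k)%C by ring.
  eapply Rle_trans; [apply Cmod_triangle|]. rewrite Cmod_mult.
  assert (Hgy : Cmod (P x' y' - P x y) <= (1 + Cmod l) * n).
  { replace (P x' y' - P x y)%C with ((P x' y' - P x y - l * v) + l * v)%C by ring.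
    eapply Rle_trans; [apply Cmod_triangle|]. rewrite Cmod_mult.
    assert (Cmod l * Cmod v <= Cmod l * n) by (apply Rmult_le_compat_l; auto). lra. }
  assert (A1 : e1 * Cmod (P x' y' - P x y) <= eps / 2 * n).
  { apply Rle_trans with (e1 * ((1 + Cmod l) * n)).
    - apply Rmult_le_compat_l; lra.
    - right. unfold e1. field. lra. }
  assert (A2 : Cmod (P x' y' - P x y - l * v) * Cmod k <= eps / 2 * n).
  { apply Rle_trans with (e2 * n * Cmod k).
    - apply Rmult_le_compat_r; lra.
    - apply Rle_trans with (e2 * n * (1 + Cmod k)).
      + apply Rmult_le_compat_l; [apply Rmult_le_pos; lra | lra].
      + right. unfold e2. field. lra. }
  lra.
Qed.

Lemma cderiv_div_sub f a c z k : cderiv f z k -> z <> a ->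
  exists l, cderiv (fun y => (f y - c) / (y - a))%C z l.
Proof.
  intros Hf Hza.
  assert (H1 := cderiv_plus _ _ _ _ _ Hf (cderiv_const (- c) z)).
  assert (H2 := cderiv_plus _ _ _ _ _ (cderiv_id z) (cderiv_const (- a) z)).
  assert (H3 := cderiv_comp Cinv (fun y => y + - a)%C z _ _ (cderiv_inv _ (Cminus_eq_contra _ _ Hza)) H2).
  eexists. exact (cderiv_mult _ _ _ _ _ H1 H3).
Qed.

Lemma ccont_mult f g z : ccont f z -> ccont g z -> ccont (fun y => f y * g y)%C z.
Proof.
  intros HF HG eps He. destruct (Cmult_continuous (f z) (g z) eps He) as (d & Hd & H).
  destruct (HF d Hd) as (d1 & Hd1 & H1). destruct (HG d Hd) as (d2 & Hd2 & H2).
  exists (Rmin d1 d2). split; [apply Rmin_pos; auto|]. intros y Hy.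
  destruct (Rmin_Rgt_l _ _ _ Hy) as [Hy1 Hy2]. apply H; auto.
Qed.

Lemma slope_ccont f a l : cderiv f a l ->
  ccont (fun z => if Ceq_dec z a then l else (f z - f a) / (z - a))%C a.
Proof.
  intros H eps He. destruct (H (eps / 2)) as (d & Hd & H1); [lra|].
  exists d. split; auto. intros y Hy. destruct (Ceq_dec a a) as [_ | N]; [|congruence].
  destruct (Ceq_dec y a) as [-> | N].
  - replace (l - l)%C with (RtoC 0) by ring. rewrite Cmod_0. exact He.
  - assert (N' := Cminus_eq_contra _ _ N).
    replace ((f y - f a) / (y - a) - l)%C with ((f y - f a - (y - a) * l) / (y - a))%C by (field; auto).
    rewrite Cmod_div by auto. assert (P : 0 < Cmod (y - a)) by (apply Cmod_gt_0; auto).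
    apply Rle_lt_trans with (eps / 2 * Cmod (y - a) / Cmod (y - a)).
    + apply Rmult_le_compat_r; [left; apply Rinv_0_lt_compat; auto | apply H1; auto].
    + replace (eps / 2 * Cmod (y - a) / Cmod (y - a)) with (eps / 2) by (field; lra). lra.
Qed.

Lemma exp_lt_1 s : s < 0 -> exp s < 1.
Proof. intros H. rewrite <- exp_0. apply exp_increasing. exact H. Qed.

Lemma exp_le s t : s <= t -> exp s <= exp t.
Proof. intros [H | ->]; [left; apply exp_increasing; auto | right; auto]. Qed.

Lemma Cminus_polar_ge s t a : exp s - Cmod a <= Cmod (polar s t - a).
Proof. rewrite <- (Cmod_polar s t). apply Cmod_minus_ge. Qed.

Lemma polar_minus_neq_0 s t a : Cmod a < exp s -> (polar s t - a)%C <> RtoC 0.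
Proof. intros H. apply Cmod_gt_0. assert (T := Cminus_polar_ge s t a). lra. Qed.

Lemma pcont_cauchy_kernel s a t : Cmod a < exp s -> pcont (fun t => / (polar s t - a))%C t.
Proof.
  intros H. apply (pcont_comp Cinv).
  - apply cderiv_ccont with (- (/ (polar s t - a) * / (polar s t - a)))%C.
    apply cderiv_inv, polar_minus_neq_0, H.
  - apply pcont_plus; [apply pcont_polar | apply pcont_const].
Qed.

(* The integrand is holomorphic outside the closed disk of radius |a| and tends to 1 at infinity. *)
Lemma Cint_cauchy_kernel s a : Cmod a < exp s ->
  Cint (fun t => polar s t / (polar s t - a))%C 0 (2 * PI) = RtoC (2 * PI).
Proof.
  intros Ha. assert (HPI := PI_RGT_0). assert (Ha0 := Cmod_ge_0 a).
  apply Ceq_minus, Cmod_eq_0, Rle_antisym; [|apply Cmod_ge_0].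
  apply le_epsilon. intros eps He. rewrite Rplus_0_l.
  set (k := fun z => (z / (z - a))%C). set (H := fun x y => k (polar x y)).
  (* On the circle of radius r the kernel differs from 1 by |a| / |z - a| <= eps / (4 pi); the
     summand [exp s] keeps this circle outside the initial one. *)
  set (r := Cmod a + exp s + 4 * PI * Cmod a / eps).
  assert (Hr0 : 0 <= 4 * PI * Cmod a / eps).
  { apply Rmult_le_pos; [apply Rmult_le_pos; lra | left; apply Rinv_0_lt_compat; lra]. }
  assert (Hes := exp_pos s).
  assert (Hr : 0 < r) by (unfold r; lra).
  assert (Er : exp (ln r) = r) by (apply exp_ln; auto).
  assert (Hsr : s <= ln r).
  { rewrite <- (ln_exp s). apply ln_le; auto. unfold r; lra. }
  assert (Hd : forall x y, s <= x -> exists l, hderiv H x y l).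
  { intros x y Hx. assert (Hax : Cmod a < exp x) by (assert (T := exp_le s x Hx); lra).
    eexists. apply (hderiv_comp k polar); [|apply hderiv_polar].
    apply cderiv_mult; [apply cderiv_id|].
    apply (cderiv_comp Cinv (fun y => y + - a)%C).
    - apply cderiv_inv, polar_minus_neq_0, Hax.
    - apply cderiv_plus; [apply cderiv_id | apply cderiv_const]. }
  assert (E := mean2pi_const H s (ln r) Hsr ltac:(intros x y; unfold H; rewrite polar_periodic; reflexivity)
      (fun x y Hx => Hd x y (proj1 Hx))).
  change (Cint (fun t => polar s t / (polar s t - a))%C 0 (2 * PI)) with (mean2pi H s). rewrite E.
  unfold mean2pi.
  replace (RtoC (2 * PI)) with (Cint (fun _ => RtoC 1) 0 (2 * PI)).
  2:{ rewrite Cint_const, Cmult_1_r. f_equal. ring. }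
  assert (HpH : forall t, pcont (H (ln r)) t).
  { intros t. destruct (Hd (ln r) t Hsr) as [l Hl]. apply hcont_pcont_y, (hderiv_hcont _ _ _ _ Hl). }
  rewrite <- Cint_minus; [| lra | intros t _; apply HpH | intros t _; apply pcont_const].
  replace eps with (2 * (eps / (4 * PI)) * (2 * PI - 0)) by (field; lra).
  apply Cint_bound; [lra | |].
  - intros t _. apply (pcont_plus (H (ln r)) (fun _ => - RtoC 1)%C); [apply HpH | apply pcont_const].
  - intros t _. unfold H, k.
    assert (N : (polar (ln r) t - a)%C <> RtoC 0) by (apply polar_minus_neq_0; rewrite Er; unfold r; lra).
    replace (polar (ln r) t / (polar (ln r) t - a) - 1)%C with (a / (polar (ln r) t - a))%C by (field; auto).
    rewrite Cmod_div by auto.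
    assert (T := Cminus_polar_ge (ln r) t a). rewrite Er in T.
    assert (T2 : 4 * PI * Cmod a / eps < Cmod (polar (ln r) t - a)) 
      by (assert (Hrd : r = Cmod a + exp s + 4 * PI * Cmod a / eps) by reflexivity; lra).
    set (m := Cmod (polar (ln r) t - a)) in *.
    apply Rmult_le_reg_r with m; [lra|].
    replace (Cmod a / m * m) with (Cmod a) by (field; lra).
    replace (Cmod a) with (eps / (4 * PI) * (4 * PI * Cmod a / eps)) by (field; lra).
    apply Rmult_le_compat_l; [left; apply Rdiv_lt_0_compat; lra | lra].
Qed.

Lemma Ceq_of_mult (c x y : C) : c <> RtoC 0 -> (c * x = c * y)%C -> x = y.
Proof.
  intros Hc E. replace x with (/ c * (c * x))%C by (field; auto). rewrite E. field. auto.
Qed.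

Lemma RtoC_neq_0 x : x <> 0 -> RtoC x <> RtoC 0.
Proof. intros H E. apply H, RtoC_inj, E. Qed.

Lemma holo_ccont f z : holomorphic_on_disk f -> disk z -> ccont f z.
Proof.
  intros Hf Hz. destruct (proj1 (ex_derive_cderiv f z) (Hf z Hz)) as [l Hl].
  exact (cderiv_ccont _ _ _ Hl).
Qed.

Lemma disk_polar s t : s < 0 -> disk (polar s t).
Proof. intros H. unfold disk. rewrite Cmod_polar. apply exp_lt_1, H. Qed.

Lemma pcont_holo f s t : holomorphic_on_disk f -> s < 0 -> pcont (fun t => f (polar s t)) t.
Proof.
  intros Hf Hs. apply pcont_comp; [apply holo_ccont; auto; apply disk_polar, Hs | apply pcont_polar].
Qed.

(** Let q be the slope of f at a and h(z) = z q(z), where the factor z accounts for dz = i z dt. The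
    circular means of h are constant and tend to h(0) = 0 at the centre, so they vanish; splitting q
    into its two terms and integrating the kernel gives the formula. *)
Lemma cauchy_formula f s a : holomorphic_on_disk f -> s < 0 -> Cmod a < exp s ->
  Cint (fun t => f (polar s t) * polar s t / (polar s t - a))%C 0 (2 * PI) = (RtoC (2 * PI) * f a)%C.
Proof.
  intros Hf Hs Ha. assert (HPI := PI_RGT_0). assert (Ha1 : disk a).
  { unfold disk. assert (T := exp_lt_1 s Hs). lra. }
  destruct (proj1 (ex_derive_cderiv f a) (Hf a Ha1)) as [l Hl].
  set (q := fun z => if Ceq_dec z a then l else ((f z - f a) / (z - a))%C).
  set (h := fun z => (z * q z)%C).
  assert (Hqd : forall z, disk z -> z <> a -> exists k, cderiv h z k).
  { intros z Hz Hza. destruct (proj1 (ex_derive_cderiv f z) (Hf z Hz)) as [k Hk].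
    destruct (cderiv_div_sub f a (f a) z k Hk Hza) as [k' Hk'].
    eexists. apply cderiv_mult; [apply cderiv_id|].
    apply (cderiv_local (fun y => (f y - f a) / (y - a))%C) with (r := Cmod (z - a)).
    - apply Cmod_gt_0, Cminus_eq_contra, Hza.
    - intros y Hy. unfold q. destruct (Ceq_dec y a) as [-> | N]; auto.
      rewrite Cmod_minus_sym in Hy. lra.
    - exact Hk'. }
  assert (Hhc : forall z, disk z -> ccont h z).
  { intros z Hz. destruct (Ceq_dec z a) as [-> | N].
    - apply ccont_mult; [apply ccont_id | apply slope_ccont, Hl].
    - destruct (Hqd z Hz N) as [k Hk]. exact (cderiv_ccont _ _ _ Hk). }
  set (H := fun x y => h (polar x y)).
  assert (Hh0 : h (RtoC 0) = RtoC 0) by (unfold h; ring).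
  (* The circle through a is the exceptional one. For a = 0 no circle meets a, and any value below s
     will do. *)
  set (x0 := if Ceq_dec a 0 then s - 1 else ln (Cmod a)).
  assert (Hx0s : x0 < s).
  { unfold x0. destruct (Ceq_dec a 0) as [_ | N]; [lra|].
    apply exp_lt_inv. rewrite exp_ln; auto. apply Cmod_gt_0, N. }
  assert (Hne : forall x y, x <> x0 -> polar x y <> a).
  { intros x y Hx E. unfold x0 in Hx. destruct (Ceq_dec a 0) as [E0 | N].
    - apply (polar_neq_0 x y). congruence.
    - apply Hx. rewrite <- E, Cmod_polar, ln_exp. reflexivity. }
  assert (J0 : mean2pi H s = RtoC 0).
  { apply Cmod_eq_0, Rle_antisym; [|apply Cmod_ge_0]. apply le_epsilon. intros eps He. rewrite Rplus_0_l.
    assert (HD0 : disk 0) by (unfold disk; rewrite Cmod_0; lra).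
    destruct (Hhc 0 HD0 (eps / (4 * PI))) as (d & Hd & H1); [apply Rdiv_lt_0_compat; lra|].
    set (x := Rmin (x0 - 1) (ln d - 1)).
    assert (Hx1 := Rmin_l (x0 - 1) (ln d - 1)). assert (Hx2 := Rmin_r (x0 - 1) (ln d - 1)). fold x in Hx1, Hx2.
    assert (E := mean2pi_const_except H x s x0 ltac:(lra)).
    rewrite <- E; clear E.
    - replace eps with (2 * (eps / (4 * PI)) * (2 * PI - 0)) by (field; lra).
      apply Cint_bound; [lra | |].
      + intros t _. apply (pcont_comp h); [apply Hhc, disk_polar; lra | apply pcont_polar].
      + intros t _. left. specialize (H1 (polar x t)). rewrite Hh0 in H1.
        replace (h (polar x t) - 0)%C with (h (polar x t)) in H1 by ring. apply H1.
        replace (polar x t - 0)%C with (polar x t) by ring. rewrite Cmod_polar.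
        apply Rlt_le_trans with (exp (ln d)).
        * apply exp_increasing. lra.
        * right. apply exp_ln. exact Hd.
    - intros u v. unfold H. rewrite polar_periodic. reflexivity.
    - intros u v Hu. apply (hcont_comp h); [apply Hhc, disk_polar; lra | apply hcont_polar].
    - intros u v Hu Hu0. destruct (Hqd (polar u v)) as [k Hk]; [apply disk_polar; lra | apply Hne, Hu0|].
      eexists. apply (hderiv_comp h); [exact Hk | apply hderiv_polar]. }
  set (K := fun t => (polar s t / (polar s t - a))%C).
  assert (PK : pcont_on K 0 (2 * PI)).
  { intros t _. apply pcont_mult; [apply pcont_polar | apply pcont_cauchy_kernel, Ha]. }
  set (F := fun t => (f (polar s t) * K t)%C).
  assert (PF : pcont_on F 0 (2 * PI)).
  { intros t Ht. apply pcont_mult; [apply pcont_holo; auto | apply PK, Ht]. }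
  assert (E1 : mean2pi H s = (Cint F 0 (2 * PI) - f a * Cint K 0 (2 * PI))%C).
  { unfold mean2pi. rewrite <- Cint_scal, <- Cint_minus; auto; try lra.
    - apply Cint_ext; [lra|]. intros t _. unfold H, h, q, F, K.
      destruct (Ceq_dec (polar s t) a) as [E | N].
      + exfalso. apply (polar_minus_neq_0 s t a Ha). rewrite E. ring.
      + field. apply Cminus_eq_contra, N.
    - intros t Ht. apply pcont_mult; [apply pcont_const | apply PK, Ht]. }
  unfold K in E1 at 1. rewrite Cint_cauchy_kernel in E1 by auto. rewrite J0 in E1.
  transitivity (Cint F 0 (2 * PI)).
  - apply Cint_ext; [lra|]. intros t _. unfold F, K, Cdiv. ring.
  - replace (Cint F 0 (2 * PI)) with (Cint F 0 (2 * PI) - f a * RtoC (2 * PI) + f a * RtoC (2 * PI))%C by ring.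
    rewrite <- E1. ring.
Qed.

(** * Cauchy transforms, Lipschitz bounds and division by z - a *)

Lemma pcont_bounded G a b : pcont_on G a b ->
  exists M, 0 <= M /\ forall t, a <= t <= b -> Cmod (G t) <= M.
Proof.
  intros H.
  destruct (@bounded_continuity R_AbsRing R_NormedModule (fun t => Re (G t)) a b) as [M1 H1].
  { intros t Ht. apply pcont_continuous_re, H, Ht. }
  destruct (@bounded_continuity R_AbsRing R_NormedModule (fun t => Im (G t)) a b) as [M2 H2].
  { intros t Ht. apply pcont_continuous_im, H, Ht. }
  exists (Rabs M1 + Rabs M2). split; [apply Rplus_le_le_0_compat; apply Rabs_pos|].
  intros t Ht. eapply Rle_trans; [apply Cmod_le_re_im|].
  specialize (H1 t Ht). specialize (H2 t Ht).
  change (Rabs (Re (G t)) < M1) in H1. change (Rabs (Im (G t)) < M2) in H2.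
  assert (T1 := Rle_abs M1). assert (T2 := Rle_abs M2). lra.
Qed.

Lemma Cmod_div_le x y m d : Cmod x <= m -> 0 < d -> d <= Cmod y -> Cmod (x / y) <= m / d.
Proof.
  intros Hx Hd Hy. assert (Ny : y <> RtoC 0) by (apply Cmod_gt_0; lra).
  rewrite Cmod_div by auto. apply Rmult_le_compat; auto using Cmod_ge_0.
  - left. apply Rinv_0_lt_compat. lra.
  - apply Rinv_le_contravar; auto.
Qed.

Lemma pcont_on_kernel G s z : pcont_on G 0 (2 * PI) -> Cmod z < exp s ->
  pcont_on (fun t => G t / (polar s t - z))%C 0 (2 * PI).
Proof. intros HG Hz t Ht. apply pcont_mult; [apply HG, Ht | apply pcont_cauchy_kernel, Hz]. Qed.

Lemma pcont_on_holo f s : holomorphic_on_disk f -> s < 0 ->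
  pcont_on (fun t => f (polar s t) * polar s t)%C 0 (2 * PI).
Proof. intros Hf Hs t _. apply pcont_mult; [apply pcont_holo; auto | apply pcont_polar]. Qed.

(** The first-order remainder of the kernel is exactly (y - a)^2 / ((w - a)^2 (w - y)), so
    differentiation under the integral needs only a uniform bound on that fraction. *)
Lemma cauchy_transform_cderiv G s a : pcont_on G 0 (2 * PI) -> Cmod a < exp s ->
  exists l, cderiv (fun z => Cint (fun t => G t / (polar s t - z))%C 0 (2 * PI)) a l.
Proof.
  intros HG Ha. assert (HPI := PI_RGT_0).
  destruct (pcont_bounded G 0 (2 * PI) HG) as (M & HM & HMt).
  set (rho := exp s - Cmod a). assert (Hrho : 0 < rho) by (unfold rho; lra).
  assert (Pk := fun z => pcont_on_kernel G s z HG).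
  assert (Pk2 := fun z => pcont_on_kernel _ s z (Pk a Ha)).
  assert (Pk3 := fun z => pcont_on_kernel _ s z (Pk2 a Ha)).
  exists (Cint (fun t => G t / (polar s t - a) / (polar s t - a))%C 0 (2 * PI)).
  intros eps He.
  set (B := 2 * (M / rho / rho / (rho / 2)) * (2 * PI - 0)).
  assert (HB : 0 <= B).
  { unfold B. repeat (apply Rmult_le_pos; try lra); left; apply Rinv_0_lt_compat; lra. }
  exists (Rmin (rho / 2) (eps / (B + 1))). split.
  { apply Rmin_pos; [lra | apply Rdiv_lt_0_compat; lra]. }
  intros y Hy.
  destruct (Rmin_Rgt_l _ _ _ Hy) as [Hy1 Hy2].
  assert (Hys : Cmod y <= exp s - rho / 2).
  { assert (T := Cmod_minus_ge y a). unfold rho in *. lra. }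
  assert (E : (Cint (fun t => G t / (polar s t - y)) 0 (2 * PI) - Cint (fun t => G t / (polar s t - a)) 0 (2 * PI)
     - (y - a) * Cint (fun t => G t / (polar s t - a) / (polar s t - a)) 0 (2 * PI))%C
     = ((y - a) * (y - a) * Cint (fun t => G t / (polar s t - a) / (polar s t - a) / (polar s t - y)) 0 (2 * PI))%C).
  { rewrite <- Cint_scal, <- Cint_minus, <- Cint_minus, <- Cint_scal; try lra;
      try (apply Pk; lra); try (apply Pk2; lra); try (apply Pk3; lra).
    - apply Cint_ext; [lra|]. intros t _. field.
      split; apply polar_minus_neq_0; lra.
    - intros t Ht. apply pcont_minus; apply Pk; auto; lra.
    - intros t Ht. apply pcont_mult; [apply pcont_const | apply (Pk2 a Ha t Ht)]. }
  rewrite E, !Cmod_mult.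
  assert (Bd : Cmod (Cint (fun t => G t / (polar s t - a) / (polar s t - a) / (polar s t - y))%C 0 (2 * PI)) <= B).
  { unfold B. apply Cint_bound; [lra | apply Pk3; lra|]. intros t Ht.
    assert (T1 := Cminus_polar_ge s t a). assert (T2 := Cminus_polar_ge s t y).
    apply Cmod_div_le; try (unfold rho in *; lra). apply Cmod_div_le; try (unfold rho in *; lra).
    apply Cmod_div_le; try (unfold rho in *; lra). apply HMt, Ht. }
  assert (Hya := Cmod_ge_0 (y - a)).
  rewrite Rmult_assoc, (Rmult_comm eps). apply Rmult_le_compat_l; auto.
  apply Rle_trans with (eps / (B + 1) * B).
  - apply Rmult_le_compat; auto using Cmod_ge_0; lra.
  - apply Rle_trans with (eps / (B + 1) * (B + 1)).
    + apply Rmult_le_compat_l; [left; apply Rdiv_lt_0_compat|]; lra.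
    + right. field. lra.
Qed.

(** The logarithmic radius of the circle halfway between radius r and the unit circle. *)
Definition mid (r : R) : R := ln ((1 + r) / 2).

Lemma exp_mid r : 0 <= r -> exp (mid r) = (1 + r) / 2.
Proof. intros H. apply exp_ln. lra. Qed.

Lemma mid_lt_0 r : 0 <= r -> r < 1 -> mid r < 0.
Proof. intros H0 H1. unfold mid. rewrite <- ln_1. apply ln_increasing; lra. Qed.

Lemma two_PI_neq_0 : RtoC (2 * PI) <> RtoC 0.
Proof. apply RtoC_neq_0. assert (H := PI_RGT_0). lra. Qed.

Lemma holo_diff_formula f s a b : holomorphic_on_disk f -> s < 0 -> Cmod a < exp s -> Cmod b < exp s ->
  (RtoC (2 * PI) * (f a - f b) = (a - b) *
   Cint (fun t => f (polar s t) * polar s t / (polar s t - b) / (polar s t - a)) 0 (2 * PI))%C.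
Proof.
  intros Hf Hs Ha Hb. assert (HPI := PI_RGT_0).
  assert (Pk := fun z => pcont_on_kernel _ s z (pcont_on_holo f s Hf Hs)).
  replace (RtoC (2 * PI) * (f a - f b))%C with (RtoC (2 * PI) * f a - RtoC (2 * PI) * f b)%C by ring.
  rewrite <- (cauchy_formula f s a), <- (cauchy_formula f s b) by auto.
  rewrite <- Cint_scal, <- Cint_minus; try lra; try (apply Pk; auto).
  - apply Cint_ext; [lra|]. intros t _. field. split; apply polar_minus_neq_0; auto.
  - apply pcont_on_kernel; auto.
Qed.

Lemma holo_lipschitz f r : holomorphic_on_disk f -> r < 1 ->
  exists L, 0 <= L /\ forall z w, Cmod z <= r -> Cmod w <= r -> Cmod (f z - f w) <= L * Cmod (z - w).
Proof.
  (* No point has negative modulus. Admitting this case allows radii such as 1 - d with d > 1. *)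
  intros Hf Hr1. destruct (Rlt_le_dec r 0) as [Hneg | Hr0].
  { exists 0. split; [lra|]. intros z w Hz. assert (T := Cmod_ge_0 z). lra. }
  assert (HPI := PI_RGT_0). set (s := mid r).
  assert (Es : exp s = (1 + r) / 2) by (apply exp_mid; auto). assert (Hs : s < 0) by (apply mid_lt_0; auto).
  assert (Pf := pcont_on_holo f s Hf Hs).
  destruct (pcont_bounded _ _ _ Pf) as (M & HM & HMt).
  exists (2 * (M / (exp s - r) / (exp s - r))). split.
  { apply Rmult_le_pos; [lra|]. apply Rmult_le_pos; [apply Rmult_le_pos; auto|]; left; apply Rinv_0_lt_compat; lra. }
  intros z w Hz Hw.
  apply Rmult_le_reg_l with (2 * PI); [lra|].
  replace (2 * PI * Cmod (f z - f w)) with (Cmod (RtoC (2 * PI) * (f z - f w))%C)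
    by (rewrite Cmod_mult, Cmod_R, Rabs_pos_eq; lra).
  rewrite (holo_diff_formula f s z w) by (auto; lra). rewrite Cmod_mult.
  replace (2 * PI * (2 * (M / (exp s - r) / (exp s - r)) * Cmod (z - w)))
    with (Cmod (z - w) * (2 * (M / (exp s - r) / (exp s - r)) * (2 * PI - 0))) by ring.
  apply Rmult_le_compat_l; [apply Cmod_ge_0|].
  apply Cint_bound; [lra | |].
  - apply pcont_on_kernel; [apply pcont_on_kernel; [exact Pf|]|]; lra.
  - intros t Ht. assert (T := Cminus_polar_ge s t z). assert (T' := Cminus_polar_ge s t w).
    apply Cmod_div_le; try lra. apply Cmod_div_le; try lra. apply HMt, Ht.
Qed.

Lemma holo_bounded f r : holomorphic_on_disk f -> r < 1 ->
  exists M, 0 <= M /\ forall z, Cmod z <= r -> Cmod (f z) <= M.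
Proof.
  intros Hf Hr. destruct (holo_lipschitz f r Hf Hr) as (L & HL & H).
  exists (Cmod (f 0) + L). split; [assert (T := Cmod_ge_0 (f 0)); lra|]. intros z Hz.
  assert (P := Cmod_ge_0 z). specialize (H z 0 Hz ltac:(rewrite Cmod_0; lra)).
  replace (z - 0)%C with z in H by ring.
  assert (L * Cmod z <= L * 1) by (apply Rmult_le_compat_l; lra).
  assert (T := Cmod_minus_ge (f z) (f 0)). lra.
Qed.

Lemma disk_open z : disk z -> exists r, 0 < r /\ forall y, Cmod (y - z) < r -> disk y.
Proof.
  unfold disk. intros H. exists (1 - Cmod z). split; [lra|].
  intros y Hy. assert (T := Cmod_minus_ge y z). lra.
Qed.

(* The quotient is, near [a], the Cauchy transform of a continuous function on a circle. *)
Lemma holo_division f a : holomorphic_on_disk f -> disk a ->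
  exists q, on_disk q /\ holomorphic_on_disk q /\
    forall z, disk z -> (f z - f a = (z - a) * q z)%C.
Proof.
  intros Hf Ha. assert (HPI := PI_RGT_0). assert (Ha0 := Cmod_ge_0 a).
  set (s := mid (Cmod a)).
  assert (Es : exp s = (1 + Cmod a) / 2) by (apply exp_mid; auto).
  assert (Hs : s < 0) by (apply mid_lt_0; auto).
  unfold disk in Ha.
  set (G := fun t => (f (polar s t) * polar s t / (polar s t - a))%C).
  assert (PG : pcont_on G 0 (2 * PI)).
  { apply pcont_on_kernel; [apply pcont_on_holo; auto | lra]. }
  set (T := fun z => Cint (fun t => G t / (polar s t - z))%C 0 (2 * PI)).
  set (q := fun z => if Rlt_dec (Cmod z) 1 then
       (if Ceq_dec z a then / RtoC (2 * PI) * T z else (f z - f a) / (z - a))%C else RtoC 0).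
  assert (HqT : forall z, Cmod z < exp s -> q z = (/ RtoC (2 * PI) * T z)%C).
  { intros z Hz. unfold q. destruct (Rlt_dec (Cmod z) 1) as [_ | N]; [|lra].
    destruct (Ceq_dec z a) as [_ | N]; auto.
    assert (N' := Cminus_eq_contra _ _ N).
    assert (E := holo_diff_formula f s z a Hf Hs Hz ltac:(lra)). fold (T z) in E.
    apply (Ceq_of_mult (RtoC (2 * PI))); [apply two_PI_neq_0|].
    transitivity ((RtoC (2 * PI) * (f z - f a)) / (z - a))%C; [field; auto|].
    rewrite E. unfold T, G. field. split; (exact N' || apply two_PI_neq_0). }
  exists q. repeat split.
  - intros z Hz. unfold q. destruct (Rlt_dec (Cmod z) 1) as [H | _]; auto. contradiction.
  - intros z Hz. apply ex_derive_cderiv. destruct (Ceq_dec z a) as [-> | N].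
    + destruct (cauchy_transform_cderiv G s a PG ltac:(lra)) as [l Hl].
      eexists. apply (cderiv_local (fun z => / RtoC (2 * PI) * T z)%C) with (r := exp s - Cmod a).
      * lra.
      * intros y Hy. rewrite HqT; auto. assert (T1 := Cmod_minus_ge y a). lra.
      * apply cderiv_mult; [apply cderiv_const | exact Hl].
    + destruct (proj1 (ex_derive_cderiv f z) (Hf z Hz)) as [k Hk].
      destruct (cderiv_div_sub f a (f a) z k Hk N) as [k' Hk'].
      destruct (disk_open z Hz) as (r & Hr & Hr1).
      exists k'. apply (cderiv_local (fun y => (f y - f a) / (y - a))%C) with (r := Rmin r (Cmod (z - a))).
      * apply Rmin_pos; auto. apply Cmod_gt_0, Cminus_eq_contra, N.
      * intros y Hy. unfold q. destruct (Rlt_dec (Cmod y) 1) as [_ | N1].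
        -- destruct (Ceq_dec y a) as [-> | _]; auto. exfalso.
           assert (T1 := Rlt_le_trans _ _ _ Hy (Rmin_r _ _)). rewrite Cmod_minus_sym in T1. lra.
        -- exfalso. apply N1. apply Hr1. eapply Rlt_le_trans; [exact Hy | apply Rmin_l].
      * exact Hk'.
  - intros z Hz. unfold q. destruct (Rlt_dec (Cmod z) 1) as [_ | N1]; [|contradiction].
    destruct (Ceq_dec z a) as [-> | N]; [ring|]. field. apply Cminus_eq_contra, N.
Qed.

(** * Taylor coefficients *)

(** Cauchy's coefficient integral on the circle of radius [exp s]. Since dz = i z dt, the exponent
    is n and not n + 1. *)
Definition tcoef (f : C -> C) (s : R) (n : nat) : C :=
  (/ RtoC (2 * PI) * Cint (fun t => f (polar s t) / polar s t ^ n) 0 (2 * PI))%C.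

Lemma cderiv_pow z n : exists l, cderiv (fun y => y ^ n)%C z l.
Proof.
  induction n as [|n [l IH]]; simpl.
  - exists (RtoC 0). apply cderiv_const.
  - eexists. apply cderiv_mult; [apply cderiv_id | exact IH].
Qed.

Lemma cderiv_div_pow f z k n : cderiv f z k -> z <> RtoC 0 ->
  exists l, cderiv (fun y => f y / y ^ n)%C z l.
Proof.
  intros Hf Hz. destruct (cderiv_pow z n) as [l Hl].
  eexists. apply cderiv_mult; [exact Hf|].
  apply (cderiv_comp Cinv (fun y => y ^ n)%C); [apply cderiv_inv, Cpow_nz, Hz | exact Hl].
Qed.

Lemma pcont_tcoef f s n t : holomorphic_on_disk f -> s < 0 ->
  pcont (fun t => f (polar s t) / polar s t ^ n)%C t.
Proof.
  intros Hf Hs. destruct (proj1 (ex_derive_cderiv f _) (Hf _ (disk_polar s t Hs))) as [k Hk].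
  destruct (cderiv_div_pow f _ k n Hk (polar_neq_0 s t)) as [l Hl].
  apply (pcont_comp (fun y => f y / y ^ n)%C); [apply (cderiv_ccont _ _ _ Hl) | apply pcont_polar].
Qed.

Lemma tcoef_indep f s s' n : holomorphic_on_disk f -> s < 0 -> s' < 0 -> tcoef f s n = tcoef f s' n.
Proof.
  intros Hf.
  assert (W : forall s s', s <= s' -> s' < 0 -> tcoef f s n = tcoef f s' n).
  { intros u v Huv Hv. unfold tcoef. f_equal.
    apply (mean2pi_const (fun x y => f (polar x y) / polar x y ^ n)%C u v Huv).
    - intros x y. rewrite polar_periodic. reflexivity.
    - intros x y Hx.
      destruct (proj1 (ex_derive_cderiv f _) (Hf _ (disk_polar x y ltac:(lra)))) as [k Hk].
      destruct (cderiv_div_pow f _ k n Hk (polar_neq_0 x y)) as [l Hl].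
      eexists. apply (hderiv_comp (fun y => f y / y ^ n)%C); [exact Hl | apply hderiv_polar]. }
  intros Hs Hs'. destruct (Rle_lt_dec s s') as [H | H]; [apply W; auto | symmetry; apply W; lra].
Qed.

Lemma tcoef_bound f s n M : holomorphic_on_disk f -> s < 0 ->
  (forall t, Cmod (f (polar s t)) <= M) -> Cmod (tcoef f s n) <= 2 * (M / exp s ^ n).
Proof.
  intros Hf Hs HM. assert (HPI := PI_RGT_0). unfold tcoef.
  rewrite Cmod_mult, Cmod_inv, Cmod_R, Rabs_pos_eq by (apply two_PI_neq_0 || lra).
  replace (2 * (M / exp s ^ n)) with (/ (2 * PI) * (2 * (M / exp s ^ n) * (2 * PI - 0)))
    by (field; split; [apply pow_nonzero, Rgt_not_eq, exp_pos | lra]).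
  apply Rmult_le_compat_l; [left; apply Rinv_0_lt_compat; lra|].
  apply Cint_bound; [lra | intros t _; apply pcont_tcoef; auto|].
  intros t _. apply Cmod_div_le; auto.
  - apply pow_lt, exp_pos.
  - rewrite Cmod_pow, Cmod_polar. lra.
Qed.

Lemma tcoef_plus f g s n : holomorphic_on_disk f -> holomorphic_on_disk g -> s < 0 ->
  tcoef (fadd f g) s n = (tcoef f s n + tcoef g s n)%C.
Proof.
  intros Hf Hg Hs. unfold tcoef. rewrite <- Cmult_plus_distr_l. f_equal.
  assert (HPI := PI_RGT_0). rewrite <- Cint_plus; try lra; try (intros t _; apply pcont_tcoef; auto).
  apply Cint_ext; [lra|]. intros t _. unfold fadd. field. apply Cpow_nz, polar_neq_0.
Qed.

Lemma tcoef_scal c f s n : holomorphic_on_disk f -> s < 0 ->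
  tcoef (fun z => c * f z)%C s n = (c * tcoef f s n)%C.
Proof.
  intros Hf Hs. unfold tcoef. assert (HPI := PI_RGT_0).
  transitivity (/ RtoC (2 * PI) * (c * Cint (fun t => f (polar s t) / polar s t ^ n) 0 (2 * PI)))%C; [|ring].
  f_equal. rewrite <- Cint_scal; try lra; try (intros t _; apply pcont_tcoef; auto).
  apply Cint_ext; [lra|]. intros t _. field. apply Cpow_nz, polar_neq_0.
Qed.

(** Each step peels one term off the geometric series of the kernel: 1 / (w^N (w - a)) = 1 / w^(N+1)
    + a / (w^(N+1) (w - a)). Cauchy's formula is the starting point. *)
Lemma taylor_remainder f s a N : holomorphic_on_disk f -> s < 0 -> Cmod a < exp s ->
  (f a - sum_n (fun n => tcoef f s n * a ^ n) N)%C =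
  (/ RtoC (2 * PI) * Cint (fun t => a ^ S N * (f (polar s t) / polar s t ^ N / (polar s t - a))) 0 (2 * PI))%C.
Proof.
  intros Hf Hs Ha. assert (HPI := PI_RGT_0).
  assert (Pr : forall c m, pcont_on (fun t => c * (f (polar s t) / polar s t ^ m / (polar s t - a)))%C 0 (2 * PI)).
  { intros c m t Ht. apply pcont_mult; [apply pcont_const|].
    apply pcont_mult; [apply pcont_tcoef; auto | apply pcont_cauchy_kernel; auto]. }
  induction N as [|N IH].
  - rewrite sum_O. apply (Ceq_of_mult (RtoC (2 * PI))); [apply two_PI_neq_0|].
    transitivity (RtoC (2 * PI) * f a - RtoC (2 * PI) * tcoef f s 0)%C; [simpl; ring|].
    rewrite <- (cauchy_formula f s a) by auto. unfold tcoef.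
    replace (RtoC (2 * PI) * (/ RtoC (2 * PI) * Cint (fun t => f (polar s t) / polar s t ^ 0) 0 (2 * PI)))%C
      with (Cint (fun t => f (polar s t) / polar s t ^ 0)%C 0 (2 * PI)) by (field; apply two_PI_neq_0).
    rewrite <- Cint_minus; try lra.
    + transitivity (Cint (fun t => a ^ 1 * (f (polar s t) / polar s t ^ 0 / (polar s t - a)))%C 0 (2 * PI)).
      * apply Cint_ext; [lra|]. intros t _. simpl. field. apply polar_minus_neq_0, Ha.
      * field. apply two_PI_neq_0.
    + apply pcont_on_kernel; [apply pcont_on_holo; auto | exact Ha].
    + intros t _. apply pcont_tcoef; auto.
  - rewrite sum_Sn. change plus with Cplus.
    replace (f a - (sum_n (fun n => tcoef f s n * a ^ n) N + tcoef f s (S N) * a ^ S N))%C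
      with (f a - sum_n (fun n => tcoef f s n * a ^ n) N - tcoef f s (S N) * a ^ S N)%C
      by (simpl; ring).
    rewrite IH. unfold tcoef.
    replace (/ RtoC (2 * PI) * Cint (fun t => f (polar s t) / polar s t ^ S N) 0 (2 * PI) * a ^ S N)%C
      with (/ RtoC (2 * PI) * Cint (fun t => a ^ S N * (f (polar s t) / polar s t ^ S N)) 0 (2 * PI))%C.
    + transitivity (/ RtoC (2 * PI) * (Cint (fun t => a ^ S N * (f (polar s t) / polar s t ^ N / (polar s t - a))) 0 (2 * PI)
        - Cint (fun t => a ^ S N * (f (polar s t) / polar s t ^ S N)) 0 (2 * PI)))%C; [ring|].
      f_equal. rewrite <- Cint_minus; try lra; try apply Pr.
      * apply Cint_ext; [lra|]. intros t _. rewrite !Cpow_S. field.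
        repeat split; (apply polar_minus_neq_0, Ha) || apply polar_neq_0 || apply Cpow_nz, polar_neq_0.
      * intros t _. apply pcont_mult; [apply pcont_const | apply pcont_tcoef; auto].
    + rewrite Cint_scal; try lra; [ring | intros t _; apply pcont_tcoef; auto].
Qed.

Lemma taylor_series f s : holomorphic_on_disk f -> s < 0 -> power_series_on_disk (tcoef f s) f.
Proof.
  intros Hf Hs a Ha. assert (HPI := PI_RGT_0). assert (Ha0 := Cmod_ge_0 a).
  (* The coefficients do not depend on the circle, so the remainder may be estimated on one strictly
     between |a| and 1, where it decays like (|a| / exp s1)^n. *)
  set (s1 := mid (Cmod a)).
  assert (Es : exp s1 = (1 + Cmod a) / 2) by (apply exp_mid; auto).
  assert (Hs1 : s1 < 0) by (apply mid_lt_0; auto). unfold disk in Ha.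
  assert (E : tcoef f s = tcoef f s1).
  { apply functional_extensionality. intros n. apply tcoef_indep; auto. }
  rewrite E.
  assert (Pf : pcont_on (fun t => f (polar s1 t)) 0 (2 * PI)) by (intros t _; apply pcont_holo; auto).
  destruct (pcont_bounded _ _ _ Pf) as (M & HM & HMt).
  set (x := Cmod a / exp s1).
  assert (Hx : Rabs x < 1).
  { unfold x. assert (Hp := exp_pos s1). rewrite Rabs_pos_eq.
    - apply Rmult_lt_reg_r with (exp s1); auto. replace (Cmod a / exp s1 * exp s1) with (Cmod a) by (field; lra). lra.
    - apply Rmult_le_pos; auto. left. apply Rinv_0_lt_compat; auto. }
  set (B := 2 * M / (exp s1 - Cmod a)).
  assert (HB : 0 <= B).
  { unfold B. apply Rmult_le_pos; [lra|]. left. apply Rinv_0_lt_compat. lra. }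
  apply filterlim_locally. intros eps.
  destruct (pow_lt_1_zero x Hx (eps / (B + 1))) as [N HN].
  { apply Rdiv_lt_0_compat; [apply cond_pos | lra]. }
  (* Balls in C come from the product structure; this lemma passes from smallness in modulus to a
     ball. *)
  exists N. intros n Hn. apply C_NormedModule_mixin_compat1.
  change (Cmod (sum_n (fun n => tcoef f s1 n * a ^ n) n - f a) < eps)%C.
  rewrite Cmod_minus_sym, taylor_remainder by (auto; lra).
  specialize (HN n Hn). rewrite Rabs_pos_eq in HN.
  2:{ apply pow_le. apply Rmult_le_pos; auto. left. apply Rinv_0_lt_compat, exp_pos. }
  apply Rle_lt_trans with (x ^ n * B).
  - rewrite Cmod_mult, Cmod_inv, Cmod_R, Rabs_pos_eq by (apply two_PI_neq_0 || lra).
    replace (x ^ n * B) with (/ (2 * PI) * (2 * (Cmod a ^ n * (M / exp s1 ^ n / (exp s1 - Cmod a))) * (2 * PI - 0))).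
    2:{ unfold x, B, Rdiv. rewrite Rpow_mult_distr, pow_inv. field. repeat split; try lra.
        apply pow_nonzero, Rgt_not_eq, exp_pos. }
    apply Rmult_le_compat_l; [left; apply Rinv_0_lt_compat; lra|].
    apply Cint_bound; [lra | |].
    + intros t _. apply pcont_mult; [apply pcont_const|].
      apply pcont_mult; [apply pcont_tcoef; auto | apply pcont_cauchy_kernel; lra].
    + intros t Ht. rewrite Cmod_mult, Cmod_pow. simpl pow.
      assert (Q : Cmod (f (polar s1 t) / polar s1 t ^ n / (polar s1 t - a)) <= M / exp s1 ^ n / (exp s1 - Cmod a)).
      { apply Cmod_div_le; [| lra | apply Cminus_polar_ge].
        apply Cmod_div_le; [apply HMt, Ht | apply pow_lt, exp_pos | rewrite Cmod_pow, Cmod_polar; lra]. }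
      rewrite Rmult_assoc. rewrite <- (Rmult_1_l (Cmod a ^ n * (M / _ / _))).
      assert (Pn : 0 <= Cmod a ^ n) by (apply pow_le; auto).
      apply Rmult_le_compat; auto; [apply Rmult_le_pos; auto using Cmod_ge_0 | lra|].
      apply Rmult_le_compat_l; auto.
  - apply Rle_lt_trans with (x ^ n * (B + 1)).
    + apply Rmult_le_compat_l; [apply pow_le | lra].
      apply Rmult_le_pos; auto. left. apply Rinv_0_lt_compat, exp_pos.
    + apply Rlt_le_trans with (eps / (B + 1) * (B + 1)).
      * apply Rmult_lt_compat_r; lra.
      * right. field. lra.
Qed.

(** * Uniqueness of Taylor coefficients *)

Lemma sum_n_re (u : nat -> C) N : Re (sum_n u N) = sum_n (fun n => Re (u n)) N.
Proof.
  induction N as [|N IH]; [rewrite !sum_O; reflexivity|]. rewrite !sum_Sn, <- IH. reflexivity.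
Qed.

Lemma sum_n_im (u : nat -> C) N : Im (sum_n u N) = sum_n (fun n => Im (u n)) N.
Proof.
  induction N as [|N IH]; [rewrite !sum_O; reflexivity|]. rewrite !sum_Sn, <- IH. reflexivity.
Qed.

Lemma is_series_re (u : nat -> C) l : @is_series C_AbsRing C_NormedModule u l ->
  is_series (fun n => Re (u n)) (Re l).
Proof.
  intros H. apply filterlim_locally. intros eps.
  destruct (proj1 (filterlim_locally _ _) H eps) as [N HN]. exists N. intros n Hn.
  rewrite <- sum_n_re. exact (proj1 (HN n Hn)).
Qed.

Lemma is_series_im (u : nat -> C) l : @is_series C_AbsRing C_NormedModule u l ->
  is_series (fun n => Im (u n)) (Im l).
Proof.
  intros H. apply filterlim_locally. intros eps.
  destruct (proj1 (filterlim_locally _ _) H eps) as [N HN]. exists N. intros n Hn.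
  rewrite <- sum_n_im. exact (proj2 (HN n Hn)).
Qed.

Lemma real_series_unique (a b : nat -> R) (g : R -> R) :
  (forall x, Rabs x < 1 -> is_series (fun n => a n * x ^ n) (g x)) ->
  (forall x, Rabs x < 1 -> is_series (fun n => b n * x ^ n) (g x)) -> forall n, a n = b n.
Proof.
  intros Ha Hb n.
  assert (CV : forall c, (forall x, Rabs x < 1 -> is_series (fun n => c n * x ^ n) (g x)) ->
     Rbar_lt 0 (CV_radius c)).
  { intros c Hc. apply Rbar_not_le_lt. intros Hle.
    apply (CV_disk_outside c (/ 2)).
    - apply Rbar_le_lt_trans with (Finite 0); auto. simpl. rewrite Rabs_pos_eq; lra.
    - apply ex_series_lim_0. exists (g (/ 2)). apply Hc. rewrite Rabs_pos_eq; lra. }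
  apply PSeries_ext_recip; [apply CV, Ha | apply CV, Hb|].
  exists (mkposreal 1 Rlt_0_1). intros x Hx. change (Rabs (x - 0) < 1) in Hx. rewrite Rminus_0_r in Hx.
  unfold PSeries. rewrite (is_series_unique _ _ (Ha x Hx)), (is_series_unique _ _ (Hb x Hx)). reflexivity.
Qed.

(** On the real diameter the real and imaginary parts of the coefficients are the coefficients of
    two real power series, for which uniqueness is available. *)
Lemma power_series_unique f a b : power_series_on_disk a f -> power_series_on_disk b f ->
  forall n, a n = b n.
Proof.
  intros Ha Hb.
  assert (D : forall x, Rabs x < 1 -> disk x) by (intros x Hx; unfold disk; rewrite Cmod_R; auto).
  assert (Er : forall (c : C) (x : R) k, Re (c * x ^ k)%C = Re c * x ^ k).
  { intros c x k. rewrite <- RtoC_pow. unfold Cmult, RtoC, Re; simpl. ring. }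
  assert (Ei : forall (c : C) (x : R) k, Im (c * x ^ k)%C = Im c * x ^ k).
  { intros c x k. rewrite <- RtoC_pow. unfold Cmult, RtoC, Im; simpl. ring. }
  intros n. apply injective_projections.
  - apply (real_series_unique (fun n => Re (a n)) (fun n => Re (b n)) (fun x => Re (f x))); intros x Hx.
    + eapply is_series_ext; [|apply (is_series_re _ _ (Ha x (D x Hx)))]. intros k. apply Er.
    + eapply is_series_ext; [|apply (is_series_re _ _ (Hb x (D x Hx)))]. intros k. apply Er.
  - apply (real_series_unique (fun n => Im (a n)) (fun n => Im (b n)) (fun x => Im (f x))); intros x Hx.
    + eapply is_series_ext; [|apply (is_series_im _ _ (Ha x (D x Hx)))]. intros k. apply Ei.
    + eapply is_series_ext; [|apply (is_series_im _ _ (Hb x (D x Hx)))]. intros k. apply Ei.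
Qed.

(** [coeffs] is a mere choice among expansions; uniqueness identifies it with Cauchy's integrals on
    any circle, and this makes it linear and estimable. *)
Lemma coeffs_tcoef f s n : holomorphic_on_disk f -> s < 0 -> coeffs f n = tcoef f s n.
Proof.
  intros Hf Hs. apply (power_series_unique f); [|apply taylor_series; auto].
  apply (epsilon_spec (inhabits (fun _ => RtoC 0)) (fun a => power_series_on_disk a f)).
  exists (tcoef f s). apply taylor_series; auto.
Qed.

(** * Pointwise and coefficient growth in the class F^p *)

Definition gr (p r : R) : R := Rpower (1 - r) (- (1 / p)).

(** The limit condition of F^p as log |f| = o((1-|z|)^(-1/p)). In this form a product is handled by
    splitting eps, without suprema or logarithms. *)
Definition growth (p : R) (f : C -> C) : Prop :=
  forall eps, 0 < eps -> exists K, 0 <= K /\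
    forall z, disk z -> Cmod (f z) <= K * exp (eps * gr p (Cmod z)).

Lemma gr_pos p r : 0 < gr p r.
Proof. apply exp_pos. Qed.

Lemma exp_ge_1 x : 0 <= x -> 1 <= exp x.
Proof. intros H. rewrite <- exp_0. apply exp_le, H. Qed.

Lemma exp_gr_ge_1 p eps r : 0 < eps -> 1 <= exp (eps * gr p r).
Proof. intros H. apply exp_ge_1, Rmult_le_pos; [lra | left; apply gr_pos]. Qed.

Lemma Rpower_gr p r : Rpower (1 - r) (1 / p) * gr p r = 1.
Proof.
  unfold gr. rewrite <- Rpower_plus. replace (1 / p + - (1 / p)) with 0 by ring.
  unfold Rpower. rewrite Rmult_0_l. apply exp_0.
Qed.

Lemma gr_incr p r r' : 0 < p -> r <= r' -> r' < 1 -> gr p r <= gr p r'.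
Proof.
  intros Hp H1 H2. unfold gr, Rpower. apply exp_le.
  assert (Hi : 0 < 1 / p) by (apply Rdiv_lt_0_compat; lra).
  assert (Hl : ln (1 - r') <= ln (1 - r)).
  { destruct H1 as [H1 | ->]; [left; apply ln_increasing; lra | lra]. }
  assert (1 / p * ln (1 - r') <= 1 / p * ln (1 - r)) by (apply Rmult_le_compat_l; lra). lra.
Qed.

(** [real] sends an infinite supremum to 0, so boundedness of f on the smaller closed disk is needed
    before [Minf] says anything. *)
Lemma Minf_ge f r z : holomorphic_on_disk f -> r < 1 -> Cmod z <= r -> Cmod (f z) <= Minf r f.
Proof.
  intros Hf Hr Hz. destruct (holo_bounded f r Hf Hr) as (M & HM & HMz).
  unfold Minf. set (E := fun y => exists z : C, Cmod z <= r /\ y = Cmod (f z)).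
  destruct (Lub_Rbar_correct E) as [H1 H2].
  assert (L1 : Rbar_le (Cmod (f z)) (Lub_Rbar E)) by (apply H1; exists z; auto).
  assert (L2 : Rbar_le (Lub_Rbar E) M).
  { apply H2. intros y (w & Hw & ->). apply HMz, Hw. }
  destruct (Lub_Rbar E); simpl in *; auto; contradiction.
Qed.

Lemma Minf_le f r B : 0 <= r -> (forall z, Cmod z <= r -> Cmod (f z) <= B) -> Minf r f <= B.
Proof.
  intros Hr HB. unfold Minf. set (E := fun y => exists z : C, Cmod z <= r /\ y = Cmod (f z)).
  destruct (Lub_Rbar_correct E) as [H1 H2].
  assert (Z : Cmod 0 <= r) by (rewrite Cmod_0; auto).
  assert (L1 : Rbar_le (Cmod (f 0)) (Lub_Rbar E)) by (apply H1; exists 0; auto).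
  assert (L2 : Rbar_le (Lub_Rbar E) B).
  { apply H2. intros y (w & Hw & ->). apply HB, Hw. }
  destruct (Lub_Rbar E); simpl in *; auto; contradiction.
Qed.

Lemma ln_nonneg x : 1 <= x -> 0 <= ln x.
Proof.
  intros [H | <-]; [|rewrite ln_1; lra]. rewrite <- ln_1. left. apply ln_increasing; lra.
Qed.

Lemma ln_nonpos x : x <= 0 -> ln x = 0.
Proof. intros H. unfold ln. destruct (Rlt_dec 0 x) as [H1 | _]; [exfalso; lra | reflexivity]. Qed.

Lemma le_exp_log_plus M : M <= exp (log_plus M).
Proof.
  unfold log_plus. destruct (Rle_lt_dec M 0) as [H | H].
  - assert (T := exp_pos (Rmax (ln M) 0)). lra.
  - rewrite <- (exp_ln M H) at 1. apply exp_le, Rmax_l.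
Qed.

Lemma Fp_growth p f : Fp p f -> growth p f.
Proof.
  intros (Hd & Hf & Hl) eps He.
  destruct (proj1 (filterlim_locally _ _) Hl (mkposreal eps He)) as [d Hd1].
  destruct (holo_bounded f (1 - d) Hf) as (M & HM & HMz); [assert (T := cond_pos d); lra|].
  exists (1 + M). split; [lra|]. intros z Hz.
  assert (G1 := exp_gr_ge_1 p eps (Cmod z) He).
  destruct (Rle_lt_dec (Cmod z) (1 - d)) as [H | H].
  - specialize (HMz z H).
    assert ((1 + M) * 1 <= (1 + M) * exp (eps * gr p (Cmod z))) by (apply Rmult_le_compat_l; lra). lra.
  - unfold disk in Hz. set (r := Cmod z) in *.
    assert (B : ball 1 d r).
    { change (Rabs (r - 1) < d). rewrite Rabs_left; lra. }
    specialize (Hd1 r B Hz). change (Rabs (Rpower (1 - r) (1 / p) * log_plus (Minf r f) - 0) < eps) in Hd1.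
    rewrite Rminus_0_r in Hd1. assert (Hd2 := Rle_lt_trans _ _ _ (Rle_abs _) Hd1).
    assert (L : log_plus (Minf r f) <= eps * gr p r).
    { assert (G := gr_pos p r). assert (E := Rpower_gr p r).
      replace (log_plus (Minf r f)) with (Rpower (1 - r) (1 / p) * gr p r * log_plus (Minf r f)) by (rewrite E; ring).
      replace (Rpower (1 - r) (1 / p) * gr p r * log_plus (Minf r f))
        with (Rpower (1 - r) (1 / p) * log_plus (Minf r f) * gr p r) by ring.
      apply Rmult_le_compat_r; lra. }
    apply Rle_trans with (Minf r f); [apply Minf_ge; auto; unfold r; lra|].
    apply Rle_trans with (exp (eps * gr p r)).
    + eapply Rle_trans; [apply le_exp_log_plus | apply exp_le, L].
    + rewrite <- (Rmult_1_l (exp (eps * gr p r))) at 1. apply Rmult_le_compat_r; [left; apply exp_pos | lra].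
Qed.

Lemma growth_Fp p f : 0 < p -> on_disk f -> holomorphic_on_disk f -> growth p f -> Fp p f.
Proof.
  intros Hp Hd Hf Hg. repeat split; auto.
  apply filterlim_locally. intros eps. assert (He := cond_pos eps).
  destruct (Hg (eps / 2)) as (K0 & HK0 & HKz); [lra|].
  (* The constant contributes (1-r)^(1/p) ln K to the limit, so (1-r)^(1/p) has to stay below eta,
     that is 1 - r < eta^p. Adding 1 to [K0] ensures ln K >= 0. *)
  set (K := K0 + 1). set (eta := eps / 2 / (1 + ln K)).
  assert (HlK : 0 <= ln K) by (apply ln_nonneg; unfold K; lra).
  assert (Heta : 0 < eta) by (unfold eta; repeat apply Rdiv_lt_0_compat; lra).
  exists (mkposreal (Rmin 1 (exp (p * ln eta))) (Rmin_pos _ _ Rlt_0_1 (exp_pos _))).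
  intros r Hr Hr1. change (Rabs (r - 1) < Rmin 1 (exp (p * ln eta))) in Hr.
  rewrite Rabs_left in Hr by lra.
  destruct (Rmin_Rgt_l _ _ _ Hr) as [Hr2 Hr3].
  assert (HM : Minf r f <= K * exp (eps / 2 * gr p r)).
  { apply Minf_le; [lra|]. intros z Hz. eapply Rle_trans; [apply HKz; unfold disk; lra|].
    apply Rmult_le_compat; [lra | left; apply exp_pos | unfold K; lra |].
    apply exp_le, Rmult_le_compat_l; [lra | apply gr_incr; lra]. }
  assert (HL : log_plus (Minf r f) <= ln K + eps / 2 * gr p r).
  { assert (G : 0 <= eps / 2 * gr p r) by (apply Rmult_le_pos; [lra | left; apply gr_pos]).
    unfold log_plus. apply Rmax_lub; [|lra].
    (* For the zero function [ln] is evaluated at 0, where it takes the default value 0. *)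
    destruct (Rle_lt_dec (Minf r f) 0) as [H | H].
    - rewrite ln_nonpos by auto. lra.
    - rewrite <- (ln_exp (eps / 2 * gr p r)), <- ln_mult by (try apply exp_pos; unfold K; lra).
      destruct HM as [HM | ->]; [left; apply ln_increasing; auto | lra]. }
  assert (HP : 0 < Rpower (1 - r) (1 / p)) by apply exp_pos.
  assert (HPe : Rpower (1 - r) (1 / p) < eta).
  { rewrite <- (exp_ln eta Heta). unfold Rpower. apply exp_increasing.
    apply Rmult_lt_reg_l with p; auto. replace (p * (1 / p * ln (1 - r))) with (ln (1 - r)) by (field; lra).
    rewrite <- (ln_exp (p * ln eta)). apply ln_increasing; lra. }
  assert (L0 : 0 <= log_plus (Minf r f)) by apply Rmax_r.
  change (Rabs (Rpower (1 - r) (1 / p) * log_plus (Minf r f) - 0) < eps).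
  rewrite Rminus_0_r, Rabs_pos_eq by (apply Rmult_le_pos; lra).
  apply Rle_lt_trans with (Rpower (1 - r) (1 / p) * (ln K + eps / 2 * gr p r)).
  - apply Rmult_le_compat_l; lra.
  - replace (Rpower (1 - r) (1 / p) * (ln K + eps / 2 * gr p r))
      with (Rpower (1 - r) (1 / p) * ln K + eps / 2 * (Rpower (1 - r) (1 / p) * gr p r)) by ring.
    rewrite Rpower_gr.
    assert (A : Rpower (1 - r) (1 / p) * (1 + ln K) < eps / 2).
    { replace (eps / 2) with (eta * (1 + ln K)) by (unfold eta; field; lra). apply Rmult_lt_compat_r; lra. }
    lra.
Qed.

Lemma growth_plus p f g : growth p f -> growth p g -> growth p (fadd f g).
Proof.
  intros Hf Hg eps He. destruct (Hf eps He) as (K1 & P1 & H1). destruct (Hg eps He) as (K2 & P2 & H2).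
  exists (K1 + K2). split; [lra|]. intros z Hz. unfold fadd.
  eapply Rle_trans; [apply Cmod_triangle|]. specialize (H1 z Hz). specialize (H2 z Hz). lra.
Qed.

Lemma growth_mult p f g : growth p f -> growth p g -> growth p (fmul f g).
Proof.
  intros Hf Hg eps He. destruct (Hf (eps / 2)) as (K1 & P1 & H1); [lra|].
  destruct (Hg (eps / 2)) as (K2 & P2 & H2); [lra|].
  exists (K1 * K2). split; [apply Rmult_le_pos; auto|]. intros z Hz. unfold fmul. rewrite Cmod_mult.
  replace (K1 * K2 * exp (eps * gr p (Cmod z)))
    with (K1 * exp (eps / 2 * gr p (Cmod z)) * (K2 * exp (eps / 2 * gr p (Cmod z)))).
  - apply Rmult_le_compat; auto using Cmod_ge_0.
  - replace (eps * gr p (Cmod z)) with (eps / 2 * gr p (Cmod z) + eps / 2 * gr p (Cmod z)) by field.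
    rewrite exp_plus. ring.
Qed.

Lemma growth_bounded p f B : 0 <= B -> (forall z, disk z -> Cmod (f z) <= B) -> growth p f.
Proof.
  intros HB H eps He. exists B. split; auto. intros z Hz. specialize (H z Hz).
  assert (G1 := exp_gr_ge_1 p eps (Cmod z) He).
  assert (B * 1 <= B * exp (eps * gr p (Cmod z))) by (apply Rmult_le_compat_l; lra). lra.
Qed.

Lemma Fp_add p f g : 0 < p -> Fp p f -> Fp p g -> Fp p (fadd f g).
Proof.
  intros Hp Hf Hg. apply growth_Fp; auto.
  - intros z Hz. unfold fadd. rewrite (proj1 Hf z Hz), (proj1 Hg z Hz). ring.
  - intros z Hz. apply ex_derive_cderiv.
    destruct (proj1 (ex_derive_cderiv _ _) (proj1 (proj2 Hf) z Hz)) as [k Hk].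
    destruct (proj1 (ex_derive_cderiv _ _) (proj1 (proj2 Hg) z Hz)) as [l Hl].
    eexists. apply cderiv_plus; eauto.
  - apply growth_plus; apply Fp_growth; auto.
Qed.

Lemma Fp_mul p f g : 0 < p -> Fp p f -> Fp p g -> Fp p (fmul f g).
Proof.
  intros Hp Hf Hg. apply growth_Fp; auto.
  - intros z Hz. unfold fmul. rewrite (proj1 Hf z Hz). ring.
  - intros z Hz. apply ex_derive_cderiv.
    destruct (proj1 (ex_derive_cderiv _ _) (proj1 (proj2 Hf) z Hz)) as [k Hk].
    destruct (proj1 (ex_derive_cderiv _ _) (proj1 (proj2 Hg) z Hz)) as [l Hl].
    eexists. apply cderiv_mult; eauto.
  - apply growth_mult; apply Fp_growth; auto.
Qed.

Lemma Fp_scal p c f : 0 < p -> Fp p f -> Fp p (fun z => c * f z)%C.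
Proof.
  intros Hp Hf. apply growth_Fp; auto.
  - intros z Hz. rewrite (proj1 Hf z Hz). ring.
  - intros z Hz. apply ex_derive_cderiv.
    destruct (proj1 (ex_derive_cderiv _ _) (proj1 (proj2 Hf) z Hz)) as [k Hk].
    eexists. apply cderiv_mult; [apply cderiv_const | eauto].
  - apply (growth_mult p (fun _ => c)); [|apply Fp_growth; auto].
    apply growth_bounded with (Cmod c); [apply Cmod_ge_0 | intros; lra].
Qed.

(** * From growth on the disk to growth of the coefficients *)

Lemma nat_rpow_pos n q : 0 <= nat_rpow n q.
Proof. destruct n; simpl; [lra | left; apply exp_pos]. Qed.

Lemma exp_INR_mult n y : exp (INR n * y) = exp y ^ n.
Proof.
  induction n as [|n IH]; [simpl; rewrite Rmult_0_l; apply exp_0|].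
  rewrite S_INR, Rmult_plus_distr_r, exp_plus, IH, Rmult_1_l. simpl. ring.
Qed.

(** Cauchy's estimate on the circle of radius 1 - d with d = kap n^(-p/(p+1)). This choice balances
    both losses: (1-r)^(-1/p) and n d are then multiples of n^(1/(p+1)). As eps and K depend only on
    p and c, a growth bound controls all coefficients uniformly in f. *)
Lemma coeffs_growth p c : 0 < p -> 0 < c ->
  exists eps K, 0 < eps /\ 0 < K /\ forall A f, holomorphic_on_disk f -> 0 <= A ->
    (forall z, disk z -> Cmod (f z) <= A * exp (eps * gr p (Cmod z))) ->
    forall n, Cmod (coeffs f n) <= K * A * exp (c * nat_rpow n (1 / (p + 1))).
Proof.
  (* The bound c/4 makes the loss 2 n d from r^(-n) at most (c/2) n^(1/(p+1)), and [eps] is tuned so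
     that the growth term gives the other half. The bound 1/2 yields 1/(1-d) <= exp(2 d). *)
  intros Hp Hc. set (kap := Rmin (c / 4) (1 / 2)).
  assert (Hk0 : 0 < kap) by (apply Rmin_pos; lra).
  assert (Hk1 : kap <= c / 4) by apply Rmin_l. assert (Hk2 : kap <= 1 / 2) by apply Rmin_r.
  assert (HR : 0 < Rpower kap (- (1 / p))) by apply exp_pos.
  set (eps := c / 2 / Rpower kap (- (1 / p))).
  assert (He : 0 < eps) by (unfold eps; repeat apply Rdiv_lt_0_compat; lra).
  set (K := 2 * exp (eps * gr p (1 / 2))).
  assert (HK : 2 <= K).
  { unfold K. assert (T := exp_gr_ge_1 p eps (1 / 2) He). lra. }
  exists eps, K. split; [auto|]. split; [lra|]. intros A f Hf HA HfA n.
  assert (Main : forall r, 0 < r < 1 -> Cmod (coeffs f n) <= 2 * (A * exp (eps * gr p r) / r ^ n)).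
  { intros r [Hr0 Hr1]. assert (Hs : ln r < 0) by (rewrite <- ln_1; apply ln_increasing; lra).
    rewrite (coeffs_tcoef f (ln r)) by auto.
    assert (E : exp (ln r) = r) by (apply exp_ln; auto). 
    assert (B := tcoef_bound f (ln r) n (A * exp (eps * gr p r)) Hf Hs). rewrite E in B. apply B. intros t.
    assert (T := HfA (polar (ln r) t) (disk_polar _ t Hs)). rewrite Cmod_polar, E in T. exact T. }
  destruct n as [|n].
  (* For n = 0 there is no scale to balance; the circle of radius 1/2 is used, and it determines
     [K]. *)
  - simpl nat_rpow. rewrite Rmult_0_r, exp_0.
    eapply Rle_trans; [apply (Main (1 / 2)); lra|]. simpl. right. unfold K. field.
  - set (x := INR (S n)). set (N := nat_rpow (S n) (1 / (p + 1))).
    assert (Hx1 : 1 <= x) by (unfold x; apply (le_INR 1); lia).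
    assert (EN : N = Rpower x (1 / (p + 1))) by reflexivity.
    set (d := kap * Rpower x (- (p / (p + 1)))).
    assert (Hd0 : 0 < d) by (apply Rmult_lt_0_compat; [auto | apply exp_pos]).
    assert (Hlx := ln_nonneg x Hx1).
    assert (Hpp : 0 < p / (p + 1)) by (apply Rdiv_lt_0_compat; lra).
    assert (Hd1 : d <= kap).
    { unfold d. rewrite <- (Rmult_1_r kap) at 2. apply Rmult_le_compat_l; [lra|].
      apply Rle_trans with (exp 0); [|rewrite exp_0; lra]. apply exp_le.
      assert (0 <= p / (p + 1) * ln x) by (apply Rmult_le_pos; lra). lra. }
    eapply Rle_trans; [apply (Main (1 - d)); lra|].
    assert (G : eps * gr p (1 - d) = c / 2 * N).
    { unfold gr. replace (1 - (1 - d)) with d by ring. unfold d.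
      rewrite <- Rpower_mult_distr by (auto; apply exp_pos).
      rewrite Rpower_mult. replace (- (p / (p + 1)) * - (1 / p)) with (1 / (p + 1)) by (field; lra).
      rewrite EN. unfold eps. field. lra. }
    rewrite G.
    assert (Hdn : x * d = kap * N).
    { unfold d. rewrite EN. rewrite <- (Rpower_1 x) at 1 by lra.
      replace (Rpower x 1 * (kap * Rpower x (- (p / (p + 1)))))
        with (kap * (Rpower x 1 * Rpower x (- (p / (p + 1))))) by ring.
      rewrite <- Rpower_plus. f_equal. f_equal. field. lra. }
    assert (Hpow : / (1 - d) ^ S n <= exp (2 * (x * d))).
    { replace (2 * (x * d)) with (x * (2 * d)) by ring.
      rewrite <- pow_inv. unfold x. rewrite exp_INR_mult.
      apply pow_incr. split; [left; apply Rinv_0_lt_compat; lra|].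
      apply Rmult_le_reg_l with (1 - d); [lra|]. rewrite Rinv_r by lra.
      apply Rle_trans with ((1 - d) * (1 + 2 * d)).
      - assert (0 <= d * (1 - 2 * d)) by (apply Rmult_le_pos; lra). lra.
      - apply Rmult_le_compat_l; [lra|]. left. apply exp_ineq1. lra. }
    assert (HN : 0 <= N) by apply nat_rpow_pos.
    apply Rle_trans with (2 * (A * exp (c / 2 * N) * exp (2 * (x * d)))).
    + apply Rmult_le_compat_l; [lra|]. apply Rmult_le_compat_l; [|exact Hpow].
      apply Rmult_le_pos; [auto | left; apply exp_pos].
    + rewrite Rmult_assoc, <- exp_plus, Hdn.
      apply Rle_trans with (2 * (A * exp (c * N))).
      * apply Rmult_le_compat_l; [lra|]. apply Rmult_le_compat_l; auto. apply exp_le.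
        assert (kap * N <= c / 4 * N) by (apply Rmult_le_compat_r; auto). lra.
      * rewrite Rmult_assoc. apply Rmult_le_compat_r; [|lra].
        apply Rmult_le_pos; [auto | left; apply exp_pos].
Qed.

Lemma ex_series_nonneg_bounded (u : nat -> R) B : (forall n, 0 <= u n) ->
  (forall N, sum_n u N <= B) -> ex_series u.
Proof.
  intros Hu HB. destruct (ex_finite_lim_seq_incr (sum_n u) B) as [l Hl].
  - intros n. rewrite sum_Sn. specialize (Hu (S n)). unfold plus; simpl. lra.
  - exact HB.
  - exists l. exact Hl.
Qed.

Lemma exp_ge_Rpower y al : 0 < y -> 0 < al -> Rpower (y / al) al <= exp y.
Proof.
  intros Hy Hal. assert (Hya : 0 < y / al) by (apply Rdiv_lt_0_compat; auto).
  replace (exp y) with (Rpower (exp (y / al)) al).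
  - apply Rle_Rpower_l; [lra|]. split; auto. assert (T := exp_ineq1 (y / al) ltac:(lra)). lra.
  - unfold Rpower. rewrite ln_exp. f_equal. field. lra.
Qed.

Lemma ex_series_exp_rpow c q : 0 < c -> 0 < q -> ex_series (fun n => exp (- c * nat_rpow n q)).
Proof.
  intros Hc Hq. apply ex_series_incr_1.
  (* With this exponent exp(c x^q) dominates a constant times x^(q al) = x^2, and the comparison
     series telescopes. *)
  set (al := 2 / q). assert (Hal : 0 < al) by (apply Rdiv_lt_0_compat; lra).
  set (K := / Rpower (c / al) al).
  assert (HK : 0 < K) by (apply Rinv_0_lt_compat, exp_pos).
  assert (Hca : 0 < c / al) by (apply Rdiv_lt_0_compat; lra).
  apply (@ex_series_le R_AbsRing R_CompleteNormedModule) with (b := fun n => 2 * K * / ((INR n + 1) * (INR n + 2))).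
  - intros n. change (norm (exp (- c * nat_rpow (S n) q))) with (Rabs (exp (- c * nat_rpow (S n) q))).
    rewrite Rabs_pos_eq by (left; apply exp_pos).
    assert (Hn := pos_INR n). set (x := INR (S n)). assert (Ex : x = INR n + 1) by apply S_INR.
    assert (Hx : 0 < x) by lra.
    simpl nat_rpow. change (match n with O => 1 | S _ => INR n + 1 end) with x.
    set (N := Rpower x q). assert (HN : 0 < N) by apply exp_pos.
    assert (L : Rpower (c / al) al * (x * x) <= exp (c * N)).
    { assert (T := exp_ge_Rpower (c * N) al ltac:(apply Rmult_lt_0_compat; auto) Hal).
      replace (c * N / al) with (c / al * N) in T by (field; lra).
      rewrite <- Rpower_mult_distr in T by auto. unfold N in T. rewrite Rpower_mult in T.
      replace (q * al) with (INR 2) in T by (simpl; unfold al; field; lra).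
      rewrite Rpower_pow in T by auto. simpl in T. rewrite Rmult_1_r in T. exact T. }
    replace (- c * N) with (- (c * N)) by ring. rewrite exp_Ropp.
    apply Rle_trans with (/ (Rpower (c / al) al * (x * x))).
    + apply Rinv_le_contravar; auto. apply Rmult_lt_0_compat; [apply exp_pos | apply Rmult_lt_0_compat; auto].
    + rewrite Rinv_mult. fold K. rewrite (Rmult_comm 2 K), Rmult_assoc.
      apply Rmult_le_compat_l; [lra|].
      apply Rmult_le_reg_l with (x * x); [apply Rmult_lt_0_compat; auto|].
      rewrite Rinv_r by (apply Rgt_not_eq, Rmult_lt_0_compat; auto).
      apply Rmult_le_reg_r with ((INR n + 1) * (INR n + 2)); [apply Rmult_lt_0_compat; lra|].
      replace (x * x * (2 * / ((INR n + 1) * (INR n + 2))) * ((INR n + 1) * (INR n + 2))) with (2 * (x * x))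
        by (field; lra).
      rewrite Ex. nra.
  - apply (@ex_series_scal R_AbsRing R_NormedModule).
    apply ex_series_nonneg_bounded with 1.
    + intros n. assert (Hn := pos_INR n). left. apply Rinv_0_lt_compat, Rmult_lt_0_compat; lra.
    + intros N. assert (E : sum_n (fun n => / ((INR n + 1) * (INR n + 2))) N = 1 - / (INR N + 2)).
      { induction N as [|N IH]; [rewrite sum_O; simpl; field|].
        rewrite sum_Sn, IH, S_INR. assert (HN := pos_INR N). unfold plus; simpl. field. lra. }
      rewrite E. assert (HN := pos_INR N). assert (0 < / (INR N + 2)) by (apply Rinv_0_lt_compat; lra). lra.
Qed.

(** * A continuous functional annihilating a closed ideal *)

Lemma quadratic_discriminant a b c : 0 <= a ->
  (forall t, 0 <= a * (t * t) + 2 * t * b + c) -> b * b <= a * c.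
Proof.
  intros Ha H. destruct Ha as [Ha | <-].
  - specialize (H (- b / a)).
    replace (a * (- b / a * (- b / a)) + 2 * (- b / a) * b + c) with ((a * c - b * b) / a) in H by (field; lra).
    assert (0 <= (a * c - b * b) / a * a) by (apply Rmult_le_pos; lra).
    replace ((a * c - b * b) / a * a) with (a * c - b * b) in H0 by (field; lra). lra.
  - destruct (Req_dec b 0) as [-> | Hb]; [lra|].
    specialize (H ((- c - 1) / (2 * b))).
    replace (0 * ((- c - 1) / (2 * b) * ((- c - 1) / (2 * b))) + 2 * ((- c - 1) / (2 * b)) * b + c) with (- 1) in H by (field; lra).
    lra.
Qed.

Lemma is_lim_seq_0_of_sqr (u : nat -> R) K :
  (forall n, u n * u n <= K * / (INR n + 1)) -> is_lim_seq u 0.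
Proof.
  intros H. apply is_lim_seq_abs_0.
  apply is_lim_seq_le_le with (u := fun _ => 0) (w := fun n => sqrt (K * / (INR n + 1))).
  - intros n. split; [apply Rabs_pos|]. rewrite <- sqrt_Rsqr_abs. apply sqrt_le_1_alt, H.
  - apply is_lim_seq_const.
  - rewrite <- sqrt_0 at 1.
    apply (is_lim_seq_continuous sqrt (fun n => K * / (INR n + 1)) 0).
    + apply continuity_pt_filterlim. apply continuous_sqrt.
    + replace (Finite 0) with (Rbar_mult K 0) by (simpl; f_equal; ring).
      apply is_lim_seq_scal_l.
      replace (Finite 0) with (Rbar_inv p_infty) by reflexivity.
      apply is_lim_seq_inv; [|discriminate].
      apply (is_lim_seq_ext (fun n => INR (S n))); [intros n; apply S_INR|].
      apply -> is_lim_seq_incr_1. apply is_lim_seq_INR.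
Qed.

Lemma inv_INR_S_pos n : 0 < / (INR n + 1).
Proof. apply Rinv_0_lt_compat. assert (H := pos_INR n). lra. Qed.

Lemma inv_INR_S_le_1 n : / (INR n + 1) <= 1.
Proof. rewrite <- Rinv_1. apply Rinv_le_contravar; [lra|]. assert (T := pos_INR n). lra. Qed.

Lemma inv_INR_S_small eps : 0 < eps -> exists N, forall n, (N <= n)%nat -> / (INR n + 1) < eps.
Proof.
  intros He. exists (Z.to_nat (up (/ eps))). intros n Hn.
  assert (Hi : 0 < / eps) by (apply Rinv_0_lt_compat; auto).
  assert (Hu := archimed (/ eps)).
  assert (Hup : (0 <= up (/ eps))%Z) by (apply le_IZR; lra).
  assert (HN : / eps < INR n).
  { apply le_INR in Hn. rewrite INR_IZR_INZ, Z2Nat.id in Hn by auto. lra. }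
  rewrite <- (Rinv_inv eps). apply Rinv_lt_contravar; [|lra]. apply Rmult_lt_0_compat; lra.
Qed.

(* Riesz: pairing with the component of [e] orthogonal to [M], obtained from a minimizing sequence. *)
Lemma orthogonal_functional (V : Type) (add : V -> V -> V) (sc : R -> V -> V) (B : V -> V -> R)
  (F M : V -> Prop) (e : V) (d : R) :
  (forall x y, F x -> F y -> F (add x y)) -> (forall t x, F x -> F (sc t x)) ->
  (forall x, M x -> F x) -> (forall x y, M x -> M y -> M (add x y)) -> (forall t x, M x -> M (sc t x)) ->
  F e -> (exists m, M m) ->
  (forall x y z, F x -> F y -> F z -> B (add x y) z = B x z + B y z) ->
  (forall t x z, F x -> F z -> B (sc t x) z = t * B x z) ->
  (forall x y, F x -> F y -> B x y = B y x) -> (forall x, F x -> 0 <= B x x) ->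
  0 < d -> (forall m, M m -> d <= B (add e m) (add e m)) ->
  exists rho : V -> R,
    (forall x y, F x -> F y -> rho (add x y) = rho x + rho y) /\
    (forall t x, F x -> rho (sc t x) = t * rho x) /\
    (forall m, M m -> rho m = 0) /\ 0 < rho e /\
    exists K, 0 <= K /\ forall x, F x -> rho x * rho x <= K * B x x.
Proof.
  intros Fadd Fsc MF Madd Msc Fe [m0 Mm0] Badd Bsc Bsym Bpos Hd Hdist.
  assert (CS : forall x y, F x -> F y -> B x y * B x y <= B x x * B y y).
  { intros x y Fx Fy. apply quadratic_discriminant; [auto|]. intros t.
    assert (Ft := Fsc t x Fx). assert (Fs := Fadd _ _ Ft Fy).
    assert (P := Bpos _ Fs). rewrite Badd, (Bsc t x) in P by auto.
    rewrite (Bsym x (add _ _)), (Bsym y (add _ _)), !Badd, !Bsc, (Bsym y x) in P by auto. lra. }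
  (* Signs are reversed because completeness is about suprema; [D] below is the infimum of the
     squared distances. *)
  set (E := fun v => exists m, M m /\ v = - B (add e m) (add e m)).
  destruct (completeness E) as [D0 [HD1 HD2]].
  { exists 0. intros v (m & Mm & ->). specialize (Hdist m Mm). lra. }
  { exists (- B (add e m0) (add e m0)), m0. auto. }
  set (D := - D0).
  assert (HDle : forall m, M m -> D <= B (add e m) (add e m)).
  { intros m Mm. assert (T := HD1 _ (ex_intro _ m (conj Mm eq_refl))). unfold D. lra. }
  assert (HdD : d <= D).
  { unfold D. assert (D0 <= - d); [|lra]. apply HD2. intros v (m & Mm & ->). specialize (Hdist m Mm). lra. }
  assert (Hmin : forall k : nat, exists m, M m /\ B (add e m) (add e m) <= D + / (INR k + 1)).
  { intros k. apply NNPP. intros HN. assert (Pk := inv_INR_S_pos k).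
    assert (D0 <= - (D + / (INR k + 1))); [|unfold D in *; lra].
    apply HD2. intros v (m & Mm & ->). apply Ropp_le_contravar. apply Rnot_lt_le. intros HL. apply HN.
    exists m. split; auto. lra. }
  set (mk := fun k => proj1_sig (constructive_indefinite_description _ (Hmin k))).
  assert (Hmk : forall k, M (mk k) /\ B (add e (mk k)) (add e (mk k)) <= D + / (INR k + 1)).
  { intros k. exact (proj2_sig (constructive_indefinite_description _ (Hmin k))). }
  set (ek := fun k => add e (mk k)).
  assert (Fmk : forall k, F (mk k)) by (intros k; apply MF, Hmk).
  assert (Fek : forall k, F (ek k)) by (intros k; apply Fadd; auto).
  assert (Orth : forall m k, M m -> B m (ek k) * B m (ek k) <= B m m * / (INR k + 1)).
  (* Near-minimality is near-orthogonality: moving e + m_k by t m stays at or above D, after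
     starting at most 1/(k+1) above it, so a quadratic polynomial in t is nonnegative. *)
  { intros m k Mm. apply quadratic_discriminant; [apply Bpos, MF, Mm|]. intros t.
    assert (Fm := MF m Mm). assert (Fsm := Fsc t m Fm).
    assert (P := HDle (add (mk k) (sc t m)) (Madd _ _ (proj1 (Hmk k)) (Msc t m Mm))).
    assert (Q := proj2 (Hmk k)). fold (ek k) in Q.
    assert (Fms : F (add (mk k) (sc t m))) by auto.
    assert (Ex : forall z, F z -> B (add e (add (mk k) (sc t m))) z = B (ek k) z + t * B m z).
    { intros z Fz. unfold ek. rewrite !Badd, Bsc by auto. ring. }
    assert (Fx : F (add e (add (mk k) (sc t m)))) by auto.
    rewrite Ex in P by auto.
    rewrite (Bsym (ek k) (add _ _)), (Bsym m (add _ _)), !Ex, (Bsym (ek k) m) in P by auto.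
    lra. }
  (* The difference n of two near-minimizers lies in M, so both pairings in B n n = B n (ek k) - B n
     (ek l) are controlled by near-orthogonality. *)
  assert (Cau : forall k l, let n := add (mk k) (sc (-1) (mk l)) in
      B n n <= 2 * (/ (INR k + 1) + / (INR l + 1))).
  { intros k l n. assert (Mn : M n) by (apply Madd; [apply Hmk | apply Msc, Hmk]).
    assert (Fn := MF n Mn). assert (Pk := inv_INR_S_pos k). assert (Pl := inv_INR_S_pos l).
    assert (En : B n n = B n (ek k) - B n (ek l)).
    { unfold ek. rewrite (Bsym n (add e (mk k))), (Bsym n (add e (mk l))), !Badd by auto.
      unfold n at 1. rewrite Badd, Bsc by auto. ring. }
    assert (O1 := Orth n k Mn). assert (O2 := Orth n l Mn).
    set (a := B n n) in *. set (u := B n (ek k)) in *. set (v := B n (ek l)) in *.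
    assert (Ha : 0 <= a) by (apply Bpos; auto).
    destruct Ha as [Ha | <-]; [|lra].
    apply Rmult_le_reg_l with a; auto.
    assert (a * a <= 2 * (u * u) + 2 * (v * v)).
    { rewrite En. assert (0 <= (u + v) * (u + v)) by apply Rle_0_sqr. lra. }
    lra. }
  assert (Diff : forall x k l, F x -> (B x (ek k) - B x (ek l)) * (B x (ek k) - B x (ek l))
     <= B x x * (2 * (/ (INR k + 1) + / (INR l + 1)))).
  { intros x k l Fx. set (n := add (mk k) (sc (-1) (mk l))).
    assert (Fn : F n) by (apply Fadd; auto).
    assert (En : B x (ek k) - B x (ek l) = B x n).
    { unfold ek, n. rewrite !(Bsym x) by auto. rewrite !Badd, Bsc by auto. ring. }
    rewrite En. eapply Rle_trans; [apply CS; auto|].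
    apply Rmult_le_compat_l; [auto | apply Cau]. }
  (* V is not complete, so the minimizing sequence may have no limit in V; its pairings with a fixed
     x still converge. *)
  set (rho := fun x => real (Lim_seq (fun k => B x (ek k)))).
  assert (Hrho : forall x, F x -> is_lim_seq (fun k => B x (ek k)) (rho x)).
  { intros x Fx. apply Lim_seq_correct'. apply ex_lim_seq_cauchy_corr.
    intros eps. assert (He := cond_pos eps). assert (Bx := Bpos x Fx).
    destruct (inv_INR_S_small (eps * eps / (4 * (B x x + 1)))) as [N HN].
    { apply Rdiv_lt_0_compat; [apply Rmult_lt_0_compat; auto | lra]. }
    exists N. intros n m Hn Hm.
    assert (T := Diff x n m Fx). assert (T1 := HN n Hn). assert (T2 := HN m Hm).
    set (u := B x (ek n) - B x (ek m)) in *.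
    assert (Hu : u * u < eps * eps).
    { eapply Rle_lt_trans; [exact T|].
      apply Rle_lt_trans with (B x x * (4 * (eps * eps / (4 * (B x x + 1))))).
      - apply Rmult_le_compat_l; lra.
      - replace (B x x * (4 * (eps * eps / (4 * (B x x + 1))))) with (eps * eps * (B x x / (B x x + 1))) by (field; lra).
        rewrite <- (Rmult_1_r (eps * eps)) at 2. apply Rmult_lt_compat_l; [apply Rmult_lt_0_compat; auto|].
        apply Rmult_lt_reg_r with (B x x + 1); [lra|].
        replace (B x x / (B x x + 1) * (B x x + 1)) with (B x x) by (field; lra). lra. }
    rewrite <- (Rabs_pos_eq eps) by lra. apply Rsqr_lt_abs_0. exact Hu. }
  assert (Uniq : forall u (a b : R), is_lim_seq u a -> is_lim_seq u b -> a = b).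
  { intros u a b H1 H2. apply is_lim_seq_unique in H1. apply is_lim_seq_unique in H2. congruence. }
  exists rho. repeat split.
  - intros x y Fx Fy. apply (Uniq (fun k => B (add x y) (ek k))); [apply Hrho; auto|].
    apply (is_lim_seq_ext (fun k => B x (ek k) + B y (ek k))).
    + intros k. rewrite Badd; auto.
    + apply is_lim_seq_plus'; apply Hrho; auto.
  - intros t x Fx. apply (Uniq (fun k => B (sc t x) (ek k))); [apply Hrho; auto|].
    apply (is_lim_seq_ext (fun k => t * B x (ek k))).
    + intros k. rewrite Bsc; auto.
    + apply (is_lim_seq_scal_l _ t (rho x)). apply Hrho; auto.
  - intros m Mm. apply (Uniq (fun k => B m (ek k))); [apply Hrho; auto|].
    apply is_lim_seq_0_of_sqr with (B m m). intros n. apply Orth, Mm.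
  - apply Rlt_le_trans with D; [lra|].
    (* Then rho e is also the limit of B (ek k) (ek k), which is at least D > 0. Near-orthogonality
       applies to the varying m_k once B (mk k) (mk k) is bounded. *)
    assert (Z : is_lim_seq (fun k => B (mk k) (ek k)) 0).
    { apply is_lim_seq_0_of_sqr with (2 * (D + 1 + B e e)). intros k.
      eapply Rle_trans; [apply Orth, Hmk|]. apply Rmult_le_compat_r; [left; apply inv_INR_S_pos|].
      assert (Q := proj2 (Hmk k)). fold (ek k) in Q.
      assert (Hk1 := inv_INR_S_le_1 k).
      (* Subtracting B(m+2e, m+2e) >= 0 from 2 B(e+m, e+m) leaves the bound B(m, m) <= 2 B(e+m, e+m)
         + 2 B(e, e). *)
      assert (P := Bpos (add (mk k) (sc 2 e)) ltac:(auto)).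
      assert (Qe : B (ek k) (ek k) = B (mk k) (mk k) + 2 * B (mk k) e + B e e).
      { unfold ek. rewrite Badd by (auto; apply (Fek k)).
        rewrite (Bsym e (add _ _)), (Bsym (mk k) (add _ _)), !Badd, (Bsym e (mk k)) by (auto; apply (Fek k)). ring. }
      rewrite Badd, (Bsym (mk k) (add _ _)), (Bsym (sc 2 e) (add _ _)), !Badd, !Bsc in P by auto.
      rewrite (Bsym (mk k) (sc 2 e)), !Bsc, (Bsym e (sc 2 e)), Bsc, (Bsym e (mk k)) in P by auto.
      lra. }
    assert (L : is_lim_seq (fun k => B e (ek k) + B (mk k) (ek k)) (rho e + 0)).
    { apply is_lim_seq_plus'; [apply Hrho, Fe | exact Z]. }
    rewrite Rplus_0_r in L.
    apply (is_lim_seq_le (fun _ => D) (fun k => B e (ek k) + B (mk k) (ek k)) D (rho e)).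
    + intros k. rewrite <- Badd by auto. apply HDle, Hmk.
    + apply is_lim_seq_const.
    + exact L.
  - exists (D + 1). split; [lra|]. intros x Fx.
    apply (is_lim_seq_le (fun k => B x (ek k) * B x (ek k)) (fun _ => (D + 1) * B x x)
             (rho x * rho x) ((D + 1) * B x x)).
    + intros k. eapply Rle_trans; [apply CS; auto|]. rewrite Rmult_comm.
      apply Rmult_le_compat_r; [auto|].
      assert (Q := proj2 (Hmk k)). fold (ek k) in Q.
      assert (Hk1 := inv_INR_S_le_1 k).
      lra.
    + apply is_lim_seq_mult'; apply Hrho, Fx.
    + apply is_lim_seq_const.
Qed.

(** * Truncation to the disk and the weighted l^2 norm of Taylor coefficients *)

Definition restr (h : C -> C) : C -> C := fun z => if Rlt_dec (Cmod z) 1 then h z else RtoC 0.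

Lemma restr_in h z : disk z -> restr h z = h z.
Proof. intros H. unfold restr. destruct (Rlt_dec (Cmod z) 1) as [_ | N]; [reflexivity | contradiction]. Qed.

Lemma restr_out h z : ~ disk z -> restr h z = RtoC 0.
Proof. intros H. unfold restr. destruct (Rlt_dec (Cmod z) 1) as [N | _]; [contradiction | reflexivity]. Qed.

Lemma Fp_restr p h : 0 < p -> (forall z, disk z -> exists l, cderiv h z l) -> growth p h -> Fp p (restr h).
Proof.
  intros Hp Hd Hg. apply growth_Fp; auto.
  - intros z. apply restr_out.
  - intros z Hz. apply ex_derive_cderiv. destruct (Hd z Hz) as [l Hl].
    destruct (disk_open z Hz) as (r & Hr & Hr1).
    exists l. apply (cderiv_local h) with (r := r); auto.
    intros y Hy. symmetry. apply restr_in, Hr1, Hy.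
  - intros eps He. destruct (Hg eps He) as (K & HK & H). exists K. split; auto.
    intros z Hz. rewrite restr_in; auto.
Qed.

(** Elements of F^p vanish off the disk, so the unit of the algebra is the truncated constant.
    Constants, z - a and 1/(z - a) enter the algebra in the same way. *)
Definition fone : C -> C := restr (fun _ => RtoC 1).

Lemma Fp_const p c : 0 < p -> Fp p (restr (fun _ => c)).
Proof.
  intros Hp. apply Fp_restr; auto.
  - intros z _. exists (RtoC 0). apply cderiv_const.
  - apply growth_bounded with (Cmod c); [apply Cmod_ge_0 | intros; lra].
Qed.

Lemma Fp_one p : 0 < p -> Fp p fone.
Proof. apply Fp_const. Qed.

Lemma eq_on_disk (f g : C -> C) : on_disk f -> on_disk g -> (forall z, disk z -> f z = g z) -> f = g.
Proof.
  intros Hf Hg H. apply functional_extensionality. intros z.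
  destruct (classic (disk z)) as [Hz | Hz]; [auto|]. rewrite Hf, Hg; auto.
Qed.

Lemma ideal_scal p M c f : 0 < p -> Fp_ideal p M -> M f -> M (fun z => c * f z)%C.
Proof.
  intros Hp (HF & _ & _ & HM) Hf.
  replace (fun z => c * f z)%C with (fmul (restr (fun _ => c)) f).
  - apply HM; auto. apply Fp_const; auto.
  - apply functional_extensionality. intros z. unfold fmul.
    destruct (classic (disk z)) as [Hz | Hz].
    + rewrite restr_in; auto.
    + rewrite (proj1 (HF f Hf) z Hz). ring.
Qed.

Lemma coeffs_add f g n : holomorphic_on_disk f -> holomorphic_on_disk g ->
  coeffs (fadd f g) n = (coeffs f n + coeffs g n)%C.
Proof.
  intros Hf Hg. assert (Hs : -1 < 0) by lra.
  rewrite !(coeffs_tcoef _ (-1)), tcoef_plus; auto.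
  intros z Hz. apply ex_derive_cderiv.
  destruct (proj1 (ex_derive_cderiv _ _) (Hf z Hz)) as [k Hk].
  destruct (proj1 (ex_derive_cderiv _ _) (Hg z Hz)) as [l Hl].
  eexists. apply cderiv_plus; eauto.
Qed.

Lemma coeffs_scal c f n : holomorphic_on_disk f ->
  coeffs (fun z => c * f z)%C n = (c * coeffs f n)%C.
Proof.
  intros Hf. assert (Hs : -1 < 0) by lra.
  rewrite !(coeffs_tcoef _ (-1)), tcoef_scal; auto.
  intros z Hz. apply ex_derive_cderiv.
  destruct (proj1 (ex_derive_cderiv _ _) (Hf z Hz)) as [k Hk].
  eexists. apply cderiv_mult; [apply cderiv_const | eauto].
Qed.

Lemma Fp_coeffs_bound p c f : 0 < p -> 0 < c -> Fp p f ->
  exists K, 0 <= K /\ forall n, Cmod (coeffs f n) <= K * exp (c * nat_rpow n (1 / (p + 1))).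
Proof.
  intros Hp Hc Hf. destruct (coeffs_growth p c Hp Hc) as (eps & K & He & HK & H).
  destruct (Fp_growth p f Hf eps He) as (A & HA & HAz).
  exists (K * A). split; [apply Rmult_le_pos; lra|]. apply H; auto. apply Hf.
Qed.

(** The weighted real part of a_n times the conjugate of b_n. Orthogonal projection is carried out
    over R; the complex structure is restored in [ideal_functional]. *)
Definition ipterm (p c : R) (f g : C -> C) (n : nat) : R :=
  (Re (coeffs f n) * Re (coeffs g n) + Im (coeffs f n) * Im (coeffs g n))
  * exp (- c * nat_rpow n (1 / (p + 1))).

Definition ip (p c : R) (f g : C -> C) : R := Series (ipterm p c f g).

Lemma inv_p1_pos p : 0 < p -> 0 < 1 / (p + 1).
Proof. intros H. apply Rdiv_lt_0_compat; lra. Qed.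

Lemma ipterm_bound p c f g A B n : 0 <= A -> 0 <= B ->
  Cmod (coeffs f n) <= A * exp (c / 4 * nat_rpow n (1 / (p + 1))) ->
  Cmod (coeffs g n) <= B * exp (c / 4 * nat_rpow n (1 / (p + 1))) ->
  Rabs (ipterm p c f g n) <= 2 * A * B * exp (- (c / 2) * nat_rpow n (1 / (p + 1))).
Proof.
  intros HA HB Hf Hg. unfold ipterm. set (N := nat_rpow n (1 / (p + 1))) in *.
  rewrite Rabs_mult, (Rabs_pos_eq (exp _)) by (left; apply exp_pos).
  assert (P : Cmod (coeffs f n) * Cmod (coeffs g n) <= A * exp (c / 4 * N) * (B * exp (c / 4 * N)))
    by (apply Rmult_le_compat; auto using Cmod_ge_0).
  assert (Q : Rabs (Re (coeffs f n) * Re (coeffs g n) + Im (coeffs f n) * Im (coeffs g n))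
      <= 2 * (Cmod (coeffs f n) * Cmod (coeffs g n))).
  { eapply Rle_trans; [apply Rabs_triang|]. rewrite !Rabs_mult.
    assert (Rabs (Re (coeffs f n)) * Rabs (Re (coeffs g n)) <= Cmod (coeffs f n) * Cmod (coeffs g n))
      by (apply Rmult_le_compat; auto using Rabs_pos, re_le_Cmod).
    assert (Rabs (Im (coeffs f n)) * Rabs (Im (coeffs g n)) <= Cmod (coeffs f n) * Cmod (coeffs g n))
      by (apply Rmult_le_compat; auto using Rabs_pos, im_le_Cmod). lra. }
  apply Rle_trans with (2 * (A * exp (c / 4 * N) * (B * exp (c / 4 * N))) * exp (- c * N)).
  - apply Rmult_le_compat_r; [left; apply exp_pos | lra].
  - right. replace (- (c / 2) * N) with (c / 4 * N + c / 4 * N + - c * N) by field.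
    rewrite !exp_plus. ring.
Qed.

Lemma ex_series_ip p c f g : 0 < p -> 0 < c -> Fp p f -> Fp p g -> ex_series (ipterm p c f g).
Proof.
  intros Hp Hc Hf Hg.
  destruct (Fp_coeffs_bound p (c / 4) f Hp ltac:(lra) Hf) as (A & HA & HAn).
  destruct (Fp_coeffs_bound p (c / 4) g Hp ltac:(lra) Hg) as (B & HB & HBn).
  apply (@ex_series_le R_AbsRing R_CompleteNormedModule)
    with (b := fun n => 2 * A * B * exp (- (c / 2) * nat_rpow n (1 / (p + 1)))).
  - intros n. apply ipterm_bound; auto.
  - apply (@ex_series_scal R_AbsRing R_NormedModule). apply ex_series_exp_rpow; [lra | apply inv_p1_pos, Hp].
Qed.

Lemma ipterm_self p c f n :
  ipterm p c f f n = Cmod (coeffs f n) ^ 2 * exp (- c * nat_rpow n (1 / (p + 1))).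
Proof. unfold ipterm. rewrite Cmod2_alt. ring. Qed.

Lemma ipterm_self_pos p c f n : 0 <= ipterm p c f f n.
Proof.
  rewrite ipterm_self. apply Rmult_le_pos; [apply pow2_ge_0 | left; apply exp_pos].
Qed.

Lemma sum_n_le_Series (u : nat -> R) N : (forall n, 0 <= u n) -> ex_series u -> sum_n u N <= Series u.
Proof.
  intros Hu He. apply (is_lim_seq_incr_compare (sum_n u)).
  - exact (Series_correct u He).
  - intros n. rewrite sum_Sn. specialize (Hu (S n)). unfold plus; simpl. lra.
Qed.

Lemma term_le_Series (u : nat -> R) n : (forall n, 0 <= u n) -> ex_series u -> u n <= Series u.
Proof.
  intros Hu He. eapply Rle_trans; [|apply (sum_n_le_Series u n); auto].
  destruct n as [|n]; [rewrite sum_O; lra|]. rewrite sum_Sn.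
  assert (P : 0 <= sum_n u n).
  { clear - Hu. induction n as [|n IH]; [rewrite sum_O; auto|]. rewrite sum_Sn.
    specialize (Hu (S n)). unfold plus; simpl. lra. }
  unfold plus; simpl. lra.
Qed.

Lemma Series_nonneg (u : nat -> R) : (forall n, 0 <= u n) -> ex_series u -> 0 <= Series u.
Proof. intros Hu He. eapply Rle_trans; [apply (Hu 0%nat) | apply (term_le_Series u 0); auto]. Qed.

(** Half of the weight bounds each |a_n| exp(-(c/2) n^(1/(p+1))) by the l^2 norm, and the other half
    is summable. One small c thus serves all the finitely many seminorms of a neighbourhood. *)
Lemma seminorm_le_ip p c c' f : 0 < p -> 0 < c -> c <= c' -> Fp p f ->
  Rbar_le (seminorm p c' f)
    (sqrt (ip p c f f) * Series (fun n => exp (- (c / 2) * nat_rpow n (1 / (p + 1))))).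
Proof.
  intros Hp Hc Hc' Hf. set (q := 1 / (p + 1)).
  assert (He := ex_series_ip p c f f Hp Hc Hf Hf).
  assert (Hw : ex_series (fun n => exp (- (c / 2) * nat_rpow n q)))
    by (apply ex_series_exp_rpow; [lra | apply inv_p1_pos, Hp]).
  assert (HB : 0 <= ip p c f f) by (apply Series_nonneg; auto; apply ipterm_self_pos).
  assert (Hn : forall n, Cmod (coeffs f n) * exp (- c' * nat_rpow n q)
       <= sqrt (ip p c f f) * exp (- (c / 2) * nat_rpow n q)).
  { intros n. assert (T := term_le_Series _ n (ipterm_self_pos p c f) He).
    fold (ip p c f f) in T. rewrite ipterm_self in T. fold q in T.
    assert (HN := nat_rpow_pos n q). set (N := nat_rpow n q) in *.
    assert (E : Cmod (coeffs f n) * exp (- (c / 2) * N) <= sqrt (ip p c f f)).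
    { rewrite <- (sqrt_square (Cmod (coeffs f n) * exp (- (c / 2) * N))).
      - apply sqrt_le_1_alt. eapply Rle_trans; [|exact T]. right.
        replace (- c * N) with (- (c / 2) * N + - (c / 2) * N) by field. rewrite exp_plus. ring.
      - apply Rmult_le_pos; [apply Cmod_ge_0 | left; apply exp_pos]. }
    apply Rle_trans with (Cmod (coeffs f n) * exp (- (c / 2) * N) * exp (- (c / 2) * N)).
    - rewrite Rmult_assoc, <- exp_plus. apply Rmult_le_compat_l; [apply Cmod_ge_0|]. apply exp_le.
      assert (c * N <= c' * N) by (apply Rmult_le_compat_r; auto). lra.
    - apply Rmult_le_compat_r; [left; apply exp_pos | exact E]. }
  unfold seminorm. fold q.
  rewrite <- (Lim_seq_const (sqrt (ip p c f f) * Series (fun n => exp (- (c / 2) * nat_rpow n q)))).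
  apply Lim_seq_le_loc. exists 0%nat. intros N _.
  apply Rle_trans with (sum_n (fun n => scal (sqrt (ip p c f f)) (exp (- (c / 2) * nat_rpow n q))) N).
  - apply sum_n_m_le. exact Hn.
  - rewrite (sum_n_scal_l (K := R_AbsRing) (V := R_NormedModule)). apply Rmult_le_compat_l; [apply sqrt_pos|].
    apply sum_n_le_Series; auto. intros n. left. apply exp_pos.
Qed.

Lemma list_pos_lower (l : list R) : (forall c, In c l -> 0 < c) ->
  exists m, 0 < m /\ forall c, In c l -> m <= c.
Proof.
  induction l as [|x l IH]; intros H.
  - exists 1. split; [lra|]. intros c [].
  - destruct IH as (m & Hm & Hml); [intros c Hc; apply H; right; auto|].
    exists (Rmin x m). split; [apply Rmin_pos; auto; apply H; left; auto|].
    intros c [<- | Hc]; [apply Rmin_l | eapply Rle_trans; [apply Rmin_r | auto]].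
Qed.

(** Continuity is recorded as a bound on all functions dominated by one fixed growth weight, because
    resolvents and products are estimated pointwise. *)
Definition annihilator (p : R) (M : (C -> C) -> Prop) (phi : (C -> C) -> C) : Prop :=
    (forall f g, Fp p f -> Fp p g -> phi (fadd f g) = (phi f + phi g)%C) /\
    (forall c f, Fp p f -> phi (fun z => c * f z)%C = (c * phi f)%C) /\
    (forall m, M m -> phi m = RtoC 0) /\ phi fone <> RtoC 0 /\
    exists eps K, 0 < eps /\ 0 <= K /\ forall A f, Fp p f -> 0 <= A ->
      (forall z, disk z -> Cmod (f z) <= A * exp (eps * gr p (Cmod z))) -> Cmod (phi f) <= K * A.

(** Closedness gives a neighbourhood of [fone] disjoint from M. It contains a ball of the weighted
    l^2 norm, so [fone] has positive distance from M in that norm and the projection argument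
    applies. *)
Lemma ideal_functional p M : 0 < p -> Fp_ideal p M -> Fp_closed p M -> ~ M fone ->
  exists phi, annihilator p M phi.
Proof.
  intros Hp HI [HMF [_ Hop]] H1. assert (F1 := Fp_one p Hp).
  destruct (Hop fone (conj F1 H1)) as (cs & e & Hcs & He & Hball).
  destruct (list_pos_lower cs Hcs) as (c & Hc & Hcl).
  set (q := 1 / (p + 1)).
  assert (Hw : ex_series (fun n => exp (- (c / 2) * nat_rpow n q)))
    by (apply ex_series_exp_rpow; [lra | apply inv_p1_pos, Hp]).
  set (S := Series (fun n => exp (- (c / 2) * nat_rpow n q))).
  assert (HS : 0 <= S) by (apply Series_nonneg; auto; intros n; left; apply exp_pos).
  set (d0 := e / (2 * (S + 1))). assert (Hd0 : 0 < d0) by (apply Rdiv_lt_0_compat; lra).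
  assert (Hip0 : forall f, Fp p f -> 0 <= ip p c f f).
  { intros f Hf. apply Series_nonneg; [apply ipterm_self_pos | apply ex_series_ip; auto]. }
  assert (HIs := fun t f Hf => ideal_scal p M t f Hp HI Hf).
  destruct (orthogonal_functional (C -> C) fadd (fun t f z => RtoC t * f z)%C (ip p c) (Fp p) M fone (d0 * d0))
    as (rho & Radd & Rsc & RM & R1 & K & HK & HKb).
  - intros; apply Fp_add; auto.
  - intros; apply Fp_scal; auto.
  - apply HMF.
  - apply HI.
  - intros; apply HIs; auto.
  - exact F1.
  - exists fzero. apply HI.
  - intros f g h Hf Hg Hh. unfold ip. rewrite <- Series_plus by (apply ex_series_ip; auto).
    apply Series_ext. intros n. unfold ipterm. rewrite coeffs_add by (apply Hf || apply Hg).
    unfold Re, Im; simpl. ring.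
  - intros t f h Hf Hh. unfold ip. rewrite <- Series_scal_l.
    apply Series_ext. intros n. unfold ipterm. rewrite coeffs_scal by apply Hf.
    unfold Re, Im; simpl. ring.
  - intros f g Hf Hg. apply Series_ext. intros n. unfold ipterm. ring.
  - exact Hip0.
  - apply Rmult_lt_0_compat; auto.
  - intros m Hm. apply Rnot_lt_le. intros Hlt.
    assert (Fm := HMF m Hm). assert (F1m := Fp_add p _ _ Hp F1 Fm).
    (* Distances in [orthogonal_functional] have the form e + m, so the element of M close to [fone]
       is -m. *)
    set (g := fun z => (- RtoC 1 * m z)%C).
    assert (Mg : M g) by (apply HIs; auto).
    assert (Hsm : forall c', In c' cs -> Rbar_lt (seminorm p c' (fsub g fone)) e).
    { intros c' Hc'.
      replace (fsub g fone) with (fun z => - RtoC 1 * fadd fone m z)%C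
        by (apply functional_extensionality; intros z; unfold fsub, fadd, g; ring).
      assert (Fn := Fp_scal p (- RtoC 1) _ Hp F1m).
      eapply Rbar_le_lt_trans; [apply (seminorm_le_ip p c c'); auto|].
      fold q. fold S. simpl.
      assert (Ei : ip p c (fun z => - RtoC 1 * fadd fone m z)%C (fun z => - RtoC 1 * fadd fone m z)%C
                   = ip p c (fadd fone m) (fadd fone m)).
      { apply Series_ext. intros n. unfold ipterm. rewrite coeffs_scal by apply F1m.
        unfold Re, Im; simpl. ring. }
      rewrite Ei. apply Rle_lt_trans with (d0 * (S + 1)).
      - apply Rmult_le_compat; [apply sqrt_pos | auto | | lra].
        rewrite <- (sqrt_square d0) by lra. apply sqrt_le_1_alt. lra.
      - unfold d0. replace (e / (2 * (S + 1)) * (S + 1)) with (e / 2) by (field; lra). lra. }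
    exact (proj2 (Hball g (HMF g Mg) Hsm) Mg).
  (* The usual complexification rho(f) - i rho(i f). It vanishes on M because M is stable under
     [Ci], and its real part at [fone] is positive. *)
  - exists (fun f => (rho f, - rho (fun z => Ci * f z)%C)).
    assert (FCi : forall f, Fp p f -> Fp p (fun z => Ci * f z)%C) by (intros; apply Fp_scal; auto).
    repeat split.
    + intros f g Hf Hg. unfold Cplus; simpl. f_equal; [apply Radd; auto|].
      replace (fun z => Ci * fadd f g z)%C with (fadd (fun z => Ci * f z)%C (fun z => Ci * g z)%C)
        by (apply functional_extensionality; intros z; unfold fadd; ring).
      rewrite Radd by auto. ring.
    + intros [x y] f Hf.
      assert (G : forall u v : R, rho (fun z => (u, v) * f z)%C = u * rho f + v * rho (fun z => Ci * f z)%C).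
      { intros u v. rewrite <- Rsc, <- (Rsc v), <- Radd by (auto; apply Fp_scal; auto).
        f_equal. apply functional_extensionality. intros z. unfold fadd.
        destruct (f z) as [a b]. unfold Cmult, Cplus, Ci, RtoC; simpl. f_equal; ring. }
      assert (E : (fun z => Ci * ((x, y) * f z))%C = (fun z => (- y, x)%R * f z)%C).
      { apply functional_extensionality. intros z.
        destruct (f z) as [a b]. unfold Cmult, Cplus, Ci, RtoC; simpl. f_equal; ring. }
      rewrite E, !G. unfold Cmult; simpl. f_equal; ring.
    + intros m Hm. rewrite (RM m Hm), (RM _ (HIs Ci m Hm)). unfold RtoC. f_equal. ring.
    + intros E. apply (f_equal fst) in E. simpl in E. lra.
    (* Two coefficients growing like exp((c/4) n^(1/(p+1))) against the weight exp(-c n^(1/(p+1)))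
       leave the summable exp(-(c/2) n^(1/(p+1))). *)
    + destruct (coeffs_growth p (c / 4) Hp ltac:(lra)) as (eps & K1 & Heps & HK1 & Hcg).
      set (K2 := sqrt (K * (2 * (K1 * K1) * S))).
      exists eps, (2 * K2). split; auto. split; [apply Rmult_le_pos; [lra | apply sqrt_pos]|].
      assert (Main : forall A f, Fp p f -> 0 <= A ->
         (forall z, disk z -> Cmod (f z) <= A * exp (eps * gr p (Cmod z))) -> Rabs (rho f) <= K2 * A).
      { intros A f Hf HA HfA.
        assert (Hn := Hcg A f (proj1 (proj2 Hf)) HA HfA).
        assert (HKA : 0 <= K1 * A) by (apply Rmult_le_pos; lra).
        assert (Bd : ip p c f f <= 2 * (K1 * A) * (K1 * A) * S).
        { unfold ip, S. rewrite <- Series_scal_l. apply Series_le.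
          - intros n. split; [apply ipterm_self_pos|].
            eapply Rle_trans; [apply Rle_abs|]. apply ipterm_bound; auto.
          - apply (@ex_series_scal R_AbsRing R_NormedModule). exact Hw. }
        assert (Q := HKb f Hf).
        assert (Q2 : rho f * rho f <= K * (2 * (K1 * K1) * S) * (A * A)).
        { eapply Rle_trans; [exact Q|].
          apply Rle_trans with (K * (2 * (K1 * A) * (K1 * A) * S)); [apply Rmult_le_compat_l; auto | right; ring]. }
        rewrite <- sqrt_Rsqr_abs. unfold K2. rewrite <- (sqrt_square A) by auto.
        rewrite <- sqrt_mult_alt.
        - apply sqrt_le_1_alt. exact Q2.
        - apply Rmult_le_pos; auto. apply Rmult_le_pos; auto.
          assert (0 <= K1 * K1) by apply Rle_0_sqr. lra. }
      intros A f Hf HA HfA. eapply Rle_trans; [apply Cmod_pair_le|]. rewrite Rabs_Ropp.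
      assert (M1 := Main A f Hf HA HfA).
      assert (M2 := Main A (fun z => Ci * f z)%C (FCi f Hf) HA
         ltac:(intros z Hz; cbv beta; rewrite Cmod_mult, Cmod_Ci, Rmult_1_l; auto)). lra.
Qed.

(** * Infinite products *)

Definition clim (u : nat -> C) (l : C) : Prop :=
  forall eps, 0 < eps -> exists N, forall n, (N <= n)%nat -> Cmod (u n - l) < eps.

Lemma clim_cauchy (u : nat -> C) :
  (forall eps, 0 < eps -> exists N, forall n m, (N <= n)%nat -> (N <= m)%nat -> Cmod (u n - u m) < eps) ->
  exists l, clim u l.
Proof.
  intros H.
  assert (H1 : ex_finite_lim_seq (fun n => Re (u n))).
  { apply ex_lim_seq_cauchy_corr. intros eps. destruct (H eps (cond_pos eps)) as [N HN].
    exists N. intros n m Hn Hm. eapply Rle_lt_trans; [|apply (HN n m Hn Hm)].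
    apply (re_le_Cmod (u n - u m)%C). }
  assert (H2 : ex_finite_lim_seq (fun n => Im (u n))).
  { apply ex_lim_seq_cauchy_corr. intros eps. destruct (H eps (cond_pos eps)) as [N HN].
    exists N. intros n m Hn Hm. eapply Rle_lt_trans; [|apply (HN n m Hn Hm)].
    apply (im_le_Cmod (u n - u m)%C). }
  destruct H1 as [a Ha], H2 as [b Hb]. exists (a, b). intros eps He.
  apply is_lim_seq_spec in Ha. apply is_lim_seq_spec in Hb.
  assert (He2 : 0 < eps / 2) by lra.
  destruct (Ha (mkposreal _ He2)) as [N1 HN1]. destruct (Hb (mkposreal _ He2)) as [N2 HN2].
  exists (max N1 N2). intros n Hn. specialize (HN1 n ltac:(lia)). specialize (HN2 n ltac:(lia)).
  change (Rabs (Re (u n) - a) < eps / 2) in HN1. change (Rabs (Im (u n) - b) < eps / 2) in HN2.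
  eapply Rle_lt_trans; [apply Cmod_le_re_im|].
  replace eps with (eps / 2 + eps / 2) by field. exact (Rplus_lt_compat _ _ _ _ HN1 HN2).
Qed.

Lemma clim_bound u l (x : C) B : clim u l -> (forall n, Cmod (u n - x) <= B) -> Cmod (l - x) <= B.
Proof.
  intros H HB. apply le_epsilon. intros eps He. destruct (H eps He) as [N HN].
  specialize (HN N (Nat.le_refl N)). specialize (HB N).
  assert (T := Cmod_minus_triangle l (u N) x). rewrite (Cmod_minus_sym l (u N)) in T. lra.
Qed.

Lemma clim_unique u a b : clim u a -> clim u b -> a = b.
Proof.
  intros Ha Hb. apply Ceq_minus, Cmod_eq_0, Rle_antisym; [|apply Cmod_ge_0].
  apply le_epsilon. intros eps He. destruct (Ha (eps / 2)) as [N1 HN1]; [lra|].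
  destruct (Hb (eps / 2)) as [N2 HN2]; [lra|].
  specialize (HN1 (max N1 N2) ltac:(lia)). specialize (HN2 (max N1 N2) ltac:(lia)).
  assert (T := Cmod_minus_triangle a (u (max N1 N2)) b). rewrite (Cmod_minus_sym a (u _)) in T. lra.
Qed.

Lemma clim_scal c u l : clim u l -> clim (fun n => c * u n)%C (c * l)%C.
Proof.
  intros H eps He. assert (Hc := Cmod_ge_0 c).
  destruct (H (eps / (1 + Cmod c))) as [N HN]; [apply Rdiv_lt_0_compat; lra|].
  exists N. intros n Hn. specialize (HN n Hn).
  replace (c * u n - c * l)%C with (c * (u n - l))%C by ring. rewrite Cmod_mult.
  apply Rle_lt_trans with ((1 + Cmod c) * Cmod (u n - l)).
  - apply Rmult_le_compat_r; [apply Cmod_ge_0 | lra].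
  - apply Rlt_le_trans with ((1 + Cmod c) * (eps / (1 + Cmod c))).
    + apply Rmult_lt_compat_l; lra.
    + right. field. lra.
Qed.

Lemma clim_eventually u v l n0 : (forall n, (n0 <= n)%nat -> u n = v n) -> clim u l -> clim v l.
Proof.
  intros E H eps He. destruct (H eps He) as [N HN]. exists (max n0 N). intros n Hn.
  rewrite <- E by lia. apply HN. lia.
Qed.

(* A uniform second-order estimate makes the derivatives [D n] a Cauchy sequence. *)
Lemma cderiv_limit (F : nat -> C -> C) (f : C -> C) (D : nat -> C) z r K : 0 < r -> 0 <= K ->
  (forall y, Cmod (y - z) <= r -> clim (fun n => F n y) (f y)) ->
  (forall n y, Cmod (y - z) <= r -> Cmod (F n y - F n z - (y - z) * D n) <= K * (Cmod (y - z) * Cmod (y - z))) ->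
  exists l, cderiv f z l.
Proof.
  intros Hr HK HF HT.
  assert (Z0 : Cmod (z - z) = 0) by (replace (z - z)%C with (RtoC 0) by ring; apply Cmod_0).
  destruct (clim_cauchy D) as [l Hl].
  (* The D n are compared through difference quotients with a fixed step h. Two quadratic errors
     cost at most h eps/2, and the four differences F - f together less than h eps/4 for large
     indices. *)
  { intros eps He. set (h := Rmin r (eps / (4 * (K + 1)))).
    assert (Hh : 0 < h) by (apply Rmin_pos; [auto | apply Rdiv_lt_0_compat; lra]).
    assert (Hh1 : h <= r) by apply Rmin_l.
    assert (Hh2 : h <= eps / (4 * (K + 1))) by apply Rmin_r.
    set (y := (z + RtoC h)%C).
    assert (Ey : (y - z)%C = RtoC h) by (unfold y; ring).
    assert (My : Cmod (y - z) = h) by (rewrite Ey, Cmod_R, Rabs_pos_eq; lra).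
    destruct (HF y ltac:(lra) (h * eps / 16)) as [N1 HN1].
    { apply Rdiv_lt_0_compat; [apply Rmult_lt_0_compat; auto | lra]. }
    destruct (HF z ltac:(lra) (h * eps / 16)) as [N2 HN2].
    { apply Rdiv_lt_0_compat; [apply Rmult_lt_0_compat; auto | lra]. }
    exists (max N1 N2). intros n m Hn Hm.
    assert (A1 := HN1 n ltac:(lia)). assert (A2 := HN1 m ltac:(lia)).
    assert (A3 := HN2 n ltac:(lia)). assert (A4 := HN2 m ltac:(lia)).
    assert (B1 := HT n y ltac:(lra)). assert (B2 := HT m y ltac:(lra)). rewrite My in B1, B2.
    apply Rmult_lt_reg_l with h; auto.
    replace (h * Cmod (D n - D m)) with (Cmod ((y - z) * (D n - D m))%C) by (rewrite Cmod_mult, My; ring).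
    replace ((y - z) * (D n - D m))%C with
      (((F m y - F m z - (y - z) * D m) - (F n y - F n z - (y - z) * D n))
       + (((F n y - f y) - (F m y - f y)) - ((F n z - f z) - (F m z - f z))))%C by ring.
    eapply Rle_lt_trans; [apply Cmod_triangle|].
    assert (T1 := Cmod_minus_le (F m y - F m z - (y - z) * D m) (F n y - F n z - (y - z) * D n)).
    assert (T2 := Cmod_minus_le ((F n y - f y) - (F m y - f y)) ((F n z - f z) - (F m z - f z))).
    assert (T3 := Cmod_minus_le (F n y - f y) (F m y - f y)).
    assert (T4 := Cmod_minus_le (F n z - f z) (F m z - f z)).
    assert (Q : K * (h * h) <= h * eps / 4).
    { replace (K * (h * h)) with (h * (K * h)) by ring.
      replace (h * eps / 4) with (h * ((K + 1) * (eps / (4 * (K + 1))))) by (field; lra).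
      apply Rmult_le_compat_l; [lra|]. apply Rmult_le_compat; lra. }
    assert (0 < h * eps) by (apply Rmult_lt_0_compat; auto). lra. }
  exists l.
  assert (Lim : forall y, Cmod (y - z) <= r -> Cmod (f y - f z - (y - z) * l) <= K * (Cmod (y - z) * Cmod (y - z))).
  { intros y Hy. apply le_epsilon. intros eps He.
    destruct (HF y Hy (eps / 4)) as [N1 HN1]; [lra|]. destruct (HF z ltac:(lra) (eps / 4)) as [N2 HN2]; [lra|].
    destruct (clim_scal (y - z) D l Hl (eps / 4)) as [N3 HN3]; [lra|].
    set (n := max N1 (max N2 N3)).
    assert (A1 := HN1 n ltac:(lia)). assert (A2 := HN2 n ltac:(lia)). assert (A3 := HN3 n ltac:(lia)). cbv beta in A3.
    assert (B1 := HT n y Hy).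
    replace (f y - f z - (y - z) * l)%C with
      ((F n y - F n z - (y - z) * D n) - ((F n y - f y) - (F n z - f z) - ((y - z) * D n - (y - z) * l)))%C by ring.
    eapply Rle_trans; [apply Cmod_minus_le|].
    assert (T1 := Cmod_minus_le (F n y - f y - (F n z - f z)) ((y - z) * D n - (y - z) * l)).
    assert (T2 := Cmod_minus_le (F n y - f y) (F n z - f z)). lra. }
  intros eps He. exists (Rmin r (eps / (K + 1))). split.
  { apply Rmin_pos; auto. apply Rdiv_lt_0_compat; lra. }
  intros y Hy. destruct (Rmin_Rgt_l _ _ _ Hy) as [Hy1 Hy2].
  eapply Rle_trans; [apply Lim; lra|]. rewrite <- Rmult_assoc. apply Rmult_le_compat_r; [apply Cmod_ge_0|].
  apply Rle_trans with ((K + 1) * (eps / (K + 1))).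
  - apply Rmult_le_compat; auto using Cmod_ge_0; lra.
  - right. field. lra.
Qed.

(** * Partial products, their derivatives and real majorants *)

Fixpoint pprod (d : nat -> C) (x : C) (N : nat) : C :=
  match N with O => RtoC 1 | S N => (pprod d x N * (1 + d N * x))%C end.

(** The derivative of [pprod d] with respect to x, unfolded by the product rule. *)
Fixpoint dprod (d : nat -> C) (x : C) (N : nat) : C :=
  match N with O => RtoC 0 | S N => (dprod d x N * (1 + d N * x) + pprod d x N * d N)%C end.

Fixpoint rprod (t : nat -> R) (X : R) (N : nat) : R :=
  match N with O => 1 | S N => rprod t X N * (1 + t N * X) end.

Fixpoint rsum (t : nat -> R) (N : nat) : R :=
  match N with O => 0 | S N => rsum t N + t N end.

Lemma rprod_ge_1 t X N : (forall m, 0 <= t m) -> 0 <= X -> 1 <= rprod t X N.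
Proof.
  intros Ht HX. induction N as [|N IH]; simpl; [lra|].
  assert (0 <= t N * X) by (apply Rmult_le_pos; auto).
  assert (1 * 1 <= rprod t X N * (1 + t N * X)) by (apply Rmult_le_compat; lra). lra.
Qed.

Lemma rsum_ge_0 t N : (forall m, 0 <= t m) -> 0 <= rsum t N.
Proof. intros Ht. induction N; simpl; [lra|]. specialize (Ht N). lra. Qed.

Lemma Cmod_factor_le (a x : C) t X : Cmod a <= t -> Cmod x <= X -> Cmod (1 + a * x) <= 1 + t * X.
Proof.
  intros Ha Hx. eapply Rle_trans; [apply Cmod_triangle|]. rewrite Cmod_1, Cmod_mult.
  apply Rplus_le_compat_l, Rmult_le_compat; auto using Cmod_ge_0.
Qed.

Lemma pprod_bound d t x X N : (forall m, Cmod (d m) <= t m) -> Cmod x <= X ->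
  Cmod (pprod d x N) <= rprod t X N.
Proof.
  intros Hd Hx. induction N as [|N IH]; simpl; [rewrite Cmod_1; lra|].
  rewrite Cmod_mult. apply Rmult_le_compat; auto using Cmod_ge_0, Cmod_factor_le.
Qed.

(** Increments are dominated term by term by those of the real product, so convergence reduces to a
    bounded increasing sequence. The case N = 0 bounds the distance of the product from 1. *)
Lemma pprod_cauchy d t x X N k : (forall m, Cmod (d m) <= t m) -> Cmod x <= X ->
  Cmod (pprod d x (N + k) - pprod d x N) <= rprod t X (N + k) - rprod t X N.
Proof.
  intros Hd Hx. induction k as [|k IH].
  - rewrite Nat.add_0_r. replace (pprod d x N - pprod d x N)%C with (RtoC 0) by ring. rewrite Cmod_0. lra.
  - rewrite Nat.add_succ_r. simpl.
    replace (pprod d x (N + k) * (1 + d (N + k)%nat * x) - pprod d x N)%C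
      with ((pprod d x (N + k) - pprod d x N) + pprod d x (N + k) * (d (N + k)%nat * x))%C by ring.
    eapply Rle_trans; [apply Cmod_triangle|]. rewrite !Cmod_mult.
    assert (Cmod (pprod d x (N + k)) * (Cmod (d (N + k)%nat) * Cmod x) <= rprod t X (N + k) * (t (N + k)%nat * X)).
    { apply Rmult_le_compat; auto using Cmod_ge_0.
      - apply Rmult_le_pos; apply Cmod_ge_0.
      - apply pprod_bound; auto.
      - apply Rmult_le_compat; auto using Cmod_ge_0. }
    lra.
Qed.

Lemma pprod_lipschitz d t x y X N : (forall m, Cmod (d m) <= t m) -> Cmod x <= X -> Cmod y <= X ->
  Cmod (pprod d x N - pprod d y N) <= rprod t X N * rsum t N * Cmod (x - y).
Proof.
  intros Hd Hx Hy. assert (Ht := fun m => Cmod_le_nonneg _ _ (Hd m)).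
  assert (HX := Cmod_le_nonneg _ _ Hx).
  induction N as [|N IH]; simpl.
  - replace (RtoC 1 - RtoC 1)%C with (RtoC 0) by ring. rewrite Cmod_0. lra.
  - replace (pprod d x N * (1 + d N * x) - pprod d y N * (1 + d N * y))%C
      with ((pprod d x N - pprod d y N) * (1 + d N * x) + pprod d y N * d N * (x - y))%C by ring.
    eapply Rle_trans; [apply Cmod_triangle|]. rewrite !Cmod_mult.
    assert (R1 := rprod_ge_1 t X N Ht HX). assert (S0 := rsum_ge_0 t N Ht). assert (C0 := Cmod_ge_0 (x - y)).
    assert (TX : 0 <= t N * X) by (apply Rmult_le_pos; auto).
    assert (A1 : Cmod (pprod d x N - pprod d y N) * Cmod (1 + d N * x)
         <= rprod t X N * rsum t N * Cmod (x - y) * (1 + t N * X))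
      by (apply Rmult_le_compat; auto using Cmod_ge_0, Cmod_factor_le).
    assert (A2 : Cmod (pprod d y N) * Cmod (d N) * Cmod (x - y)
         <= rprod t X N * (1 + t N * X) * t N * Cmod (x - y)).
    { apply Rmult_le_compat_r; auto. apply Rmult_le_compat; auto using Cmod_ge_0.
      eapply Rle_trans; [apply pprod_bound; eauto|].
      rewrite <- (Rmult_1_r (rprod t X N)) at 1. apply Rmult_le_compat_l; lra. }
    lra.
Qed.

(** The second-order estimate that [cderiv_limit] asks for. In the induction (s + t)^2 exceeds s^2
    by 2 s t + t^2, which covers the cross term bounded by [pprod_lipschitz]. *)
Lemma pprod_taylor d t x y X N : (forall m, Cmod (d m) <= t m) -> Cmod x <= X -> Cmod y <= X ->
  Cmod (pprod d x N - pprod d y N - (x - y) * dprod d y N)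
    <= rprod t X N * (rsum t N * rsum t N) * (Cmod (x - y) * Cmod (x - y)).
Proof.
  intros Hd Hx Hy. assert (Ht := fun m => Cmod_le_nonneg _ _ (Hd m)).
  assert (HX := Cmod_le_nonneg _ _ Hx).
  assert (C0 := Cmod_ge_0 (x - y)).
  induction N as [|N IH]; simpl.
  - replace (RtoC 1 - RtoC 1 - (x - y) * 0)%C with (RtoC 0) by ring. rewrite Cmod_0. lra.
  - replace (pprod d x N * (1 + d N * x) - pprod d y N * (1 + d N * y) - (x - y) * (dprod d y N * (1 + d N * y) + pprod d y N * d N))%C
      with ((pprod d x N - pprod d y N - (x - y) * dprod d y N) * (1 + d N * y)
            + (pprod d x N - pprod d y N) * (d N * (x - y)))%C by ring.
    eapply Rle_trans; [apply Cmod_triangle|]. rewrite !Cmod_mult.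
    assert (R1 := rprod_ge_1 t X N Ht HX). assert (S0 := rsum_ge_0 t N Ht).
    assert (TX : 0 <= t N * X) by (apply Rmult_le_pos; auto).
    set (r := rprod t X N) in *. set (s := rsum t N) in *. set (c := Cmod (x - y)) in *.
    assert (A1 : Cmod (pprod d x N - pprod d y N - (x - y) * dprod d y N) * Cmod (1 + d N * y)
         <= r * (s * s) * (c * c) * (1 + t N * X))
      by (apply Rmult_le_compat; auto using Cmod_ge_0, Cmod_factor_le).
    assert (L := pprod_lipschitz d t x y X N Hd Hx Hy). fold r s c in L.
    assert (A2 : Cmod (pprod d x N - pprod d y N) * (Cmod (d N) * c) <= r * s * c * (t N * c)).
    { apply Rmult_le_compat; auto using Cmod_ge_0.
      - apply Rmult_le_pos; auto using Cmod_ge_0.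
      - apply Rmult_le_compat_r; auto. }
    assert (cc : 0 <= c * c) by (apply Rmult_le_pos; auto).
    assert (rs : 0 <= r * s) by (apply Rmult_le_pos; lra).
    assert (Q : r * s * t N * (c * c) <= r * (1 + t N * X) * (2 * s * t N + t N * t N) * (c * c)).
    { apply Rmult_le_compat_r; auto.
      rewrite !Rmult_assoc. apply Rmult_le_compat_l; [lra|].
      rewrite <- (Rmult_1_l (s * t N)). assert (P1 := Ht N).
      assert (0 <= s * t N) by (apply Rmult_le_pos; auto).
      assert (0 <= t N * t N) by (apply Rmult_le_pos; auto).
      apply Rmult_le_compat; lra. }
    replace (r * (1 + t N * X) * ((s + t N) * (s + t N)) * (c * c))
      with (r * (s * s) * (c * c) * (1 + t N * X) + r * (1 + t N * X) * (2 * s * t N + t N * t N) * (c * c)) by ring.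
    lra.
Qed.

Lemma pprod_clim d t x X B : (forall m, Cmod (d m) <= t m) -> Cmod x <= X ->
  (forall N, rprod t X N <= B) -> exists l, clim (pprod d x) l.
Proof.
  intros Hd Hx HB. assert (Ht := fun m => Cmod_le_nonneg _ _ (Hd m)).
  assert (HX := Cmod_le_nonneg _ _ Hx).
  assert (Hinc : forall n, rprod t X n <= rprod t X (S n)).
  { intros n. simpl. assert (R1 := rprod_ge_1 t X n Ht HX).
    assert (0 <= t n * X) by (apply Rmult_le_pos; auto).
    rewrite <- (Rmult_1_r (rprod t X n)) at 1. apply Rmult_le_compat_l; lra. }
  destruct (ex_finite_lim_seq_incr (rprod t X) B Hinc HB) as [l Hl].
  apply is_lim_seq_spec in Hl.
  apply clim_cauchy. intros eps He. assert (He2 : 0 < eps / 4) by lra.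
  destruct (Hl (mkposreal _ He2)) as [N HN]. simpl in HN.
  exists N.
  assert (W : forall n, (N <= n)%nat -> Cmod (pprod d x n - pprod d x N) < eps / 2).
  { intros n Hn. replace n with (N + (n - N))%nat by lia.
    eapply Rle_lt_trans; [apply pprod_cauchy with (t := t) (X := X); auto|].
    assert (A1 := HN N (Nat.le_refl N)). assert (A2 := HN (N + (n - N))%nat ltac:(lia)).
    apply Rabs_def2 in A1. apply Rabs_def2 in A2. lra. }
  intros n m Hn Hm. assert (T := Cmod_minus_triangle (pprod d x n) (pprod d x N) (pprod d x m)).
  rewrite (Cmod_minus_sym (pprod d x N)) in T. specialize (W n Hn) as W1. specialize (W m Hm) as W2. lra.
Qed.

(** * Limits of products whose coefficients decrease fast *)

Definition plim (d : nat -> C) (x : C) : C :=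
  epsilon (inhabits (RtoC 0)) (fun l => clim (pprod d x) l).

Lemma plim_spec d x : (exists l, clim (pprod d x) l) -> clim (pprod d x) (plim d x).
Proof. intros H. apply (epsilon_spec (inhabits (RtoC 0)) (fun l => clim (pprod d x) l) H). Qed.

(* For [y <= 1] use [y <= y^s], for [y > 1] use [1 + y <= 2 y <= e^(1/s) y]. *)
Lemma one_plus_le_exp_Rpower y s : 0 < y -> 0 < s <= 1 -> 1 + y <= exp (Rpower y s / s).
Proof.
  intros Hy [Hs Hs1]. assert (Hv : 0 < Rpower y s) by apply exp_pos.
  assert (H1s : 1 <= / s) by (rewrite <- Rinv_1; apply Rinv_le_contravar; lra).
  destruct (Rle_lt_dec y 1) as [H | H].
  - assert (L : y <= Rpower y s).
    { rewrite <- (exp_ln y Hy) at 1. unfold Rpower. apply exp_le.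
      assert (Hl : ln y <= 0) by (rewrite <- ln_1; destruct H as [H | ->]; [left; apply ln_increasing | ]; lra).
      assert (0 <= (1 - s) * (- ln y)) by (apply Rmult_le_pos; lra). lra. }
    apply Rle_trans with (exp y); [left; apply exp_ineq1; lra|]. apply exp_le.
    apply Rle_trans with (Rpower y s * 1); [lra|]. apply Rmult_le_compat_l; lra.
  - assert (L : y <= exp ((Rpower y s - 1) / s)).
    { rewrite <- (exp_ln y Hy) at 1. apply exp_le.
      apply Rmult_le_reg_l with s; auto. replace (s * ((Rpower y s - 1) / s)) with (Rpower y s - 1) by (field; lra).
      unfold Rpower. assert (0 < s * ln y) by (apply Rmult_lt_0_compat; auto; rewrite <- ln_1; apply ln_increasing; lra).
      assert (T := exp_ineq1 (s * ln y) ltac:(lra)). lra. }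
    assert (E2 : 2 <= exp (/ s)).
    { apply Rle_trans with (exp 1); [assert (T := exp_ineq1 1 ltac:(lra)); lra | apply exp_le, H1s]. }
    replace (Rpower y s / s) with (/ s + (Rpower y s - 1) / s) by (field; lra).
    rewrite exp_plus. apply Rle_trans with (2 * y); [lra|]. apply Rmult_le_compat; lra.
Qed.

(** Chosen so that its s-th power is eta 2^(-(m+1)). Each factor 1 + t_m X then contributes eta
    2^(-(m+1)) X^s / s to the exponent, and the whole product at most eta X^s / s. *)
Definition tseq (s eta : R) (m : nat) : R := Rpower (eta * (/ 2) ^ S m) (/ s).

Lemma tseq_pos s eta m : 0 < tseq s eta m.
Proof. apply exp_pos. Qed.

Lemma half_pow_pos m : 0 < (/ 2) ^ m.
Proof. apply pow_lt. lra. Qed.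

Lemma rprod_tseq_le s eta X N : 0 < s <= 1 -> 0 < eta -> 0 < X ->
  rprod (tseq s eta) X N <= exp (eta * (1 - (/ 2) ^ N) * (Rpower X s / s)).
Proof.
  intros Hs Heta HX. induction N as [|N IH].
  - simpl. rewrite Rminus_diag, Rmult_0_r, Rmult_0_l, exp_0. lra.
  - simpl rprod. replace (eta * (1 - (/ 2) ^ S N) * (Rpower X s / s))
      with (eta * (1 - (/ 2) ^ N) * (Rpower X s / s) + Rpower (tseq s eta N * X) s / s).
    + rewrite exp_plus. apply Rmult_le_compat; auto.
      * assert (T := rprod_ge_1 (tseq s eta) X N (fun m => Rlt_le _ _ (tseq_pos s eta m)) ltac:(lra)). lra.
      * assert (0 < tseq s eta N * X) by (apply Rmult_lt_0_compat; auto; apply tseq_pos). lra.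
      * apply one_plus_le_exp_Rpower; auto. apply Rmult_lt_0_compat; auto. apply tseq_pos.
    + rewrite <- Rpower_mult_distr by (auto; apply tseq_pos). unfold tseq. rewrite Rpower_mult.
      replace (/ s * s) with 1 by (field; lra).
      rewrite Rpower_1 by (apply Rmult_lt_0_compat; auto; apply half_pow_pos). simpl. field. lra.
Qed.

Lemma rprod_tseq_bound s eta X N : 0 < s <= 1 -> 0 < eta -> 0 < X ->
  rprod (tseq s eta) X N <= exp (eta * (Rpower X s / s)).
Proof.
  intros Hs Heta HX. eapply Rle_trans; [apply rprod_tseq_le; auto|]. apply exp_le.
  apply Rmult_le_compat_r.
  - left. apply Rdiv_lt_0_compat; [apply exp_pos | lra].
  - assert (P := half_pow_pos N). assert (0 < eta * (/ 2) ^ N) by (apply Rmult_lt_0_compat; auto). lra.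
Qed.

Lemma rsum_tseq_bound s eta N : 0 < s <= 1 -> 0 < eta <= 1 -> rsum (tseq s eta) N <= 1 - (/ 2) ^ N.
Proof.
  intros Hs Heta. induction N as [|N IH]; simpl; [lra|].
  assert (T : tseq s eta N <= (/ 2) ^ S N).
  { unfold tseq. assert (P := half_pow_pos (S N)).
    assert (Hle : (/ 2) ^ S N <= 1) by (rewrite <- (pow1 (S N)); apply pow_incr; lra).
    set (v := eta * (/ 2) ^ S N).
    assert (Hv : 0 < v) by (apply Rmult_lt_0_compat; lra).
    assert (Hv2 : v <= (/ 2) ^ S N).
    { unfold v. rewrite <- (Rmult_1_l ((/ 2) ^ S N)) at 2. apply Rmult_le_compat_r; lra. }
    eapply Rle_trans; [|exact Hv2].
    rewrite <- (exp_ln v Hv) at 2. unfold Rpower. apply exp_le.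
    assert (H1s : 1 <= / s) by (rewrite <- Rinv_1; apply Rinv_le_contravar; lra).
    assert (Hl : ln v <= 0).
    { rewrite <- ln_1. destruct (Req_dec v 1) as [-> | Hn]; [lra|]. left. apply ln_increasing; lra. }
    assert (0 <= (/ s - 1) * (- ln v)) by (apply Rmult_le_pos; lra). lra. }
  simpl in T. lra.
Qed.

Lemma plim_clim d s eta x : 0 < s <= 1 -> 0 < eta -> (forall m, Cmod (d m) <= tseq s eta m) ->
  clim (pprod d x) (plim d x).
Proof.
  intros Hs Heta Hd. apply plim_spec. assert (C0 := Cmod_ge_0 x).
  apply pprod_clim with (t := tseq s eta) (X := Cmod x + 1) (B := exp (eta * (Rpower (Cmod x + 1) s / s))); auto.
  - lra.
  - intros N. apply rprod_tseq_bound; auto. lra.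
Qed.

Lemma plim_bound d s eta x X : 0 < s <= 1 -> 0 < eta -> (forall m, Cmod (d m) <= tseq s eta m) ->
  0 < X -> Cmod x <= X -> Cmod (plim d x) <= exp (eta * (Rpower X s / s)).
Proof.
  intros Hs Heta Hd HX Hx. replace (plim d x) with (plim d x - 0)%C by ring.
  apply (clim_bound (pprod d x)); [apply plim_clim with s eta; auto|].
  intros n. replace (pprod d x n - 0)%C with (pprod d x n) by ring.
  eapply Rle_trans; [apply pprod_bound with (t := tseq s eta) (X := X); auto | apply rprod_tseq_bound; auto].
Qed.

Lemma plim_near_1 d s eta x X : 0 < s <= 1 -> 0 < eta -> (forall m, Cmod (d m) <= tseq s eta m) ->
  0 < X -> Cmod x <= X -> Cmod (plim d x - 1) <= exp (eta * (Rpower X s / s)) - 1.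
Proof.
  intros Hs Heta Hd HX Hx.
  apply (clim_bound (pprod d x)); [apply plim_clim with s eta; auto|].
  intros n. assert (T := pprod_cauchy d (tseq s eta) x X 0 n Hd Hx). simpl in T.
  assert (B := rprod_tseq_bound s eta X n Hs Heta HX). lra.
Qed.

Lemma plim_cderiv d s eta x : 0 < s <= 1 -> 0 < eta <= 1 -> (forall m, Cmod (d m) <= tseq s eta m) ->
  exists l, cderiv (plim d) x l.
Proof.
  intros Hs Heta Hd. assert (C0 := Cmod_ge_0 x). set (X := Cmod x + 1).
  assert (HX : 0 < X) by (unfold X; lra).
  assert (Htp : forall m, 0 <= tseq s eta m) by (intros m; left; apply tseq_pos).
  apply (cderiv_limit (fun n y => pprod d y n) (plim d) (dprod d x) x 1 (exp (eta * (Rpower X s / s)))).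
  - lra.
  - left. apply exp_pos.
  - intros y _. apply plim_clim with s eta; auto. lra.
  - intros n y Hy.
    assert (Hyx : Cmod y <= X) by (assert (T := Cmod_minus_ge y x); unfold X; lra).
    eapply Rle_trans; [apply pprod_taylor with (t := tseq s eta) (X := X); auto; unfold X; lra|].
    apply Rmult_le_compat_r; [apply Rmult_le_pos; apply Cmod_ge_0|].
    assert (S1 := rsum_tseq_bound s eta n Hs Heta). assert (S0 := rsum_ge_0 (tseq s eta) n Htp).
    assert (P := half_pow_pos n).
    assert (SS : rsum (tseq s eta) n * rsum (tseq s eta) n <= 1 * 1) by (apply Rmult_le_compat; lra).
    assert (RB := rprod_tseq_bound s eta X n Hs (proj1 Heta) HX).
    assert (R1 := rprod_ge_1 (tseq s eta) X n Htp ltac:(lra)).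
    rewrite <- (Rmult_1_r (exp _)). apply Rmult_le_compat; try lra. apply Rmult_le_pos; auto.
Qed.

(** A zero coefficient turns the n-th factor into 1, so a factor is removed without reindexing and
    every bound on d survives. *)
Definition drop_at (d : nat -> C) (n m : nat) : C := if Nat.eq_dec m n then RtoC 0 else d m.

Lemma drop_at_bound d n t : (forall m, Cmod (d m) <= t m) -> forall m, Cmod (drop_at d n m) <= t m.
Proof.
  intros H m. unfold drop_at. destruct (Nat.eq_dec m n); auto. rewrite Cmod_0.
  eapply Rle_trans; [apply Cmod_ge_0 | apply H].
Qed.

Lemma pprod_drop_at d n x N : (n < N)%nat -> pprod d x N = ((1 + d n * x) * pprod (drop_at d n) x N)%C.
Proof.
  assert (W : forall N, (N <= n)%nat -> pprod d x N = pprod (drop_at d n) x N).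
  { intros K. induction K as [|K IH]; intros HK; simpl; auto. rewrite IH by lia.
    unfold drop_at at 3. destruct (Nat.eq_dec K n); [lia | reflexivity]. }
  induction N as [|N IH]; intros HN; [lia|]. simpl. unfold drop_at at 2.
  destruct (Nat.eq_dec N n) as [-> | Hne].
  - rewrite W by lia. ring.
  - rewrite IH by lia. ring.
Qed.

Lemma plim_drop_at d s eta n x : 0 < s <= 1 -> 0 < eta -> (forall m, Cmod (d m) <= tseq s eta m) ->
  plim d x = ((1 + d n * x) * plim (drop_at d n) x)%C.
Proof.
  intros Hs Heta Hd. apply (clim_unique (pprod d x)); [apply plim_clim with s eta; auto|].
  apply (clim_eventually (fun N => (1 + d n * x) * pprod (drop_at d n) x N)%C _ _ (S n)).
  - intros N HN. symmetry. apply pprod_drop_at. lia.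
  - apply clim_scal. apply plim_clim with s eta; auto. apply drop_at_bound, Hd.
Qed.

(** * The resolvent of the coordinate function modulo a closed maximal ideal *)

Definition lin (a : C) : C -> C := restr (fun z => z - a)%C.
Definition kern (a : C) : C -> C := restr (fun z => / (z - a))%C.

(** Each [g a] is some inverse of z - a modulo M; nothing is assumed about its dependence on a. *)
Definition resolvent (p : R) (M : (C -> C) -> Prop) (g : C -> C -> C) : Prop :=
  forall a, Fp p (g a) /\ M (fsub fone (fmul (lin a) (g a))).

(** 1/(1 - r) is the p-th power of [gr p r], and exponentials beat powers. *)
Lemma inv_dist_growth p eps : 0 < p -> 0 < eps ->
  exists K, 0 <= K /\ forall r, r < 1 -> / (1 - r) <= K * exp (eps * gr p r).
Proof.
  intros Hp He. assert (Hep : 0 < eps / p) by (apply Rdiv_lt_0_compat; auto).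
  assert (HR : 0 < Rpower (eps / p) p) by apply exp_pos.
  exists (/ Rpower (eps / p) p). split; [left; apply Rinv_0_lt_compat; auto|].
  intros r Hr. assert (G := gr_pos p r).
  assert (T := exp_ge_Rpower (eps * gr p r) p ltac:(apply Rmult_lt_0_compat; auto) Hp).
  replace (eps * gr p r / p) with (eps / p * gr p r) in T by (field; lra).
  rewrite <- Rpower_mult_distr in T by auto.
  assert (E : Rpower (gr p r) p = / (1 - r)).
  { unfold gr. rewrite Rpower_mult. replace (- (1 / p) * p) with (- (1)) by (field; lra).
    rewrite Rpower_Ropp, Rpower_1; lra. }
  rewrite E in T. apply Rmult_le_reg_l with (Rpower (eps / p) p); auto.
  rewrite <- Rmult_assoc, Rinv_r, Rmult_1_l by lra. exact T.
Qed.

(* AM-GM: [gr p r] is the square of [Rpower (/ (1 - r)) (/ (2 * p))]. *)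
Lemma exp_sqrt_gr_le p eps c r : 0 < p -> 0 < eps -> r < 1 ->
  exp (c * Rpower (/ (1 - r)) (/ (2 * p))) <= exp (c * c / (4 * eps)) * exp (eps * gr p r).
Proof.
  intros Hp He Hr. rewrite <- exp_plus. apply exp_le.
  set (T := Rpower (/ (1 - r)) (/ (2 * p))).
  assert (E : gr p r = T * T).
  { unfold T, gr. rewrite <- Rpower_plus. unfold Rpower. rewrite ln_Rinv by lra. f_equal. field. lra. }
  rewrite E. assert (Q : 0 <= eps * ((T - c / (2 * eps)) * (T - c / (2 * eps)))).
  { apply Rmult_le_pos; [lra | apply Rle_0_sqr]. }
  replace (eps * ((T - c / (2 * eps)) * (T - c / (2 * eps)))) with (eps * (T * T) - c * T + c * c / (4 * eps)) in Q
    by (field; lra). lra.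
Qed.

Lemma Fp_lin p a : 0 < p -> Fp p (lin a).
Proof.
  intros Hp. apply Fp_restr; auto.
  - intros z _. eexists. apply cderiv_plus; [apply cderiv_id | apply cderiv_const].
  - apply growth_bounded with (1 + Cmod a); [assert (T := Cmod_ge_0 a); lra|].
    intros z Hz. assert (T := Cmod_minus_le z a). unfold disk in Hz. lra.
Qed.

Lemma kern_dist a z : 1 <= Cmod a -> 1 - Cmod z <= Cmod (z - a).
Proof. intros Ha. assert (T := Cmod_minus_ge a z). rewrite Cmod_minus_sym in T. lra. Qed.

Lemma cderiv_kern a z : 1 <= Cmod a -> disk z -> exists l, cderiv (fun z => / (z - a))%C z l.
Proof.
  intros Ha Hz. assert (T := kern_dist a z Ha). unfold disk in Hz.
  eexists. apply (cderiv_comp Cinv (fun y => y + - a)%C).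
  - apply cderiv_inv. apply Cmod_gt_0. change (0 < Cmod (z - a)). lra.
  - apply cderiv_plus; [apply cderiv_id | apply cderiv_const].
Qed.

Lemma Cmod_kern_le a z : 1 <= Cmod a -> disk z -> Cmod (/ (z - a))%C <= / (1 - Cmod z).
Proof.
  intros Ha Hz. assert (T := kern_dist a z Ha). unfold disk in Hz.
  rewrite Cmod_inv by (apply Cmod_gt_0; lra). apply Rinv_le_contravar; lra.
Qed.

Lemma Fp_kern p a : 0 < p -> 1 <= Cmod a -> Fp p (kern a).
Proof.
  intros Hp Ha. apply Fp_restr; auto.
  - intros z Hz. apply cderiv_kern; auto.
  - intros eps He. destruct (inv_dist_growth p eps Hp He) as (K & HK & H).
    exists K. split; auto. intros z Hz. eapply Rle_trans; [apply Cmod_kern_le; auto | apply H, Hz].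
Qed.

Lemma lin_kern a : 1 <= Cmod a -> fmul (lin a) (kern a) = fone.
Proof.
  intros Ha. apply functional_extensionality. intros z. unfold fmul, lin, kern, fone.
  destruct (classic (disk z)) as [Hz | Hz].
  - rewrite !restr_in by auto. field. apply Cmod_gt_0.
    assert (T := kern_dist a z Ha). unfold disk in Hz. lra.
  - rewrite !restr_out by auto. ring.
Qed.

Lemma fmul_one f : on_disk f -> fmul f fone = f.
Proof.
  intros Hf. apply functional_extensionality. intros z. unfold fmul, fone.
  destruct (classic (disk z)) as [Hz | Hz].
  - rewrite restr_in by auto. ring.
  - rewrite restr_out, Hf by auto. ring.
Qed.

Lemma one_mul f z : on_disk f -> (fone z * f z)%C = f z.
Proof. intros Hf. rewrite Cmult_comm. exact (f_equal (fun h => h z) (fmul_one f Hf)). Qed.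

Lemma one_not_in p M : Fp_proper_ideal p M -> ~ M fone.
Proof.
  intros [(HF & _ & _ & HM) (f & Hf & Nf)] H1. apply Nf.
  rewrite <- (fmul_one f (proj1 Hf)). apply HM; auto.
Qed.

Lemma ideal_sub p M f g : 0 < p -> Fp_ideal p M -> M f -> M g -> M (fsub f g).
Proof.
  intros Hp HI Hf Hg.
  replace (fsub f g) with (fadd f (fun z => - RtoC 1 * g z)%C)
    by (apply functional_extensionality; intros z; unfold fsub, fadd; ring).
  apply HI; auto. apply (ideal_scal p); auto.
Qed.

(** If the ideal M + u F^p did not contain [fone], it would be proper, and maximality would put u
    into M. *)
Lemma maximal_inverse p M u : 0 < p -> Fp_maximal_ideal p M -> Fp p u -> ~ M u ->
  exists w, Fp p w /\ M (fsub fone (fmul u w)).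
Proof.
  intros Hp [HP Hmax] Hu Nu. assert (HI := proj1 HP). destruct HI as (HF & H0 & Hadd & Hmul).
  assert (F0 : Fp p fzero) by (apply HF, H0). assert (F1 := Fp_one p Hp).
  set (J := fun f => exists m w, M m /\ Fp p w /\ f = fadd m (fmul u w)).
  destruct (classic (J fone)) as [(m & w & Hm & Hw & E) | NJ].
  - exists w. split; auto. replace (fsub fone (fmul u w)) with m; auto.
    rewrite E. apply functional_extensionality. intros z. unfold fsub, fadd. ring.
  - exfalso. apply Nu.
    assert (HMJ : forall f, M f -> J f).
    { intros f Hf. exists f, fzero. repeat split; auto; try apply F0.
      apply functional_extensionality. intros z. unfold fadd, fmul, fzero. ring. }
    apply (Hmax J); auto.
    + split; [|exists fone; auto]. split; [|split; [|split]].
      * intros f (m & w & Hm & Hw & ->). apply Fp_add; auto. apply Fp_mul; auto.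
      * apply HMJ, H0.
      * intros f g (m & w & Hm & Hw & ->) (m' & w' & Hm' & Hw' & ->).
        exists (fadd m m'), (fadd w w'). split; [auto|]. split; [apply Fp_add; auto|].
        apply functional_extensionality. intros z. unfold fadd, fmul. ring.
      * intros f g Hf (m & w & Hm & Hw & ->).
        exists (fmul f m), (fmul f w). split; [auto|]. split; [apply Fp_mul; auto|].
        apply functional_extensionality. intros z. unfold fadd, fmul. ring.
    + exists fzero, fone. split; [auto|]. split; [auto|]. rewrite fmul_one by apply Hu.
      apply functional_extensionality. intros z. unfold fadd, fzero. ring.
Qed.

Lemma annihilator_eq p M phi f g : 0 < p -> annihilator p M phi -> Fp p f -> Fp p g ->
  M (fsub f g) -> Fp p (fsub f g) -> phi f = phi g.
Proof.
  intros Hp (Hadd & Hsc & HM & _) Hf Hg H HF.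
  replace f with (fadd g (fsub f g)) by (apply functional_extensionality; intros z; unfold fadd, fsub; ring).
  rewrite Hadd, (HM _ H) by auto. ring.
Qed.

Lemma resolvent_unique p M g a h : 0 < p -> Fp_ideal p M -> resolvent p M g -> Fp p h ->
  M (fsub fone (fmul (lin a) h)) -> M (fsub h (g a)).
Proof.
  intros Hp HI Hg Hh Hm. destruct (Hg a) as [Fg Mg].
  replace (fsub h (g a)) with (fsub (fmul h (fsub fone (fmul (lin a) (g a)))) (fmul (g a) (fsub fone (fmul (lin a) h)))).
  - apply (ideal_sub p); auto; apply HI; auto.
  - apply functional_extensionality. intros z.
    (* [fone] is not constantly 1 on C, so h = fone h has to be inserted by hand before [ring] can
       see the cancellation. *)
    assert (E1 := one_mul h z (proj1 Hh)). assert (E2 := one_mul (g a) z (proj1 Fg)).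
    unfold fsub, fmul. rewrite <- E1 at 3. rewrite <- E2 at 3. ring.
Qed.

(** The value phi(w g_a) can be computed with any inverse of z - a modulo M. Bounds near a given
    point thus come from inverses built for that purpose. *)
Lemma annihilator_resolvent p M phi g w a h : 0 < p -> Fp_ideal p M -> annihilator p M phi ->
  resolvent p M g -> Fp p w -> Fp p h -> M (fsub fone (fmul (lin a) h)) ->
  phi (fmul w (g a)) = phi (fmul w h).
Proof.
  intros Hp HI Hphi Hg Hw Hh Hm. symmetry.
  assert (MM : M (fsub (fmul w h) (fmul w (g a)))).
  { replace (fsub (fmul w h) (fmul w (g a))) with (fmul w (fsub h (g a)))
      by (apply functional_extensionality; intros z; unfold fsub, fmul; ring).
    apply HI; auto. apply (resolvent_unique p); auto. }
  apply (annihilator_eq p M); auto; try (apply Fp_mul; auto; apply Hg). apply HI, MM.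
Qed.

Lemma resolvent_identity p M phi g w a b : 0 < p -> Fp_ideal p M -> annihilator p M phi ->
  resolvent p M g -> Fp p w ->
  (phi (fmul w (g a)) - phi (fmul w (g b)) = (a - b) * phi (fmul (fmul w (g b)) (g a)))%C.
Proof.
  intros Hp HI Hphi Hg Hw. destruct (Hg a) as [Fa Ma]. destruct (Hg b) as [Fb Mb].
  assert (Fwb : Fp p (fmul w (g b))) by (apply Fp_mul; auto).
  assert (Fwba : Fp p (fmul (fmul w (g b)) (g a))) by (apply Fp_mul; auto).
  assert (Fs := Fp_scal p (a - b) _ Hp Fwba).
  assert (E : phi (fmul w (g a)) = phi (fadd (fmul w (g b)) (fun z => (a - b) * fmul (fmul w (g b)) (g a) z)%C)).
  { assert (MM : M (fsub (fmul w (g a)) (fadd (fmul w (g b)) (fun z => (a - b) * fmul (fmul w (g b)) (g a) z)%C))).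
    { replace (fsub (fmul w (g a)) (fadd (fmul w (g b)) (fun z => (a - b) * fmul (fmul w (g b)) (g a) z)%C))
        (* Crosswise multiplication: g_a (1 - (z-b) g_b) - g_b (1 - (z-a) g_a) = g_a - g_b - (a-b)
           g_a g_b, and both brackets lie in M. *)
        with (fmul w (fsub (fmul (g a) (fsub fone (fmul (lin b) (g b)))) (fmul (g b) (fsub fone (fmul (lin a) (g a)))))).
      - apply HI; auto. apply (ideal_sub p); auto; apply HI; auto.
      - apply functional_extensionality. intros z. unfold fsub, fadd, fmul, lin, fone.
        destruct (classic (disk z)) as [Hz | Hz].
        + rewrite !restr_in by auto. ring.
        + rewrite !restr_out, (proj1 Hw z Hz) by auto. ring. }
    apply (annihilator_eq p M); auto.
    - apply Fp_mul; auto.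
    - apply Fp_add; auto.
    - apply HI, MM. }
  destruct Hphi as (Hadd & Hsc & _). rewrite E, Hadd, Hsc by auto. ring.
Qed.

(** Uniform in the base point a: inside the radius r1 the quotient is bounded by a Lipschitz
    constant of f, and beyond it |z - a| >= r1 - r, so dividing costs only a constant. *)
Lemma quotient_bound p f r eps : Fp p f -> r < 1 -> 0 < eps ->
  exists K, 0 <= K /\ forall a q, Cmod a <= r -> holomorphic_on_disk q ->
    (forall z, disk z -> (f z - f a = (z - a) * q z)%C) ->
    forall z, disk z -> Cmod (q z) <= K * exp (eps * gr p (Cmod z)).
Proof.
  intros Hf Hr He. assert (Hh := proj1 (proj2 Hf)).
  set (r1 := (1 + r) / 2). assert (Hr1 : r1 < 1) by (unfold r1; lra). assert (Hrr : r < r1) by (unfold r1; lra).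
  destruct (holo_lipschitz f r1 Hh Hr1) as (L & HL & HLz).
  destruct (holo_bounded f r Hh Hr) as (M0 & HM0 & HM0z).
  destruct (Fp_growth p f Hf eps He) as (Kf & HKf & HKfz).
  set (K2 := (Kf + M0) / (r1 - r)).
  assert (HK2 : 0 <= K2) by (apply Rmult_le_pos; [lra | left; apply Rinv_0_lt_compat; lra]).
  exists (L + 1 + K2). split; [lra|]. intros a q Ha Hq Eq.
  assert (Da : disk a) by (unfold disk; lra).
  assert (Near : forall z, disk z -> z <> a -> Cmod z <= r1 -> Cmod (q z) <= L).
  { intros z Hz Hza Hzr. assert (Na := Cminus_eq_contra _ _ Hza).
    assert (P : 0 < Cmod (z - a)) by (apply Cmod_gt_0, Na).
    apply Rmult_le_reg_l with (Cmod (z - a)); auto. rewrite <- Cmod_mult, <- Eq by auto.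
    rewrite (Rmult_comm _ L). apply HLz; lra. }
  intros z Hz.
  assert (G1 := exp_gr_ge_1 p eps (Cmod z) He).
  set (X := exp (eps * gr p (Cmod z))) in *.
  assert (Weak : Cmod (q z) <= L + 1 -> Cmod (q z) <= (L + 1 + K2) * X).
  { intros Hle. assert ((L + 1 + K2) * 1 <= (L + 1 + K2) * X) by (apply Rmult_le_compat_l; lra). lra. }
  destruct (Ceq_dec z a) as [-> | Hza].
  (* At z = a the division identity says nothing about q. Continuity compares q(a) with a nearby
     value, at a cost of 1. *)
  - apply Weak. destruct (holo_ccont q a Hq Da 1 Rlt_0_1) as (d & Hd & H1).
    set (h := Rmin (d / 2) (r1 - r)). assert (Hh0 : 0 < h) by (apply Rmin_pos; lra).
    assert (Hh1 : h <= d / 2) by apply Rmin_l. assert (Hh2 : h <= r1 - r) by apply Rmin_r.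
    set (y := (a + RtoC h)%C).
    assert (Ey : (y - a)%C = RtoC h) by (unfold y; ring).
    assert (My : Cmod (y - a) = h) by (rewrite Ey, Cmod_R, Rabs_pos_eq; lra).
    assert (Hyr : Cmod y <= r1) by (assert (T := Cmod_minus_ge y a); lra).
    assert (Q1 := Near y ltac:(unfold disk; lra) ltac:(intros E; rewrite E in My;
        replace (a - a)%C with (RtoC 0) in My by ring; rewrite Cmod_0 in My; lra) Hyr).
    assert (Q2 := H1 y ltac:(lra)). assert (T := Cmod_minus_ge (q a) (q y)). rewrite Cmod_minus_sym in T. lra.
  - destruct (Rle_lt_dec (Cmod z) r1) as [H | H].
    + apply Weak. assert (T := Near z Hz Hza H). lra.
    + assert (P : r1 - r <= Cmod (z - a)) by (assert (T := Cmod_minus_ge z a); lra).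
      assert (Num : (r1 - r) * Cmod (q z) <= (Kf + M0) * X).
      { apply Rle_trans with (Cmod (z - a) * Cmod (q z)); [apply Rmult_le_compat_r; auto; apply Cmod_ge_0|].
        rewrite <- Cmod_mult, <- Eq by auto. eapply Rle_trans; [apply Cmod_minus_le|].
        assert (A1 := HKfz z Hz). fold X in A1. assert (A2 := HM0z a Ha).
        assert (M0 * 1 <= M0 * X) by (apply Rmult_le_compat_l; lra). lra. }
      apply Rle_trans with (K2 * X).
      * apply Rmult_le_reg_l with (r1 - r); [lra|].
        replace ((r1 - r) * (K2 * X)) with ((Kf + M0) * X) by (unfold K2; field; lra). exact Num.
      * apply Rmult_le_compat_r; lra.
Qed.

Lemma Fp_division p f a : 0 < p -> Fp p f -> disk a ->
  exists q, Fp p q /\ forall z, disk z -> (f z - f a = (z - a) * q z)%C.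
Proof.
  intros Hp Hf Ha. destruct (holo_division f a (proj1 (proj2 Hf)) Ha) as (q & Hq1 & Hq2 & Hq3).
  exists q. split; auto. apply growth_Fp; auto. intros eps He.
  destruct (quotient_bound p f (Cmod a) eps Hf Ha He) as (K & HK & H). exists K. split; auto.
  apply (H a q); auto. lra.
Qed.

(** The function f = 1 - (z-a) g_a lies in M and f(a) = 1. For b near a write f = f(b) + (z-b) q;
    then -q/f(b) inverts z - b modulo M, with |f(b)| > 1/2 and q bounded uniformly in b. *)
Lemma resolvent_bounded_inside p M phi g w a : 0 < p -> Fp_ideal p M -> annihilator p M phi ->
  resolvent p M g -> Fp p w -> disk a ->
  exists d K, 0 < d /\ forall b, Cmod (b - a) < d -> Cmod (phi (fmul w (g b))) <= K.
Proof.
  intros Hp HI Hphi Hg Hw Ha.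
  assert (Hphi' := Hphi). destruct Hphi' as (Hadd & Hsc & HM & H1 & eps & K0 & He & HK0 & HB).
  set (f := fsub fone (fmul (lin a) (g a))).
  assert (Mf : M f) by apply Hg. assert (Ff : Fp p f) by (apply HI, Mf).
  assert (Efa : f a = RtoC 1).
  { unfold f, fsub, fmul, fone, lin. rewrite !restr_in by auto. ring. }
  destruct (holo_ccont f a (proj1 (proj2 Ff)) Ha (1 / 2)) as (d1 & Hd1 & Hc); [lra|].
  unfold disk in Ha. set (r := (1 + Cmod a) / 2). assert (Hr : r < 1) by (unfold r; lra).
  destruct (Fp_growth p w Hw (eps / 2)) as (K1 & HK1 & HK1z); [lra|].
  destruct (quotient_bound p f r (eps / 2) Ff Hr ltac:(lra)) as (K2 & HK2 & HK2z).
  exists (Rmin d1 (r - Cmod a)), (2 * (K0 * (K1 * K2))). split.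
  { apply Rmin_pos; auto. unfold r. lra. }
  intros b Hb. destruct (Rmin_Rgt_l _ _ _ Hb) as [Hb1 Hb2].
  assert (Hbr : Cmod b <= r) by (assert (T := Cmod_minus_ge b a); lra).
  assert (Db : disk b) by (unfold disk; lra).
  destruct (Fp_division p f b Hp Ff Db) as (q & Fq & Eq).
  specialize (HK2z b q Hbr (proj1 (proj2 Fq)) Eq).
  assert (Hfb : 1 / 2 < Cmod (f b)).
  { specialize (Hc b Hb1). rewrite Efa in Hc. assert (T := Cmod_minus_ge 1 (f b)).
    rewrite Cmod_1, Cmod_minus_sym in T. lra. }
  assert (Nfb : f b <> RtoC 0) by (apply Cmod_gt_0; lra).
  set (c := (- / f b)%C).
  assert (Hcm : Cmod c <= 2).
  { unfold c. rewrite Cmod_opp, Cmod_inv by auto. replace 2 with (/ (1 / 2)) by field.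
    apply Rinv_le_contravar; lra. }
  set (h := fun z => (c * q z)%C). assert (Fh : Fp p h) by (apply Fp_scal; auto).
  assert (Fwq : Fp p (fmul w q)) by (apply Fp_mul; auto).
  assert (Mh : M (fsub fone (fmul (lin b) h))).
  { replace (fsub fone (fmul (lin b) h)) with (fun z => / f b * f z)%C; [apply (ideal_scal p); auto|].
    apply functional_extensionality. intros z. unfold fsub, fmul, fone, lin.
    destruct (classic (disk z)) as [Hz | Hz].
    - rewrite !restr_in by auto. unfold h, c.
      replace (f z) with (f b + (z - b) * q z)%C by (rewrite <- Eq by auto; ring). field. auto.
    - rewrite !restr_out, (proj1 Ff z Hz) by auto. ring. }
  rewrite (annihilator_resolvent p M phi g w b h) by auto.
  replace (fmul w h) with (fun z => c * fmul w q z)%C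
    by (apply functional_extensionality; intros z; unfold fmul, h; ring).
  rewrite Hsc, Cmod_mult by auto. apply Rmult_le_compat; auto using Cmod_ge_0.
  apply HB; auto; [apply Rmult_le_pos; auto|].
  intros z Hz. unfold fmul. rewrite Cmod_mult.
  replace (eps * gr p (Cmod z)) with (eps / 2 * gr p (Cmod z) + eps / 2 * gr p (Cmod z)) by field.
  rewrite exp_plus.
  replace (K1 * K2 * (exp (eps / 2 * gr p (Cmod z)) * exp (eps / 2 * gr p (Cmod z))))
    with (K1 * exp (eps / 2 * gr p (Cmod z)) * (K2 * exp (eps / 2 * gr p (Cmod z)))) by ring.
  apply Rmult_le_compat; auto using Cmod_ge_0.
Qed.

Lemma exp_minus_1_le a : 0 <= a -> exp a - 1 <= a * exp a.
Proof.
  intros Ha. destruct (Req_dec a 0) as [-> | N]; [rewrite exp_0; lra|].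
  assert (T := exp_ineq1 (- a) ltac:(lra)). assert (P := exp_pos a).
  assert (E : exp a * exp (- a) = 1) by (rewrite <- exp_plus, Rplus_opp_r; apply exp_0).
  assert (exp a * (1 + - a) < exp a * exp (- a)) by (apply Rmult_lt_compat_l; auto). lra.
Qed.

(* If [phi (w g_b)] were unbounded near [a], pick [b_n] tending to [a] fast with large values. The
   product of the [(z - b_n) / (z - a)] is close to 1, hence invertible modulo [M], and it is divisible
   by every [z - b_n] with quotients that stay bounded in F^p: a contradiction. *)
Lemma resolvent_bounded_outside p M phi g w a : 1 < p -> Fp_maximal_ideal p M -> annihilator p M phi ->
  resolvent p M g -> Fp p w -> 1 <= Cmod a ->
  exists d K, 0 < d /\ forall b, Cmod (b - a) < d -> Cmod (phi (fmul w (g b))) <= K.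
Proof.
  intros Hp1 Hmax Hphi Hg Hw Ha. assert (Hp : 0 < p) by lra.
  assert (HI := proj1 (proj1 Hmax)).
  assert (Hphi' := Hphi). destruct Hphi' as (Hadd & Hsc & HM & H1 & eps & K0 & He & HK0 & HB).
  apply NNPP. intros HN.
  (* Half of the critical exponent 1/p: [exp_sqrt_gr_le] then absorbs any multiple of (1-|z|)^(-s)
     into every weight eps. *)
  set (s := / (2 * p)).
  assert (Hs : 0 < s <= 1).
  { unfold s. split; [apply Rinv_0_lt_compat; lra|]. rewrite <- Rinv_1. apply Rinv_le_contravar; lra. }
  set (C1 := exp (2 / s * (2 / s) / (4 * eps))). assert (HC1 : 0 < C1) by apply exp_pos.
  assert (Hf1 : 0 < Cmod (phi fone)) by (apply Cmod_gt_0, H1).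
  (* So small that |phi(u - 1)| < |phi(1)|, which keeps the product u out of M. *)
  set (eta := Rmin 1 (Cmod (phi fone) / (2 * (K0 + 1) * C1))).
  assert (HKC : 0 < 2 * (K0 + 1) * C1) by (repeat apply Rmult_lt_0_compat; lra).
  assert (Heta : 0 < eta <= 1).
  { split; [apply Rmin_pos; [lra | apply Rdiv_lt_0_compat; auto] | apply Rmin_l]. }
  assert (Heta2 : K0 * (eta * C1) < Cmod (phi fone)).
  { apply Rle_lt_trans with ((K0 + 1) * (Cmod (phi fone) / (2 * (K0 + 1) * C1) * C1)).
    - apply Rmult_le_compat; try lra.
      + apply Rmult_le_pos; lra.
      + apply Rmult_le_compat_r; [lra | apply Rmin_r].
    - replace ((K0 + 1) * (Cmod (phi fone) / (2 * (K0 + 1) * C1) * C1)) with (Cmod (phi fone) / 2) by (field; lra). lra. }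
  (* Unboundedness is used at radius [tseq s eta n] with bound n: the points approach a as fast as
     the product requires. *)
  assert (Hb : forall n, exists b, Cmod (b - a) < tseq s eta n /\ INR n < Cmod (phi (fmul w (g b)))).
  { intros n. apply NNPP. intros Nb. apply HN. exists (tseq s eta n), (INR n).
    split; [apply tseq_pos|]. intros b Hb. apply Rnot_lt_le. intros Hlt. apply Nb. exists b. auto. }
  set (b := fun n => proj1_sig (constructive_indefinite_description _ (Hb n))).
  assert (Hb2 : forall n, Cmod (b n - a) < tseq s eta n /\ INR n < Cmod (phi (fmul w (g (b n))))).
  { intros n. exact (proj2_sig (constructive_indefinite_description _ (Hb n))). }
  (* With x = 1/(z - a) the factor 1 + d_n x equals (z - b_n)/(z - a). *)
  set (d := fun n => (a - b n)%C).
  assert (Hd : forall m, Cmod (d m) <= tseq s eta m).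
  { intros m. unfold d. rewrite Cmod_minus_sym. left. apply Hb2. }
  set (U := fun d => restr (fun z => plim d (/ (z - a))%C)).
  assert (HX : forall z, disk z -> 0 < / (1 - Cmod z)) by (intros z Hz; unfold disk in Hz; apply Rinv_0_lt_compat; lra).
  (* K is chosen before d, so one constant serves the product and all products with one factor
     removed. *)
  assert (Ugr : forall e, 0 < e -> exists K, 0 <= K /\ forall d, (forall m, Cmod (d m) <= tseq s eta m) ->
      forall z, disk z -> Cmod (plim d (/ (z - a))%C) <= K * exp (e * gr p (Cmod z))).
  { intros e He'. exists (exp (eta / s * (eta / s) / (4 * e))). split; [left; apply exp_pos|].
    intros d' Hd' z Hz.
    eapply Rle_trans; [apply (plim_bound d' s eta _ (/ (1 - Cmod z))); auto; try lra; apply Cmod_kern_le; auto|].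
    replace (eta * (Rpower (/ (1 - Cmod z)) s / s)) with (eta / s * Rpower (/ (1 - Cmod z)) s) by (field; lra).
    apply exp_sqrt_gr_le; auto. }
  assert (FU : forall d, (forall m, Cmod (d m) <= tseq s eta m) -> Fp p (U d)).
  { intros d' Hd'. apply Fp_restr; auto.
    - intros z Hz. destruct (cderiv_kern a z Ha Hz) as [l Hl].
      destruct (plim_cderiv d' s eta (/ (z - a))%C Hs Heta Hd') as [k Hk].
      eexists. apply (cderiv_comp (plim d')); eauto.
    - intros e He'. destruct (Ugr e He') as (K & HK & HKz). exists K. split; auto. }
  set (u := U d). assert (Fu : Fp p u) by (apply FU, Hd).
  assert (F1 := Fp_one p Hp).
  assert (Nu : ~ M u).
  { intros Mu.
    assert (Fsu : Fp p (fsub u fone)).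
    { replace (fsub u fone) with (fadd u (fun z => - RtoC 1 * fone z)%C)
        by (apply functional_extensionality; intros z; unfold fsub, fadd; ring).
      apply Fp_add; auto. apply Fp_scal; auto. }
    assert (E : phi u = (phi fone + phi (fsub u fone))%C).
    { rewrite <- Hadd by auto. f_equal. apply functional_extensionality. intros z. unfold fadd, fsub. ring. }
    rewrite (HM u Mu) in E.
    assert (Bd : Cmod (phi (fsub u fone)) <= K0 * (eta * C1)).
    { apply HB; auto; [apply Rmult_le_pos; lra|]. intros z Hz. unfold fsub, u, U, fone. rewrite !restr_in by auto.
      set (Y := Rpower (/ (1 - Cmod z)) s / s).
      assert (HY : 0 < Y) by (apply Rdiv_lt_0_compat; [apply exp_pos | lra]).
      eapply Rle_trans; [apply (plim_near_1 d s eta _ (/ (1 - Cmod z))); auto; try lra; apply Cmod_kern_le; auto|].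
      fold Y. assert (HeY : 0 <= eta * Y) by (apply Rmult_le_pos; lra).
      eapply Rle_trans; [apply exp_minus_1_le, HeY|].
      (* Here exp(eta Y) - 1 <= eta Y exp(eta Y) with eta <= 1 and Y <= exp Y. The factor eta is
         kept in front and exp(2 Y) costs the constant [C1]. *)
      apply Rle_trans with (eta * (exp Y * exp Y)).
      - rewrite Rmult_assoc. apply Rmult_le_compat_l; [lra|]. apply Rmult_le_compat; [lra | left; apply exp_pos | |].
        + assert (T := exp_ineq1 Y ltac:(lra)). lra.
        + apply exp_le. assert (eta * Y <= 1 * Y) by (apply Rmult_le_compat_r; lra). lra.
      - rewrite Rmult_assoc. apply Rmult_le_compat_l; [lra|]. rewrite <- exp_plus. unfold Y.
        replace (Rpower (/ (1 - Cmod z)) s / s + Rpower (/ (1 - Cmod z)) s / s)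
          with (2 / s * Rpower (/ (1 - Cmod z)) s) by (field; lra).
        apply exp_sqrt_gr_le; auto. }
    replace (phi (fsub u fone)) with (- phi fone)%C in Bd.
    - rewrite Cmod_opp in Bd. lra.
    - replace (phi (fsub u fone)) with (phi fone + phi (fsub u fone) - phi fone)%C by ring. rewrite <- E. ring. }
  destruct (maximal_inverse p M u Hp Hmax Fu Nu) as (w' & Fw' & Mw').
  destruct (Fp_growth p (fmul w w') (Fp_mul p w w' Hp Hw Fw') (eps / 3)) as (K1 & HK1 & HK1z); [lra|].
  destruct (Ugr (eps / 3)) as (K2 & HK2 & HK2z); [lra|].
  destruct (Fp_growth p (kern a) (Fp_kern p a Hp Ha) (eps / 3)) as (K3 & HK3 & HK3z); [lra|].
  assert (Bound : forall n, Cmod (phi (fmul w (g (b n)))) <= K0 * (K1 * K2 * K3)).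
  { intros n. set (un := U (drop_at d n)).
    assert (Fun : Fp p un) by (apply FU, drop_at_bound, Hd).
    (* Multiplying u_n/(z - a) by z - b_n restores u, and u w' is 1 modulo M; hence h inverts z -
       b_n modulo M. *)
    set (h := fmul (fmul un (kern a)) w').
    assert (Fk := Fp_kern p a Hp Ha).
    assert (Fh : Fp p h) by (apply Fp_mul; auto; apply Fp_mul; auto).
    assert (Mh : M (fsub fone (fmul (lin (b n)) h))).
    { replace (fmul (lin (b n)) h) with (fmul u w'); auto.
      apply functional_extensionality. intros z. unfold fmul, h, u, un, U, fmul, lin, kern.
      destruct (classic (disk z)) as [Hz | Hz].
      - rewrite !restr_in by auto. rewrite (plim_drop_at d s eta n) by (auto; lra). unfold d at 1. field.
        apply Cmod_gt_0. assert (T := kern_dist a z Ha). unfold disk in Hz. lra.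
      - rewrite !restr_out by auto. ring. }
    rewrite (annihilator_resolvent p M phi g w (b n) h) by auto.
    apply HB; [apply Fp_mul; auto | repeat apply Rmult_le_pos; auto|].
    intros z Hz.
    replace (fmul w h z) with (fmul w w' z * un z * kern a z)%C by (unfold fmul, h, fmul; ring).
    rewrite !Cmod_mult. set (x := gr p (Cmod z)).
    replace (K1 * K2 * K3 * exp (eps * x))
      with (K1 * exp (eps / 3 * x) * (K2 * exp (eps / 3 * x)) * (K3 * exp (eps / 3 * x))).
    - apply Rmult_le_compat; [apply Rmult_le_pos; apply Cmod_ge_0 | apply Cmod_ge_0 | | apply HK3z; auto].
      apply Rmult_le_compat; [apply Cmod_ge_0 | apply Cmod_ge_0 | apply HK1z; auto |].
      unfold un, U. rewrite restr_in by auto. apply HK2z; auto. apply drop_at_bound, Hd.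
    - replace (eps * x) with (eps / 3 * x + eps / 3 * x + eps / 3 * x) by field. rewrite !exp_plus. ring. }
  set (B := K0 * (K1 * K2 * K3)) in *.
  destruct (nfloor_ex (Rmax B 0)) as [n Hn]; [apply Rmax_r|].
  assert (T1 := Bound (S n)). assert (T2 := proj2 (Hb2 (S n))). rewrite S_INR in T2.
  assert (T3 := Rmax_l B 0). lra.
Qed.

(** Two applications of the resolvent identity give the remainder (b-a)^2 phi(w g_a g_a g_b), so
    local boundedness for the function w g_a g_a is enough, and phi(w g_a g_a) is the derivative. *)
Lemma resolvent_cderiv p M phi g w a : 1 < p -> Fp_maximal_ideal p M -> annihilator p M phi ->
  resolvent p M g -> Fp p w -> exists l, cderiv (fun b => phi (fmul w (g b))) a l.
Proof.
  intros Hp1 Hmax Hphi Hg Hw. assert (Hp : 0 < p) by lra. assert (HI := proj1 (proj1 Hmax)).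
  assert (Fga : Fp p (g a)) by apply Hg.
  set (w1 := fmul w (g a)). assert (Fw1 : Fp p w1) by (apply Fp_mul; auto).
  set (w2 := fmul w1 (g a)). assert (Fw2 : Fp p w2) by (apply Fp_mul; auto).
  assert (HBd : exists d K, 0 < d /\ forall b, Cmod (b - a) < d -> Cmod (phi (fmul w2 (g b))) <= K).
  { destruct (Rlt_le_dec (Cmod a) 1) as [H | H].
    - apply (resolvent_bounded_inside p M); auto.
    - apply (resolvent_bounded_outside p M); auto. }
  destruct HBd as (d & K & Hd & HK).
  assert (HK0 : 0 <= K).
  { eapply Rle_trans; [apply Cmod_ge_0 | apply (HK a)].
    replace (a - a)%C with (RtoC 0) by ring. rewrite Cmod_0. exact Hd. }
  exists (phi (fmul w1 (g a))). intros eps He.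
  exists (Rmin d (eps / (K + 1))). split; [apply Rmin_pos; auto; apply Rdiv_lt_0_compat; lra|].
  intros b Hb. destruct (Rmin_Rgt_l _ _ _ Hb) as [Hb1 Hb2].
  assert (E1 := resolvent_identity p M phi g w b a Hp HI Hphi Hg Hw). fold w1 in E1.
  assert (E2 := resolvent_identity p M phi g w1 b a Hp HI Hphi Hg Fw1). fold w2 in E2.
  fold w1 w2.
  replace (phi (fmul w (g b)) - phi w1 - (b - a) * phi w2)%C
    with ((b - a) * ((b - a) * phi (fmul w2 (g b))))%C by (rewrite E1, <- E2; ring).
  rewrite !Cmod_mult, (Rmult_comm eps). apply Rmult_le_compat_l; [apply Cmod_ge_0|].
  apply Rle_trans with (eps / (K + 1) * (K + 1)).
  - apply Rmult_le_compat; auto using Cmod_ge_0; [lra|]. specialize (HK b Hb1). lra.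
  - right. field. lra.
Qed.

(** Outside the closed disk 1/(z - a) itself is the inverse, and a/(z - a) + 1 = z/(z - a) is
    uniformly of order 1/(|a| - 1) on the disk. *)
Lemma resolvent_at_infinity p M phi g : 1 < p -> Fp_ideal p M -> annihilator p M phi -> resolvent p M g ->
  exists K, 0 <= K /\ forall a, 1 < Cmod a ->
    Cmod (a * phi (fmul fone (g a)) + phi fone) <= K * / (Cmod a - 1).
Proof.
  intros Hp1 HI Hphi Hg. assert (Hp : 0 < p) by lra. assert (F1 := Fp_one p Hp).
  assert (Hphi' := Hphi). destruct Hphi' as (Hadd & Hsc & HM & H1 & eps & K0 & He & HK0 & HB).
  exists K0. split; auto. intros a Ha.
  assert (Fk := Fp_kern p a Hp ltac:(lra)).
  rewrite (annihilator_resolvent p M phi g fone a (kern a)); auto.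
  2:{ rewrite lin_kern by lra. replace (fsub fone fone) with fzero; [apply HI|].
      apply functional_extensionality. intros z. unfold fsub, fzero. ring. }
  assert (F1k : Fp p (fmul fone (kern a))) by (apply Fp_mul; auto).
  rewrite <- Hsc, <- Hadd by (auto; apply Fp_scal; auto).
  assert (Pa : 0 < / (Cmod a - 1)) by (apply Rinv_0_lt_compat; lra).
  apply HB; [apply Fp_add; auto; apply Fp_scal; auto | lra|].
  intros z Hz. unfold fadd, fmul, fone, kern. rewrite !restr_in by auto.
  assert (D : Cmod a - 1 <= Cmod (z - a)).
  { assert (T := Cmod_minus_ge a z). rewrite Cmod_minus_sym in T. unfold disk in Hz. lra. }
  assert (N : (z - a)%C <> RtoC 0) by (apply Cmod_gt_0; lra).
  replace (a * (1 * / (z - a)) + 1)%C with (z / (z - a))%C by (field; auto).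
  assert (G1 := exp_gr_ge_1 p eps (Cmod z) He).
  eapply Rle_trans; [apply (Cmod_div_le z (z - a)%C 1 (Cmod a - 1)); auto; unfold disk in Hz; lra|].
  unfold Rdiv. rewrite Rmult_1_l, <- (Rmult_1_r (/ (Cmod a - 1))) at 1. apply Rmult_le_compat_l; lra.
Qed.

(* Otherwise [a * phi (g a)] is entire, so its circular means are constant; they tend to 0 at the origin
   and to [- phi fone] at infinity. *)
Lemma closed_maximal_contains_lin p M : 1 < p -> Fp_maximal_ideal p M -> Fp_closed p M ->
  exists a, disk a /\ M (lin a).
Proof.
  intros Hp1 Hmax Hcl. assert (Hp : 0 < p) by lra. assert (HPI := PI_RGT_0).
  assert (HI := proj1 (proj1 Hmax)). assert (N1 := one_not_in p M (proj1 Hmax)).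
  destruct (ideal_functional p M Hp HI Hcl N1) as (phi & Hphi).
  apply NNPP. intros HN.
  assert (Hlin : forall a, ~ M (lin a)).
  (* For |a| >= 1 the function z - a is a unit of F^p and cannot lie in a proper ideal. *)
  { intros a Ma. destruct (Rlt_le_dec (Cmod a) 1) as [H | H]; [apply HN; exists a; auto|].
    apply N1. rewrite <- (lin_kern a H).
    replace (fmul (lin a) (kern a)) with (fmul (kern a) (lin a))
      by (apply functional_extensionality; intros z; unfold fmul; ring).
    apply HI; auto. apply Fp_kern; auto. }
  assert (Hinv := fun a => maximal_inverse p M (lin a) Hp Hmax (Fp_lin p a Hp) (Hlin a)).
  set (g := fun a => proj1_sig (constructive_indefinite_description _ (Hinv a))).
  assert (Hg : resolvent p M g).
  { intros a. exact (proj2_sig (constructive_indefinite_description _ (Hinv a))). }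
  assert (F1 := Fp_one p Hp).
  set (Rs := fun a => phi (fmul fone (g a))).
  set (F := fun a => (a * Rs a)%C).
  assert (HF : forall a, exists l, cderiv F a l).
  { intros a. destruct (resolvent_cderiv p M phi g fone a Hp1 Hmax Hphi Hg F1) as [l Hl].
    eexists. apply cderiv_mult; [apply cderiv_id | exact Hl]. }
  destruct (resolvent_at_infinity p M phi g Hp1 HI Hphi Hg) as (K & HK & HKinf).
  destruct (resolvent_bounded_inside p M phi g fone 0 Hp HI Hphi Hg F1) as (d & K' & Hd & HK').
  { unfold disk. rewrite Cmod_0. lra. }
  assert (Nphi : phi fone <> RtoC 0) by apply Hphi.
  apply Nphi, Cmod_eq_0, Rle_antisym; [|apply Cmod_ge_0].
  apply le_epsilon. intros eps He. rewrite Rplus_0_l.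
  set (H := fun x y => F (polar x y)).
  assert (Hder : forall x y, exists l, hderiv H x y l).
  { intros x y. destruct (HF (polar x y)) as [l Hl]. eexists. apply (hderiv_comp F); [exact Hl | apply hderiv_polar]. }
  assert (Hpc : forall x y, pcont (H x) y).
  { intros x y. destruct (Hder x y) as [l Hl]. apply hcont_pcont_y, (hderiv_hcont _ _ _ _ Hl). }
  (* On this circle the function is at most eps/4, and on the circle of radius [rho2] it is within
     eps/4 of -phi(1). Each integral then errs by at most pi eps, together 2 pi eps. [Rabs] is there
     because K' carries no sign information. *)
  set (rho1 := Rmin (d / 2) (eps / (4 * (Rabs K' + 1)))).
  assert (PK' := Rabs_pos K'). assert (LK' := Rle_abs K').
  assert (Hrho1 : 0 < rho1) by (apply Rmin_pos; [lra | apply Rdiv_lt_0_compat; lra]).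
  set (rho2 := 2 + rho1 + 4 * K / eps).
  assert (Hq : 0 <= 4 * K / eps) by (apply Rmult_le_pos; [lra | left; apply Rinv_0_lt_compat; lra]).
  assert (Hrho2 : 0 < rho2) by (unfold rho2; lra).
  assert (E1 : exp (ln rho1) = rho1) by (apply exp_ln; auto).
  assert (E2 : exp (ln rho2) = rho2) by (apply exp_ln; auto).
  assert (Hle : ln rho1 <= ln rho2) by (left; apply ln_increasing; auto; unfold rho2; lra).
  assert (J := mean2pi_const H (ln rho1) (ln rho2) Hle
     ltac:(intros x y; unfold H; rewrite polar_periodic; reflexivity) (fun x y _ => Hder x y)).
  assert (J1 : Cmod (mean2pi H (ln rho1)) <= 2 * (eps / 4) * (2 * PI - 0)).
  { apply Cint_bound; [lra | intros t _; apply Hpc|]. intros t _. unfold H, F. rewrite Cmod_mult, Cmod_polar, E1.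
    assert (B : Cmod (Rs (polar (ln rho1) t)) <= K').
    { apply HK'. replace (polar (ln rho1) t - 0)%C with (polar (ln rho1) t) by ring.
      rewrite Cmod_polar, E1. assert (T := Rmin_l (d / 2) (eps / (4 * (Rabs K' + 1)))). fold rho1 in T. lra. }
    apply Rle_trans with (eps / (4 * (Rabs K' + 1)) * (Rabs K' + 1)).
    - apply Rmult_le_compat; [lra | apply Cmod_ge_0 | apply Rmin_r | lra].
    - right. field. lra. }
  assert (J2 : Cmod (mean2pi H (ln rho2) - Cint (fun _ => - phi fone)%C 0 (2 * PI)) <= 2 * (eps / 4) * (2 * PI - 0)).
  { unfold mean2pi. rewrite <- Cint_minus; [| lra | intros t _; apply Hpc | intros t _; apply pcont_const].
    apply Cint_bound; [lra | |].
    - intros t _. apply (pcont_plus (H (ln rho2)) (fun _ => - - phi fone)%C); [apply Hpc | apply pcont_const].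
    - intros t _. unfold H, F, Rs.
      assert (B := HKinf (polar (ln rho2) t)). rewrite Cmod_polar, E2 in B.
      replace (polar (ln rho2) t * phi (fmul fone (g (polar (ln rho2) t))) - - phi fone)%C
        with (polar (ln rho2) t * phi (fmul fone (g (polar (ln rho2) t))) + phi fone)%C by ring.
      eapply Rle_trans; [apply B; unfold rho2; lra|].
      assert (Hr1 : 4 * K / eps <= rho2 - 1) by (unfold rho2; lra).
      assert (Hr0 : 0 < rho2 - 1) by (unfold rho2; lra).
      apply Rmult_le_reg_r with (rho2 - 1); auto.
      rewrite Rmult_assoc, Rinv_l, Rmult_1_r by lra.
      replace K with (eps / 4 * (4 * K / eps)) at 1 by (field; lra). apply Rmult_le_compat_l; lra. }
  rewrite <- J, Cint_const in J2. rewrite Rminus_0_r in *.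
  apply Rmult_le_reg_l with (2 * PI); [lra|].
  replace (2 * PI * Cmod (phi fone)) with (Cmod (RtoC (2 * PI) * - phi fone)%C)
    by (rewrite Cmod_mult, Cmod_R, Cmod_opp, Rabs_pos_eq; lra).
  assert (T := Cmod_minus_ge (RtoC (2 * PI) * - phi fone) (mean2pi H (ln rho1))).
  rewrite Cmod_minus_sym in T. lra.
Qed.

Theorem theorem8 (p : R) (hp : 1 < p) (M : (C -> C) -> Prop)
  (hM : Fp_maximal_ideal p M) (hclosed : Fp_closed p M) :
  exists lambda : C, disk lambda /\ forall f : C -> C, M f <-> M_at p lambda f.
Proof.
  assert (Hp : 0 < p) by lra.
  assert (HI := proj1 (proj1 hM)). assert (N1 := one_not_in p M (proj1 hM)).
  destruct (closed_maximal_contains_lin p M hp hM hclosed) as (a & Ha & Ma).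
  assert (Hsub : forall f, M_at p a f -> M f).
  { intros f [Hf Hfa]. destruct (Fp_division p f a Hp Hf Ha) as (q & Fq & Eq).
    replace f with (fmul q (lin a)); [apply HI; auto|].
    apply eq_on_disk.
    - intros z Hz. unfold fmul. rewrite (proj1 Fq z Hz). ring.
    - apply Hf.
    - intros z Hz. unfold fmul, lin. rewrite restr_in by auto.
      replace (f z) with (f z - f a)%C by (rewrite Hfa; ring). rewrite Eq by auto. ring. }
  exists a. split; auto. intros f. split; [|apply Hsub].
  intros Mf. assert (Ff : Fp p f) by (apply HI, Mf). split; auto.
  (* If f(a) were nonzero, f and f - f(a) would both lie in M, hence also their difference, an
     invertible constant. *)
  apply NNPP. intros Nfa. apply N1.
  assert (Fc : Fp p (restr (fun _ => f a))) by (apply Fp_const; auto).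
  assert (Md : M (fadd f (fun z => - RtoC 1 * restr (fun _ => f a) z)%C)).
  { apply Hsub. split.
    - apply Fp_add; auto. apply Fp_scal; auto.
    - unfold fadd. rewrite restr_in by auto. ring. }
  assert (Mc := ideal_sub p M _ _ Hp HI Mf Md).
  replace fone with (fun z => / f a * fsub f (fadd f (fun z => - RtoC 1 * restr (fun _ => f a) z)) z)%C.
  - apply (ideal_scal p); auto.
  - apply functional_extensionality. intros z. unfold fsub, fadd, fone.
    destruct (classic (disk z)) as [Hz | Hz].
    + rewrite !restr_in by auto. field. auto.
    + rewrite !restr_out by auto. ring.
Qed.
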